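(* Let $d\ge 3$ be an odd integer and $\gamma>0$. There are positive constants $C_1,C_2,C_3$, depending at most on $d$ and $\gamma$, such that for all integers $m\ge 2$, with $1/q+1/q'=1$, $$\nu_m(W_p^\gamma,\Xi,L_q)\ \ge\ C_1\,m^{-\gamma/d}\,\bigl(p^{1/2}\,2^{C_2 (q')^{1/2}}\bigr)^{-C_3}\qquad\text{if } 1<q,p<\infty,$$ and $$\nu_m(W_\infty^\gamma,\Xi,L_q)\ \ge\ C_1\,m^{-\gamma/d}\,\bigl((\log m)^{1/2}\,2^{C_2 (q')^{1/2}}\bigr)^{-C_3}\qquad\text{if } p=\infty,\ q>1.$$
   Context: $\mathbb{S}^d(\mathbb{C})=\{\mathbf{z}\in\mathbb{C}^{n}: |\mathbf{z}|=1\}$ is the unit sphere of $\mathbb{C}^n$, where $d=2n-1$ is its real dimension ($d=3,5,\dots$), considered as a compact Riemannian manifold with normalized volume element $\nu$. $L_p=L_p(\mathbb{S}^d(\mathbb{C}),\nu)$ is the real Banach space of (real-valued) functions with the usual norm $\|\cdot\|_p$, $1\le p\le\infty$. The Laplace–Beltrami operator (with nonnegative sign convention) has eigenvalues $\theta_k=k(k+d-1)$, $k=0,1,2,\dots$, with finite-dimensional, mutually $L_2$-orthogonal eigenspaces $\mathrm{H}_k$; $d_k=\dim\mathrm{H}_k$, and $\{Y_m^k\}_{m=1}^{d_k}$ is a fixed orthonormal basis of $\mathrm{H}_k$ (in $L_2$). For $\phi\in L_p$ put $c_{k,m}(\phi)=\int\phi\,Y_m^k\,d\nu$. Sobolev class: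 for $\gamma>0$, $W_p^\gamma$ is the set of functions $\phi_\gamma$ with formal Fourier expansion $\phi_\gamma\sim c+\sum_{k\in\mathbb{N}}\theta_k^{-\gamma/2}\sum_{m=1}^{d_k}c_{k,m}(\phi)\,Y_m^k$, where $c\in\mathbb{R}$, $\|\phi\|_p\le 1$ and $\int\phi\,d\nu=0$; here $\mathbb{N}=\{1,2,\dots\}$. $m$-term approximation: $\Xi=\{\xi_k\}_{k\in\mathbb{N}}$ is the orthonormal system of harmonics on $\mathbb{S}^d(\mathbb{C})$, i.e. the sequence enumerating all $Y_j^k$, $k\ge0$, $1\le j\le d_k$ (listed in order of nondecreasing $k$). For $\Omega_m=\{k_1<\cdots<k_m\}\subset\mathbb{N}$ let $\Xi(\Omega_m)=\mathrm{lin}\{\xi_{k_l}\}_{l=1}^m$. For a set $\mathcal{K}$ of functions and a Banach space $X$, $$\nu_m(\mathcal{K},\Xi,X)=\sup_{\phi\in\mathcal{K}}\ \inf_{\Omega_m\subset\mathbb{N}}\ \inf_{\xi\in\Xi(\Omega_m)}\|\phi-\xi\|_X ,$$ with the convention $\|\cdot\|_X=+\infty$ outside $X$. *)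

(* Defs.v *)
From HB Require Import structures.
From mathcomp Require Import all_boot all_order all_algebra.
From mathcomp Require Import complex.
From mathcomp Require Import all_classical all_reals all_analysis.
From mathcomp Require Import measurable_realfun.

Set Implicit Arguments.
Unset Strict Implicit.
Unset Printing Implicit Defensive.

Import Order.TTheory GRing.Theory Num.Theory.
Import numFieldNormedType.Exports.

Local Open Scope classical_set_scope.
Local Open Scope ring_scope.

(** Lebesgue measure on R^N, with R^N represented by N.-tuple R carrying the
    product sigma-algebra. *)

Section cons_measure.
Local Open Scope ereal_scope.
Context {R : realType} {N : nat}.
Local Notation RN := (N.-tuple (measurableTypeR R)).
Local Notation RN1 := (N.+1.-tuple (measurableTypeR R)).
Variable mu : {sigma_finite_measure set RN -> \bar R}.

Definition cons_pair (xt : measurableTypeR R * RN) : RN1 :=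
  [the N.+1.-tuple _ of xt.1 :: xt.2].

Lemma measurable_cons_pair :
  measurable_fun [set: (measurableTypeR R * RN)%type] cons_pair.
Proof. exact: measurable_cons. Qed.

Let measurable_preim (A : set RN1) : measurable A ->
  measurable (cons_pair @^-1` A).
Proof. by move=> mA; rewrite -[X in measurable X]setTI; exact: measurable_cons_pair. Qed.

Definition cons_measure (A : set RN1) : \bar R :=
  (@lebesgue_measure R \x mu) (cons_pair @^-1` A).

Let cons_measure0 : cons_measure set0 = 0.
Proof. by rewrite /cons_measure preimage_set0 measure0. Qed.

Let cons_measure_ge0 A : 0 <= cons_measure A.
Proof. exact: measure_ge0. Qed.

Let cons_measure_sigma_additive : semi_sigma_additive cons_measure.
Proof.
move=> F mF tF mUF; rewrite /cons_measure preimage_bigcup.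
apply: measure_semi_sigma_additive.
- by move=> n; exact: measurable_preim.
- apply/trivIsetP => /= i j _ _ ij; rewrite -preimage_setI.
  by move/trivIsetP : tF => /(_ _ _ _ _ ij) ->//; rewrite preimage_set0.
- by rewrite -preimage_bigcup; exact: measurable_preim.
Qed.

HB.instance Definition _ := isMeasure.Build _ _ _ cons_measure
  cons_measure0 cons_measure_ge0 cons_measure_sigma_additive.

Let cons_measure_sigma_finite : sigma_finite setT cons_measure.
Proof.
have /sigma_finiteP[F [TF ndF Foo]] := sigma_finiteT (@lebesgue_measure R).
have /sigma_finiteP[G [TG ndG Goo]] := sigma_finiteT mu.
pose uncons (t : RN1) : measurableTypeR R * RN := (thead t, [tuple of behead t]).
have munc : measurable_fun [set: RN1] uncons.
  by apply/measurable_fun_pairP; split;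
    [exact: measurable_tnth | exact: measurable_behead].
exists (fun n => uncons @^-1` (F n `*` G n)).
  apply/esym; rewrite -subTset => t _.
  have [k _ Fk] : (\bigcup_i F i) (thead t) by rewrite -TF.
  have [l _ Gl] : (\bigcup_i G i) [tuple of behead t] by rewrite -TG.
  exists (maxn k l) => //; split => /=.
    by move: (thead t) Fk; exact/subsetPset/ndF/leq_maxl.
  by move: [tuple of behead t] Gl; exact/subsetPset/ndG/leq_maxr.
move=> n; have [mF Ffin] := Foo n; have [mG Gfin] := Goo n.
have mFG : measurable (F n `*` G n) by exact: measurableX.
split; first by rewrite -[X in measurable X]setTI; exact: munc.
rewrite /= /cons_measure -comp_preimage (_ : uncons \o cons_pair = id).
  by rewrite product_measure1E// lte_mul_pinfty// ge0_fin_numE.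
by apply/funext => -[x t] /=; congr pair; exact/val_inj.
Qed.

HB.instance Definition _ := Measure_isSigmaFinite.Build _ _ _ cons_measure
  cons_measure_sigma_finite.

End cons_measure.

Fixpoint lebesgue_tuple (R : realType) (N : nat) :
    {sigma_finite_measure set (N.-tuple (measurableTypeR R)) -> \bar R} :=
  match N with
  | 0%N => [the {sigma_finite_measure set _ -> \bar R} of
             \d_([tuple] : 0.-tuple (measurableTypeR R))]
  | N'.+1 => [the {sigma_finite_measure set _ -> \bar R} of
             cons_measure (lebesgue_tuple R N')]
  end.

Section lebesgue_tuple_box.
Local Open Scope ereal_scope.
Context {R : realType}.

Definition tuple_box (N : nat) (A : set (measurableTypeR R)) :
    set (N.-tuple (measurableTypeR R)) := [set t | forall i, A (tnth t i)].
Arguments tuple_box : clear implicits.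

Lemma measurable_tuple_box N A : measurable A -> measurable (tuple_box N A).
Proof.
move=> mA; rewrite (_ : tuple_box N A =
    \bigcap_(i in [set: 'I_N]) ((@tnth _ _)^~ i @^-1` A)).
  apply: fin_bigcap_measurable => // i _.
  by rewrite -[X in measurable X]setTI; exact: measurable_tnth.
by apply/seteqP; split => [t At i _|t At i]; [exact: At|exact: (At i I)].
Qed.

Lemma lebesgue_tuple_box N A : measurable A ->
  lebesgue_tuple R N (tuple_box N A) = (@lebesgue_measure R A) ^+ N.
Proof.
move=> mA; elim: N => [|N ih].
  by rewrite /= diracE mem_set//= => -[].
rewrite expeS -ih [LHS]/= /cons_measure (_ : _ @^-1` _ = A `*` tuple_box N A).
  by rewrite product_measure1E//; exact: measurable_tuple_box.
apply/seteqP; split => -[x t] /=.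
  move=> h; split => [|i]; first exact: (h ord0).
  by have := h (lift ord0 i); rewrite tnthS.
move=> [Ax At] i; case: (unliftP ord0 i) => [j ->|-> //].
by rewrite tnthS.
Qed.

End lebesgue_tuple_box.
Arguments tuple_box {R} N A _.

Section complex_sphere.
Context {R : realType}.

(* C^m = R^(2m), z = x + iy being sent to the concatenation (x, y) *)
Definition realify (m : nat) (z : 'rV[R[i]]_m) : 'rV[R]_(m + m) :=
  row_mx (map_mx (@complex.Re R) z) (map_mx (@complex.Im R) z).

Definition complexify (m : nat) (v : 'rV[R]_(m + m)) : 'rV[R[i]]_m :=
  \row_j Complex (lsubmx v 0 j) (rsubmx v 0 j).

(* the norm of the normed module 'rV[R]_N is the sup norm *)
Definition enorm (N : nat) (v : 'rV[R]_N) : R :=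
  Num.sqrt (\sum_(i < N) v 0 i ^+ 2).

(* the unit sphere of C^(n+1), of real dimension 2n+1 *)
Definition sphere (n : nat) : Type :=
  {z : 'rV[R[i]]_n.+1 | \sum_(j < n.+1) `|z 0 j| ^+ 2 == 1}.

End complex_sphere.
Arguments sphere R n : clear implicits.

Section sphere_measurable.
Context {R : realType} {n : nat}.
Local Notation N := (n.+1 + n.+1)%N.

HB.instance Definition _ := Choice.on (sphere R n).

Let sphere_point_subproof :
  \sum_(j < n.+1) `|(delta_mx 0 0 : 'rV[R[i]]_n.+1) 0 j| ^+ 2 == 1.
Proof.
rewrite (bigD1 ord0)//= mxE !eqxx normr1 expr1n big1 ?addr0// => j j0.
by rewrite mxE (negbTE j0) andbF normr0 expr0n.
Qed.

Definition sphere_point : sphere R n :=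
  exist _ (delta_mx 0 0) sphere_point_subproof.

HB.instance Definition _ := isPointed.Build (sphere R n) sphere_point.

Definition sphere_coord (i : 'I_N) (z : sphere R n) : measurableTypeR R :=
  realify (val z) 0 i.

Let sphere_measurable := g_sigma_preimage sphere_coord.

Let sphere_measurable0 : sphere_measurable set0.
Proof. exact: sigma_algebra0. Qed.

Let sphere_measurableC A : sphere_measurable A -> sphere_measurable (~` A).
Proof. exact: sigma_algebraC. Qed.

Let sphere_measurable_bigcup (F : _^nat) : (forall i, sphere_measurable (F i)) ->
  sphere_measurable (\bigcup_i (F i)).
Proof. exact: sigma_algebra_bigcup. Qed.

Definition sphere_display : measure_display. Proof. exact. Qed.

HB.instance Definition _ := @isMeasurable.Build sphere_display (sphere R n)
  sphere_measurable sphere_measurable0 sphere_measurableC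
  sphere_measurable_bigcup.

(* v |-> v / |v|; the value at v = 0 is a dummy *)
Definition radial (v : 'rV[R]_N) : sphere R n :=
  insubd sphere_point (complexify ((enorm v)^-1 *: v)).

Definition row_of_tuple (t : N.-tuple (measurableTypeR R)) : 'rV[R]_N :=
  \row_i tnth t i.

Lemma measurable_sphere_coordP d (T : measurableType d) (f : T -> sphere R n) :
  (forall i, measurable_fun [set: T] (sphere_coord i \o f)) ->
  measurable_fun [set: T] f.
Proof.
move=> mf; apply: measurability => //.
move=> _ [A +] <-; rewrite -bigcup_seq => -[i _ [B mB] <-].
by rewrite !setTI -comp_preimage -[X in measurable X]setTI; exact: mf.
Qed.

Lemma realify_norm m (z : 'rV[R[i]]_m) :
  (\sum_i realify z 0 i ^+ 2)%:C%C = \sum_j `|z 0 j| ^+ 2.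
Proof.
rewrite big_split_ord/= -big_split/= rmorph_sum; apply: eq_bigr => j _.
rewrite row_mxEl row_mxEr !mxE. by rewrite -[RHS]add_Re2_Im2.
Qed.

Lemma complexifyK m : cancel (@complexify R m) (@realify R m).
Proof.
move=> v; rewrite -[RHS]hsubmxK; congr row_mx; apply/rowP => j; by rewrite !mxE.
Qed.

Lemma val_radial (v : 'rV[R]_N) : realify (val (radial v)) =
  if enorm v == 0 then realify (val sphere_point) else (enorm v)^-1 *: v.
Proof.
have c1 (x : R) : (x%:C%C == 1 :> R[i]) = (x == 1).
  by rewrite eq_complex /= eqxx andbT.
rewrite /radial val_insubd -realify_norm complexifyK.
have vE : \sum_i v 0 i ^+ 2 = enorm v ^+ 2.
  by rewrite sqr_sqrtr// sumr_ge0// => i _; rewrite sqr_ge0.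
have -> : \sum_i ((enorm v)^-1 *: v) 0 i ^+ 2 = (enorm v)^-1 ^+ 2 * enorm v ^+ 2.
  by rewrite -vE mulr_sumr; apply: eq_bigr => i _; rewrite mxE exprMn.
case: (eqVneq (enorm v) 0) => [->|v0].
  by rewrite invr0 expr0n mul0r c1 eq_sym oner_eq0.
by rewrite -exprMn mulVf// expr1n eqxx complexifyK.
Qed.

Let measurable_enorm :
  measurable_fun [set: N.-tuple (measurableTypeR R)] (@enorm R N \o row_of_tuple).
Proof.
rewrite (_ : _ \o _ = fun t => (\sum_(i < N) (tnth t i : R) ^+ 2) `^ 2^-1).
  apply: (measurableT_comp (measurable_powR _)).
  by apply: measurable_sum => i; apply: measurable_funX; exact: measurable_tnth.
apply/funext => t /=; rewrite powR12_sqrt ?sumr_ge0// => [|i _]; last exact: sqr_ge0.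
by congr Num.sqrt; apply: eq_bigr => i _; rewrite mxE.
Qed.

Lemma measurable_radial :
  measurable_fun [set: N.-tuple (measurableTypeR R)] (radial \o row_of_tuple).
Proof.
apply: measurable_sphere_coordP => i.
rewrite (_ : _ \o _ = fun t => if (@enorm R N \o row_of_tuple) t == 0
    then realify (val sphere_point) 0 i
    else (@enorm R N \o row_of_tuple) t `^ (-1) * (tnth t i : R)).
  apply: measurable_fun_ifT => //.
    exact: measurable_fun_eqr.
  apply: measurable_funM; last exact: measurable_tnth.
  exact: (measurableT_comp (measurable_powR _)).
apply/funext => t /=; rewrite /sphere_coord val_radial; case: ifP => // _.
by rewrite powR_inv1 ?sqrtr_ge0// !mxE.
Qed.

Definition punctured_ball : set (N.-tuple (measurableTypeR R)) :=
  [set t | 0 < enorm (row_of_tuple t) <= 1].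

Lemma measurable_punctured_ball : measurable punctured_ball.
Proof.
rewrite -[X in measurable X]setTI.
rewrite (_ : punctured_ball = (@enorm R N \o row_of_tuple) @^-1` `]0, 1]%classic).
  exact: measurable_enorm.
by apply/seteqP; split => t /=; rewrite in_itv.
Qed.

Lemma punctured_ball_gt0 : (0 < lebesgue_tuple R N punctured_ball)%E.
Proof.
pose A : set (measurableTypeR R) := `]0, N%:R^-1]%classic.
have N0 : (0 : R) < N%:R by rewrite ltr0n.
have mA : measurable A by exact: measurable_itv.
apply: (@lt_le_trans _ _ (lebesgue_tuple R N (tuple_box N A))).
  have lA : @lebesgue_measure R A = (N%:R^-1)%:E.
    by rewrite lebesgue_measure_itv/= lte_fin invr_gt0 N0 oppr0 adde0.
  by rewrite lebesgue_tuple_box// lA -EFin_expe lte_fin exprn_gt0// invr_gt0.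
apply: le_measure; rewrite ?inE.
- exact: measurable_tuple_box.
- exact: measurable_punctured_ball.
move=> t At.
have ht i : 0 < (tnth t i : R) <= N%:R^-1 by have := At i; rewrite /A/= in_itv.
rewrite /punctured_ball/= /enorm.
rewrite sqrtr_gt0 -[X in _ && (_ <= X)]sqrtr1 ler_sqrt//; apply/andP; split.
  rewrite (bigD1 ord0)//= ltr_pwDl//.
    by rewrite mxE exprn_gt0//; case/andP: (ht ord0).
  by apply: sumr_ge0 => i _; exact: sqr_ge0.
apply: (@le_trans _ _ (\sum_(i < N) N%:R^-1)).
  apply: ler_sum => i _; rewrite mxE.
  have /andP[t0 t1] := ht i; apply: le_trans t1; rewrite expr2.
  rewrite ler_piMl ?(ltW t0)//; have /andP[_ t1] := ht i.
  by apply: le_trans t1 _; rewrite invf_le1// ler1n.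
by rewrite sumr_const card_ord -[_ *+ _]mulr_natl mulfV// gt_eqF.
Qed.

Lemma punctured_ball_lty : (lebesgue_tuple R N punctured_ball < +oo)%E.
Proof.
pose A : set (measurableTypeR R) := `[-1, 1]%classic.
have mA : measurable A by exact: measurable_itv.
apply: (@le_lt_trans _ _ (lebesgue_tuple R N (tuple_box N A))); last first.
  have lA : @lebesgue_measure R A = (1 + 1)%:E.
    by rewrite lebesgue_measure_itv/= lte_fin gtrN// opprK.
  by rewrite lebesgue_tuple_box// lA -EFin_expe ltry.
apply: le_measure; rewrite ?inE.
- exact: measurable_punctured_ball.
- exact: measurable_tuple_box.
move=> t /andP[_ t1] i; rewrite /A/= in_itv/= -ler_norml; apply: le_trans t1.
rewrite -sqrtr_sqr ler_sqrt; last by apply: sumr_ge0 => j _; exact: sqr_ge0.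
by rewrite (bigD1 i)//= mxE lerDl; apply: sumr_ge0 => j _; exact: sqr_ge0.
Qed.

(* Normalized Riemannian volume: by polar coordinates, dx = r^(N-1) dr dsigma,
   the surface measure of A is N times the Lebesgue measure of the cone
   {x | 0 < |x| <= 1, x / |x| \in A}. *)
Definition sphere_vol (A : set (sphere R n)) : \bar R :=
  (((fine (lebesgue_tuple R N punctured_ball))^-1)%:E *
   lebesgue_tuple R N (punctured_ball `&` (radial \o row_of_tuple) @^-1` A))%E.

Let measurable_cone A : measurable A ->
  measurable (punctured_ball `&` (radial \o row_of_tuple) @^-1` A).
Proof.
move=> mA; apply: measurableI; first exact: measurable_punctured_ball.
by rewrite -[X in measurable X]setTI; exact: measurable_radial.
Qed.

Let factor_ge0 : (0 <= ((fine (lebesgue_tuple R N punctured_ball))^-1)%:E)%E.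
Proof. by rewrite lee_fin invr_ge0 fine_ge0. Qed.

Let sphere_vol0 : sphere_vol set0 = 0%E.
Proof. by rewrite /sphere_vol preimage_set0 setI0 measure0 mule0. Qed.

Let sphere_vol_ge0 A : (0 <= sphere_vol A)%E.
Proof. by rewrite /sphere_vol mule_ge0. Qed.

Let sphere_vol_sigma_additive : semi_sigma_additive sphere_vol.
Proof.
move=> F mF tF mUF; rewrite /sphere_vol preimage_bigcup setI_bigcupr.
rewrite [X in X @ _ --> _](_ : _ = fun k =>
  (((fine (lebesgue_tuple R N punctured_ball))^-1)%:E *
   \sum_(0 <= i < k) lebesgue_tuple R N
     (punctured_ball `&` (radial \o row_of_tuple) @^-1` F i))%E); last first.
  by apply/funext => k; rewrite ge0_sume_distrr.
apply: cvgeZl => //; apply: measure_semi_sigma_additive.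
- by move=> k; exact: measurable_cone.
- apply/trivIsetP => /= i j _ _ ij; rewrite setIACA setIid -preimage_setI.
  by move/trivIsetP : tF => /(_ _ _ _ _ ij) ->//; rewrite preimage_set0 setI0.
- rewrite -setI_bigcupr -preimage_bigcup; exact: measurable_cone.
Qed.

HB.instance Definition _ := isMeasure.Build _ _ _ sphere_vol
  sphere_vol0 sphere_vol_ge0 sphere_vol_sigma_additive.

Let sphere_vol_setT : sphere_vol setT = 1%E.
Proof.
rewrite /sphere_vol preimage_setT setIT.
have := punctured_ball_gt0; have := punctured_ball_lty.
case: (lebesgue_tuple R N punctured_ball) => //= r _; rewrite lte_fin => r0.
by rewrite -EFinM mulVf// gt_eqF.
Qed.

HB.instance Definition _ := Measure_isProbability.Build _ _ _ sphere_vol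
  sphere_vol_setT.

End sphere_measurable.

Arguments sphere_vol R n : clear implicits.

Section laplace_beltrami.
Context {R : realType} {n : nat}.
Local Notation N := (n.+1 + n.+1)%N.

Definition C2_on (U : set 'rV[R]_N) (F : 'rV[R]_N -> R) : Prop :=
  forall v, U v -> {for v, continuous F} /\
    forall i : 'I_N, [/\ derivable F v (delta_mx 0 i),
      {for v, continuous ('D_(delta_mx 0 i) F)} &
      forall j : 'I_N, derivable ('D_(delta_mx 0 i) F) v (delta_mx 0 j) /\
        {for v, continuous ('D_(delta_mx 0 j) ('D_(delta_mx 0 i) F))}].

Definition laplacian (F : 'rV[R]_N -> R) (v : 'rV[R]_N) : R :=
  \sum_(i < N) 'D_(delta_mx 0 i) ('D_(delta_mx 0 i) F) v.

(* extension of f to R^N \ 0, constant along rays *)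
Definition radial_ext (f : sphere R n -> R) (v : 'rV[R]_N) : R := f (radial v).

Definition C2_sphere (f : sphere R n -> R) : Prop :=
  C2_on [set v | v != 0] (radial_ext f).

(* On the unit sphere, the (nonnegative) Laplace-Beltrami operator is minus the
   Euclidean Laplacian of the extension constant along rays. *)
Definition laplace_beltrami (f : sphere R n -> R) (z : sphere R n) : R :=
  - laplacian (radial_ext f) (realify (val z)).

Definition theta (d k : nat) : R := k%:R * (k%:R + d%:R - 1).

Definition eigenspace_LB (d k : nat) : set (sphere R n -> R) :=
  [set f | C2_sphere f /\ forall z, laplace_beltrami f z = theta d k * f z].

End laplace_beltrami.
Arguments theta R d k : clear implicits.
Arguments eigenspace_LB R n d k : clear implicits.

Section harmonics.
Context {R : realType} {n : nat}.
Variable d : nat.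
Local Notation nu := (sphere_vol R n).

Definition inner (f g : sphere R n -> R) : R := (\int[nu]_z (f z * g z))%R.

Definition orthonormal_basis (dim : nat) (H : set (sphere R n -> R))
    (Y : 'I_dim -> sphere R n -> R) : Prop :=
  [/\ forall j, H (Y j),
      forall i j, inner (Y i) (Y j) = (i == j)%:R &
      forall f, H f ->
        exists a : 'I_dim -> R, f = (fun z => \sum_(j < dim) a j * Y j z)].

Variables (dim : nat -> nat) (Y : forall k, 'I_(dim k) -> sphere R n -> R).

Definition harmonic_bases : Prop :=
  forall k, orthonormal_basis (eigenspace_LB R n d k) (@Y k).

(* xi lists the Y k j, each exactly once, in order of nondecreasing k *)
Definition harmonic_enumeration (xi : nat -> sphere R n -> R) : Prop :=
  exists e : nat -> {k : nat & 'I_(dim k)},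
    [/\ bijective e, {homo (fun i => tag (e i)) : i j / (i <= j)%N} &
        forall i, xi i = Y (tagged (e i))].

Definition fourier_coef (f : sphere R n -> R) (k : nat) (j : 'I_(dim k)) : R :=
  inner f (Y j).

Definition sobolev_class (gamma : R) (p : \bar R) : set (sphere R n -> R) :=
  [set f : sphere R n -> R | nu.-integrable setT (EFin \o f) /\
    exists (c : R) (phi : sphere R n -> R),
    [/\ measurable_fun setT phi,
        ('N[nu]_p[EFin \o phi] <= 1)%E,
        (\int[nu]_z phi z)%R = 0,
        (\int[nu]_z f z)%R = c &
        forall k (j : 'I_(dim k)), (0 < k)%N ->
          fourier_coef f j = theta R d k `^ (- (gamma / 2)) * fourier_coef phi j]].

End harmonics.

Definition lin_span (R : realType) (T : Type) (m : nat) (xi : 'I_m -> T -> R) :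
    set (T -> R) :=
  [set g | exists a : 'I_m -> R, g = (fun x => \sum_(l < m) a l * xi l x)].

(* the norm is [0, +oo]-valued: it is +oo outside the Banach space *)
Definition m_term_width (R : realType) (T : Type) (K : set (T -> R))
    (xi : nat -> T -> R) (m : nat) (norm : (T -> R) -> \bar R) : \bar R :=
  ereal_sup [set
    ereal_inf [set
      ereal_inf [set norm (phi \- g) | g in lin_span (fun l => xi (om l))]
    | om in [set om : 'I_m -> nat | {homo om : i j / (i < j)%N}]]
  | phi in K].

(* Main.v *)
Require Import Defs.
From HB Require Import structures.
From mathcomp Require Import all_boot all_order all_algebra.
From mathcomp Require Import complex.
From mathcomp Require Import all_classical all_reals all_analysis.
From mathcomp Require Import measurable_realfun ess_sup_inf.
From mathcomp Require Import ring lra zify.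

(** Fix the first D = 4Km harmonics, K a constant. For signs e, let f_e be the
    image in the Sobolev class of a * sum_i e_i xi_i, the sum being over the
    harmonics of positive degree. If g is a combination of the xi_i with i in W,
    |W| <= m, then the combination h of the xi_i with i outside W and with
    coefficients e'_i w_min / w_i is orthogonal to g, so that by Hoelder
    |f_e - g|_q >= <f_e, h> / |h|_q' = a w_min (sum_i e_i e'_i) / |h|_q'.
    Two subsets of the cube {0,1}^D at Hamming distance at least D/4 cannot both
    be large; with a union bound over W this yields one e with small |f_e|_p
    which, for every W, has a close e' (depending on W) with small |h|_q'.

    Norms of random sums are controlled by Khinchine's inequality and by the
    bound C M^d on the sum of the xi_i(z)^2 over degrees at most M. That bound,
    and the uniform norm needed when p = oo, come from the (sub-)mean value
    property, on balls of radius 1/(2M), of even powers of the harmonic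
    extensions. Finally the first D degrees are at most C D^(1/d), because
    polynomials of degree d(s-1) interpolate on a grid of s^d points of the
    sphere and restrict to sums of eigenfunctions. *)

Set Implicit Arguments.
Unset Strict Implicit.
Unset Printing Implicit Defensive.

Import Order.TTheory GRing.Theory Num.Theory.
Import numFieldNormedType.Exports.

Local Open Scope classical_set_scope.
Local Open Scope ring_scope.

(** * Measurability and integration on R^N *)

(** The obstacle is the order of choices: f_e must be fixed before W, whereas h has to avoid W. For
    a fixed W moments guarantee a good h only for half of the sign vectors, far too few for a direct
    union bound over the exponentially many W. Allowing e' to differ from e in less than D/4 places
    makes the exceptional e exponentially rare, and a large constant ratio D/m then beats the number
    of sets W. The balance of orders is this. The pairing is of order a w_min m. Sums of squares are
    at most C M^d, and M^d is at most a constant times m, so 1/a and |h|_q' are each of order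
    m^(1/2) up to powers of p and q'; m cancels and w_min, of order m^(-gamma/d), remains. Moments
    of order 2s cost a factor s, with s near p, near q', or near log m when p = oo, where m^(1/s)
    stays bounded. Eigenspaces are given only as C^2 solutions of the eigenvalue equation, through
    extensions constant along rays. These are singular at the origin, so every integration by parts
    stays away from 0. *)

Lemma measurable_fun_countable d (T : measurableType d) (I : countType)
    d' (U : measurableType d') (j : T -> I) (h : I -> U) :
  (forall z, measurable (j @^-1` [set z])) -> measurable_fun [set: T] (h \o j).
Proof.
move=> mj _ Y mY; rewrite setTI.
rewrite (_ : _ @^-1` _ =
    \bigcup_z (if `[<Y (h z)>] then j @^-1` [set z] else set0)).
  apply: countable_bigcupT_measurable => [|z]; first exact: countableP.
  by case: ifP => // _; exact: measurable0.
apply/seteqP; split => [t /= Yt|t [z _]].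
  by exists (j t) => //; rewrite asboolT.
by case: asboolP => //= Yz jt; rewrite jt.
Qed.

Section grid.
Context {R : realType} {N : nat}.

Definition grid_round (k : nat) (v : 'rV[R]_N) : 'rV[R]_N :=
  \row_i ((Num.floor (v 0 i * k.+1%:R))%:~R / k.+1%:R).

Lemma cvg_grid_round (v : 'rV[R]_N) : grid_round k v @[k --> \oo] --> v.
Proof.
apply/cvgrPdist_le => e e0.
near=> k.
rewrite /Num.norm/= mx_normrE; apply/bigmax_leP; split; first exact: ltW.
move=> [i j] _ /=; rewrite ord1 !mxE.
have k0 : (0:R) < k.+1%:R by rewrite ltr0n.
rewrite -[X in X - _](mulfK (lt0r_neq0 k0)) -mulrBl normrM normfV.
rewrite (ger0_norm (ltW k0)) ler_pdivrMr//.
have /andP[f1 f2] := floor_itv (v 0 j * k.+1%:R).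
apply: (@le_trans _ _ 1).
  rewrite ger0_norm ?subr_ge0//; rewrite lerBlDl.
  by move: f2; rewrite intrD => /ltW.
rewrite mulrC -ler_pdivrMr// mul1r.
near: k.
have [m _ hm] := near_infty_natSinv_lt (PosNum e0).
exists m => // k /= mk; apply/ltW; rewrite invf_plt ?posrE//; exact: hm k mk.
Unshelve. all: by end_near. Qed.

(** [G \o f] is the pointwise limit of [G] at the points [grid_round k (f t)]. Each approximant
    factors through the countable type of integer vectors, so its measurability asks nothing of [G].
    Continuity is required at the values of [f] only, which later allows [G] to be singular at the
    origin. *)
Lemma measurable_continuous_coord d (T : measurableType d) (f : T -> 'rV[R]_N)
    (G : 'rV[R]_N -> R) :
  (forall i, measurable_fun [set: T] (fun t => f t 0 i)) ->
  (forall t, {for f t, continuous G}) -> measurable_fun [set: T] (G \o f).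
Proof.
move=> mf cG.
pose j k t : {ffun 'I_N -> int} := [ffun i => Num.floor (f t 0 i * k.+1%:R)].
pose h k (z : {ffun 'I_N -> int}) : R := G (\row_i ((z i)%:~R / k.+1%:R)).
apply: (@measurable_fun_cvg _ _ _ _ (fun k => h k \o j k)).
  move=> k; apply: measurable_fun_countable => z.
  rewrite (_ : _ @^-1` _ = \bigcap_(i in [set: 'I_N])
      ((fun t => f t 0 i * k.+1%:R) @^-1` `[(z i)%:~R, (z i + 1)%:~R[%classic)).
    apply: fin_bigcap_measurable => // i _.
    rewrite -[X in measurable X]setTI.
    have : measurable_fun [set: T] (fun t => f t 0 i * k.+1%:R).
      exact: measurable_funM.
    by apply => //; exact: measurable_itv.
  apply/seteqP; split => t /=.
    by move=> <- i _; rewrite /= ffunE in_itv/=; exact: floor_itv.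
  move=> h0; apply/ffunP => i; rewrite ffunE.
  by apply: floor_def; have := h0 i I; rewrite /= in_itv/=.
move=> t _.
have -> : (fun k => (h k \o j k) t) = (fun k => G (grid_round k (f t))).
  apply/funext => k /=; rewrite /h; congr G; apply/rowP => i.
  by rewrite !mxE ffunE.
exact: (@cvg_comp _ _ _ (fun k => grid_round k (f t)) G _ _ _ (@cvg_grid_round (f t)) (cG t)).
Qed.

End grid.

Section rV_norm.
Context {R : realType} {N : nat}.
Local Notation V := 'rV[R]_N.
Local Notation ei i := (delta_mx 0 i : V).
Implicit Types (v : V).

Lemma rV_coord_le_norm v i : `|v 0 i| <= `|v|.
Proof.
rewrite [leRHS]/Num.norm/= mx_normrE.
by apply/bigmax_geP; right => /=; exists (0, i).
Qed.

Lemma rV_norm_le v M : 0 <= M -> (forall i, `|v 0 i| <= M) -> `|v| <= M.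
Proof.
move=> M0 h; rewrite [leLHS]/Num.norm/= mx_normrE.
by apply/bigmax_leP; split => // -[i j] _ /=; rewrite ord1.
Qed.

Lemma norm_delta_rV (i : 'I_N) : `|ei i| = 1 :> R.
Proof.
apply/eqP; rewrite eq_le; apply/andP; split.
  apply: rV_norm_le => // j; rewrite mxE /=.
  by case: (j == i); rewrite ?normr1 ?normr0.
by have := rV_coord_le_norm (ei i) i; rewrite mxE !eqxx normr1.
Qed.

End rV_norm.

Section affine.
Context {R : realType}.
Local Open Scope ereal_scope.
Local Notation mu := (@lebesgue_measure R).

Let aff (c r : R) (y : measurableTypeR R) : measurableTypeR R := (c + r * y)%R.

Let maff c r : measurable_fun [set: measurableTypeR R] (aff c r).
Proof. by apply: measurable_funD => //; exact: measurable_funM. Qed.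

(** By uniqueness of Lebesgue measure: r times its image under y |-> c + r y has the right value on
    half-open intervals. *)
Lemma lebesgue_measure_affine (c r : R) (A : set (measurableTypeR R)) :
  (0 < r)%R -> measurable A ->
  mu ((fun y : R => c + r * y)%R @^-1` A) = (r^-1)%:E * mu A.
Proof.
move=> r0 mA.
pose p0 := [the {measure set (measurableTypeR R) -> \bar R} of pushforward mu (aff c r)].
pose p := p0 (@maff c r).
pose m := mscale (NngNum (ltW r0)) p.
have mE X : m X = r%:E * mu (aff c r @^-1` X) by [].
suff -> : mu A = m A by rewrite mE muleA -EFinM mulVf ?gt_eqF// mul1e.
apply: lebesgue_measure_unique => // _ [[a b] _ <-].
transitivity (r%:E * mu (aff c r @^-1` `]a, b]%classic)); last by [].
rewrite (_ : _ @^-1` _ = `](a - c) / r, (b - c) / r]%classic)%R; last first.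
  apply/seteqP; split => y /=; rewrite !in_itv/=.
    by rewrite ltr_pdivrMr// ler_pdivlMr// ltrBlDl lerBrDl (mulrC y).
  by rewrite ltr_pdivrMr// ler_pdivlMr// ltrBlDl lerBrDl (mulrC y).
rewrite !lebesgue_measure_itv/= !lte_fin ltr_pM2r ?invr_gt0// ltrD2r.
case: ifP => _; last by rewrite mule0.
by rewrite -!EFinD -EFinM -mulrBl mulrCA opprB addrA subrK mulfV ?mulr1// gt_eqF.
Qed.

Lemma ge0_integral_affine (c r : R) (f : R -> \bar R) : (0 < r)%R ->
  measurable_fun [set: R] f -> (forall y, 0 <= f y) ->
  \int[mu]_y f (c + r * y)%R = (r^-1)%:E * \int[mu]_y f y.
Proof.
move=> r0 mf f0.
have := @ge0_integral_pushforward _ _ _ _ R _ (maff c r) mu setT f measurableT mf.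
rewrite preimage_setT => <-; last by move=> ? _.
have ri0 : (0 < r^-1)%R by rewrite invr_gt0.
rewrite (eq_measure_integral (mscale (NngNum (ltW ri0)) mu)).
  by rewrite ge0_integral_mscale.
by move=> A mA _; exact: lebesgue_measure_affine.
Qed.

Definition aff_tuple (N : nat) (c : N.-tuple R) (r : R) (t : N.-tuple R) : N.-tuple R :=
  [tuple (tnth c i + r * tnth t i)%R | i < N].

Lemma measurable_aff_tuple N (c : N.-tuple R) (r : R) :
  measurable_fun [set: N.-tuple (measurableTypeR R)]
    (aff_tuple c r : _ -> N.-tuple (measurableTypeR R)).
Proof.
apply/measurable_fun_tnthP => i.
rewrite (_ : _ \o _ = fun t => aff (tnth c i) r (tnth t i)).
  apply: (measurableT_comp (@maff _ _)); exact: measurable_tnth.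
by apply/funext => t /=; rewrite tnth_mktuple.
Qed.

Lemma lebesgue_tuple_affine N (c : N.-tuple R) (r : R)
    (A : set (N.-tuple (measurableTypeR R))) : (0 < r)%R -> measurable A ->
  lebesgue_tuple R N (aff_tuple c r @^-1` A) = (r^-1 ^+ N)%:E * lebesgue_tuple R N A.
Proof.
move=> r0; elim: N c A => [|N ih] c A mA.
  rewrite expr0 mul1e; congr (lebesgue_tuple _ _ _); apply/seteqP.
  by split => t /=; rewrite (tuple0 (aff_tuple c r t)) (tuple0 t).
rewrite /= /cons_measure /product_measure1.
have mAx x : measurable (xsection (cons_pair @^-1` A) x).
  apply: measurable_xsection.
  by rewrite -[X in measurable X]setTI; exact: measurable_cons_pair.
pose c' : N.-tuple R := [tuple of behead c].
have affE x t : aff_tuple c r (cons_pair (x, t)) =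
    cons_pair ((thead c + r * x)%R, aff_tuple c' r t).
  apply/eq_from_tnth => i; rewrite tnth_mktuple.
  case: (unliftP ord0 i) => [j ->|->].
    by rewrite !tnthS tnth_mktuple tnth_behead; congr (tnth c _ + _)%R; apply/val_inj;
      rewrite /= inordK // ltnS.
  by rewrite !tnth0.
have secE x : xsection (cons_pair @^-1` (aff_tuple c r @^-1` A)) x =
    aff_tuple c' r @^-1` (xsection (cons_pair @^-1` A) (thead c + r * x)%R).
  by apply/seteqP; split => t; rewrite /xsection/= !inE/= affE.
transitivity (\int[mu]_x ((r^-1 ^+ N)%:E *
   (lebesgue_tuple R N \o xsection (cons_pair @^-1` A)) (thead c + r * x)%R)).
  by apply: eq_integral => x _; rewrite /= secE ih.
have mS : measurable_fun [set: R] (lebesgue_tuple R N \o xsection (cons_pair @^-1` A)).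
  apply: measurable_fun_xsection.
  by rewrite -[X in measurable X]setTI; exact: measurable_cons_pair.
rewrite ge0_integralZl//; last 2 first.
- apply: (measurableT_comp mS); exact: maff.
- by rewrite lee_fin exprn_ge0// invr_ge0 ltW.
rewrite (@ge0_integral_affine _ _ (lebesgue_tuple R N \o xsection (cons_pair @^-1` A)))//.
by rewrite muleA -EFinM -exprSr.
Qed.

Lemma ge0_integral_tuple_affine N (c : N.-tuple R) (r : R)
    (f : N.-tuple (measurableTypeR R) -> \bar R) : (0 < r)%R ->
  measurable_fun setT f -> (forall y, 0 <= f y) ->
  \int[lebesgue_tuple R N]_y f (aff_tuple c r y) =
    (r^-1 ^+ N)%:E * \int[lebesgue_tuple R N]_y f y.
Proof.
move=> r0 mf f0.
have := @ge0_integral_pushforward _ _ _ _ R _ (@measurable_aff_tuple N c r)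
  (lebesgue_tuple R N) setT f measurableT mf.
rewrite preimage_setT => <-; last by move=> ? _.
have ri0 : (0 <= r^-1 ^+ N)%R by rewrite exprn_ge0// invr_ge0 ltW.
rewrite (eq_measure_integral (mscale (NngNum ri0) (lebesgue_tuple R N))).
  by rewrite ge0_integral_mscale.
- exact: measurable_aff_tuple.
- by move=> mc A mA _; have := lebesgue_tuple_affine c r0 mA; apply.
Qed.

End affine.

Section euclidean_integral.
Context {R : realType} {n : nat}.
Local Notation N := (n.+1 + n.+1)%N.
Local Notation V := 'rV[R]_N.
Local Notation RN := (N.-tuple (measurableTypeR R)).
Local Notation lam := (lebesgue_tuple R N).
Implicit Types (G H : V -> R) (c v : V).

Definition lint G : R := (\int[lam]_t G (row_of_tuple t))%R.

Definition meas G := measurable_fun [set: RN] (G \o @row_of_tuple R n).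

(* cmb: compactly supported, measurable, bounded *)
Definition cmb G := meas G /\
  exists M, forall v, `|G v| <= M /\ (M < `|v| -> G v = 0).

Lemma measurable_row_coord i :
  measurable_fun [set: RN] (fun t => @row_of_tuple R n t 0 i).
Proof.
rewrite (_ : (fun _ => _) = (fun t : RN => tnth t i : R)).
  exact: measurable_tnth.
by apply/funext => t; rewrite mxE.
Qed.

Lemma meas_cont G : continuous G -> meas G.
Proof.
move=> cG; apply: measurable_continuous_coord.
- by move=> i; exact: measurable_row_coord.
- by move=> t; exact: cG.
Qed.

Lemma rV_ball_bounded G M : continuous G -> exists K, forall v, `|v| <= M -> `|G v| <= K.
Proof.
move=> cG.
pose A := [set v : V | `|v| <= M].
have cA : compact A.
  apply: bounded_closed_compact.
    by exists M; split; [exact: num_real|move=> x Mx v /= /le_trans; apply; exact: ltW].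
  rewrite (_ : A = (fun v : V => `|v|) @^-1` [set x | x <= M]); last by [].
  apply: (preimage_closed _ (@closed_le _ _)) => y _.
  exact: norm_continuous.
have cGA : compact (G @` A).
  apply: continuous_compact => //; exact: continuous_subspaceT.
have [K [_ hK]] := compact_bounded cGA.
exists (K + 1) => v vM; apply: (hK (K + 1)); first by rewrite ltrDl.
by exists v.
Qed.

Lemma cmb_cont G M : continuous G -> (forall v, M < `|v| -> G v = 0) -> cmb G.
Proof.
move=> cG h; split; first exact: meas_cont.
have [K hK] := rV_ball_bounded M cG.
exists (Num.max K (Num.max M 0)) => v; split; last first.
  by rewrite gt_max gt_max => /andP[_ /andP[Mv _]]; exact: h.
have [vM|Mv] := leP `|v| M; first by rewrite le_max hK.
by rewrite h// normr0 !le_max lexx !orbT.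
Qed.

Lemma cmb_integrable G : cmb G -> lam.-integrable setT (EFin \o (G \o @row_of_tuple R n)).
Proof.
move=> [mG [M hM]].
pose A : set (measurableTypeR R) := `[- M, M]%classic.
have mA : measurable A by exact: measurable_itv.
have mB := measurable_tuple_box (N := N) mA.
have -> : EFin \o (G \o @row_of_tuple R n) =
    (EFin \o (G \o @row_of_tuple R n)) \_ (tuple_box N A).
  apply/funext => t; rewrite patchE; case: ifPn => //= tA.
  congr EFin; apply: (hM _).2; rewrite ltNge; apply/negP => tM.
  move/negP: tA; apply; rewrite inE => i.
  rewrite /A /= in_itv/= -ler_norml; apply: le_trans tM.
  by have := rV_coord_le_norm (row_of_tuple t) i; rewrite mxE.
apply/(integrable_mkcond _ mB).
apply: measurable_bounded_integrable => //.
- have [x Ex] : exists x : R, @lebesgue_measure R A = x%:E.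
    rewrite lebesgue_measure_itv/=; case: ifP => _; last by exists 0.
    by rewrite -EFinB; exists (M - - M).
  by rewrite [X in (X < _)%E](lebesgue_tuple_box N mA) Ex -EFin_expe ltry.
- exact: measurable_funTS.
- exists M; split; first exact: num_real.
  by move=> x Mx t _ /=; apply: le_trans (ltW Mx); exact: (hM _).1.
Qed.

Lemma cmbD G H : cmb G -> cmb H -> cmb (fun v => G v + H v).
Proof.
move=> [mG [M hM]] [mH [K hK]]; split.
  exact: measurable_funD.
have M0 : 0 <= M by apply: le_trans (hM 0).1.
have K0 : 0 <= K by apply: le_trans (hK 0).1.
exists (M + K) => v; split.
  by apply: le_trans (ler_normD _ _) _; apply: lerD; [exact: (hM v).1|exact: (hK v).1].
move=> h; rewrite (hM v).2 ?(hK v).2 ?addr0//; apply: le_lt_trans h.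
  by rewrite lerDr.
by rewrite lerDl.
Qed.

Lemma cmbM G H : cmb G -> cmb H -> cmb (fun v => G v * H v).
Proof.
move=> [mG [M hM]] [mH [K hK]]; split; first exact: measurable_funM.
exists (Num.max (M * K) M) => v; split.
  rewrite normrM le_max ler_pM//; [exact: (hM v).1|exact: (hK v).1].
by rewrite gt_max => /andP[_ h]; rewrite (hM v).2// mul0r.
Qed.

Lemma cmbZ k G : cmb G -> cmb (fun v => k * G v).
Proof.
move=> [mG [M hM]]; split; first exact: measurable_funM.
exists (Num.max (`|k| * M) M) => v; split.
  by rewrite normrM le_max ler_wpM2l//; exact: (hM v).1.
by rewrite gt_max => /andP[_ h]; rewrite (hM v).2// mulr0.
Qed.

Lemma cmb0 : cmb (fun=> 0).
Proof.
by split; [exact: measurable_cst|exists 0 => v; rewrite normr0].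
Qed.

Lemma cmb_sum (I : Type) (s : seq I) (P : pred I) (F : I -> V -> R) :
  (forall i, cmb (F i)) -> cmb (fun v => \sum_(i <- s | P i) F i v).
Proof.
move=> h; elim: s => [|i s ih].
  by under eq_fun do rewrite big_nil; exact: cmb0.
under eq_fun do rewrite big_cons.
by case: (P i) => //; exact: cmbD.
Qed.

Lemma lintD G H : cmb G -> cmb H -> lint (fun v => G v + H v) = lint G + lint H.
Proof. by move=> cG cH; rewrite /lint RintegralD//; exact: cmb_integrable. Qed.

Lemma lintZ k G : cmb G -> lint (fun v => k * G v) = k * lint G.
Proof. by move=> cG; rewrite /lint RintegralZl//; exact: cmb_integrable. Qed.

Lemma lint0 : lint (fun=> 0) = 0.
Proof. by rewrite /lint Rintegral_cst//= mul0r. Qed.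

Lemma lint_sum (I : Type) (s : seq I) (P : pred I) (F : I -> V -> R) :
  (forall i, cmb (F i)) ->
  lint (fun v => \sum_(i <- s | P i) F i v) = \sum_(i <- s | P i) lint (F i).
Proof.
move=> h; elim: s => [|i s ih].
  by rewrite big_nil; under eq_fun do rewrite big_nil; exact: lint0.
rewrite big_cons; under eq_fun do rewrite big_cons.
by case: (P i) => //; rewrite lintD// ?ih//; exact: cmb_sum.
Qed.

Lemma le_lint G H : cmb G -> cmb H -> (forall v, G v <= H v) -> lint G <= lint H.
Proof.
by move=> cG cH h; apply: le_Rintegral => //; exact: cmb_integrable.
Qed.

Lemma lint_ge0 G : (forall v, 0 <= G v) -> 0 <= lint G.
Proof. by move=> h; apply: Rintegral_ge0. Qed.

Lemma row_of_tuple_aff (c : V) r (t : RN) :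
  row_of_tuple (aff_tuple [tuple c 0 i | i < N] r t) = c + r *: row_of_tuple t :> V.
Proof. by apply/rowP => i; rewrite !mxE !tnth_mktuple. Qed.

Lemma cmb_affine G c r : 0 < r -> cmb G -> cmb (fun v => G (c + r *: v)).
Proof.
move=> r0 [mG [M hM]]; split.
  rewrite /meas (_ : _ \o _ =
      (G \o @row_of_tuple R n) \o aff_tuple [tuple c 0 i | i < N] r).
    apply: (measurableT_comp mG); exact: measurable_aff_tuple.
  by apply/funext => t /=; rewrite row_of_tuple_aff.
exists (Num.max M ((M + `|c|) / r)) => v; split.
  by rewrite le_max (hM _).1.
rewrite gt_max => /andP[_]; rewrite ltr_pdivrMr// => h; apply: (hM _).2.
have : `|r *: v| <= `|c + r *: v| + `|c|.
  by rewrite -[X in `|X| <= _](addKr c) addrC; apply: le_trans (ler_normD _ _) _; rewrite normrN.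
rewrite normrZ (gtr0_norm r0) mulrC -lerBlDr; apply: lt_le_trans.
by rewrite ltrBrDr.
Qed.

Lemma lint_affine G c r : 0 < r -> cmb G ->
  lint (fun v => G (c + r *: v)) = r^-1 ^+ N * lint G.
Proof.
move=> r0 cG; have cG' := cmb_affine c r0 cG.
rewrite /lint /Rintegral.
pose tc : N.-tuple R := [tuple c 0 i | i < N].
pose g (t : RN) := (G (row_of_tuple t))%:E.
have mg : measurable_fun [set: RN] g by apply/measurable_EFinP; exact: cG.1.
have -> : (\int[lam]_x (G (c + r *: row_of_tuple x))%:E =
    (r^-1 ^+ N)%:E * \int[lam]_x g x)%E.
  transitivity (\int[lam]_t g (aff_tuple tc r t))%E.
    by apply: eq_integral => t _; rewrite /g row_of_tuple_aff.
  rewrite integralE [in RHS]integralE.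
  have -> : (fun x => g (aff_tuple tc r x))^\+%E =
      (fun x => g^\+%E (aff_tuple tc r x)) by apply/funext => x; rewrite !funeposE.
  have -> : (fun x => g (aff_tuple tc r x))^\-%E =
      (fun x => g^\-%E (aff_tuple tc r x)) by apply/funext => x; rewrite !funenegE.
  rewrite !ge0_integral_tuple_affine//; last 2 first.
  - exact: measurable_funeneg.
  - exact: measurable_funepos.
  have ig := cmb_integrable cG.
  rewrite [RHS]muleBr//; apply: fin_num_adde_defr; exact: integrable_pos_fin_num.
by rewrite fineM//; exact: integrable_fin_num (cmb_integrable cG).
Qed.

End euclidean_integral.

Section partials.
Context {R : realType}.

Lemma is_derive_line (U : normedModType R) (H : U -> R) (v u : U) (x d : R) :
  is_derive (v + x *: u) u H d -> is_derive x (1:R) (fun y => H (v + y *: u)) d.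
Proof.
have E : (fun h : R => h^-1 *: (((fun y => H (v + y *: u)) \o shift x) (h *: 1) -
           (fun y => H (v + y *: u)) x)) =
         (fun h : R => h^-1 *: ((H \o shift (v + x *: u)) (h *: u) - H (v + x *: u))).
  apply/funext => h /=; congr (_ *: (H _ - _)).
  by rewrite [_%:A]mulr1 scalerDl addrCA.
move=> [dH dE]; split; first by rewrite /derivable E.
by rewrite -dE /derive E.
Qed.

Lemma MVT_line (U : normedModType R) (H : U -> R) (dH : U -> R) (v u : U) (h : R) :
  (forall s, `|s| <= `|h| -> is_derive (v + s *: u) u H (dH (v + s *: u))) ->
  exists2 s, `|s| <= `|h| & H (v + h *: u) - H v = dH (v + s *: u) * h.
Proof.
move=> hd.
have dl s : `|s| <= `|h| -> is_derive s (1:R) (fun y => H (v + y *: u)) (dH (v + s *: u)).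
  by move=> /hd; exact: is_derive_line.
have v0 : v = v + 0 *: u by rewrite scale0r addr0.
have cl a b : (forall s, s \in `[a, b] -> `|s| <= `|h|) ->
    {within `[a, b], continuous (fun y => H (v + y *: u))}.
  move=> ab; apply: derivable_within_continuous => s sab.
  by have [] := dl s (ab s sab).
have [h0|h0] := leP 0 h.
  have ab s : s \in `[0, h] -> `|s| <= `|h|.
    by rewrite in_itv/= => /andP[s0 sh]; rewrite !ger0_norm.
  have [s sab E] := @MVT_segment _ (fun y => H (v + y *: u)) (fun s => dH (v + s *: u)) 0 h h0
    (fun s si => dl s (ab s (subset_itv_oo_cc si))) (cl _ _ ab).
  by exists s; [exact: ab|rewrite {2}v0 E subr0].
have ab s : s \in `[h, 0] -> `|s| <= `|h|.
  by rewrite in_itv/= => /andP[s0 sh]; rewrite (ler0_norm sh) (ler0_norm (ltW h0)) lerN2.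
have [s sab E] := @MVT_segment _ (fun y => H (v + y *: u)) (fun s => dH (v + s *: u)) h 0 (ltW h0)
    (fun s si => dl s (ab s (subset_itv_oo_cc si))) (cl _ _ ab).
exists s; first exact: ab.
by rewrite {2}v0 -[LHS]opprB E sub0r mulrN opprK.
Qed.

End partials.

Section ibp.
Context {R : realType} {n : nat}.
Local Notation N := (n.+1 + n.+1)%N.
Local Notation V := 'rV[R]_N.
Local Notation RN := (N.-tuple (measurableTypeR R)).
Local Notation lam := (lebesgue_tuple R N).
Local Notation ei i := (delta_mx 0 i : V).

(** The dominating function is K times the indicator of the cube of half-side |M|. *)
Lemma lint_derive (f df : R -> V -> R) (T K M : R) :
  (forall t, `|t| < T -> cmb (f t)) ->
  (forall t y, `|t| < T -> is_derive t (1:R) (f ^~ y) (df t y)) ->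
  (forall t y, `|t| < T -> `|df t y| <= K) ->
  (forall t y, `|t| < T -> M < `|y| -> df t y = 0) ->
  forall t, `|t| < T -> is_derive t (1:R) (fun t => lint (f t)) (lint (df t)).
Proof.
move=> cf fd dfK dfM t tT.
pose B := tuple_box N (`[- `|M|, `|M|]%classic : set (measurableTypeR R)).
have mA : measurable (`[- `|M|, `|M|]%classic : set (measurableTypeR R)).
  exact: measurable_itv.
have mB : measurable B by exact: measurable_tuple_box.
have K0 : 0 <= K by exact: le_trans (dfK t 0 tT).
have fE x (y : RN) : `|x| < T ->
    partial1of2 (fun s y => f s (row_of_tuple y)) x y = df x (row_of_tuple y).
  by move=> xT; rewrite partial1of2E; have [_ ->] := fd x (row_of_tuple y) xT.
have Gint : lam.-integrable setT (EFin \o (fun t => K * \1_B t)).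
  apply: (@integrableZl _ _ _ lam setT measurableT K (EFin \o \1_B)).
  apply/integrableP; split; first exact/measurable_EFinP.
  rewrite (eq_integral (fun x => (\1_B x)%:E)); last first.
    by move=> s _; rewrite gee0_abs// lee_fin.
  rewrite integral_indic// setIT.
  have [x Ex] : exists x : R, @lebesgue_measure R `[- `|M|, `|M|]%classic = x%:E.
    rewrite lebesgue_measure_itv/=; case: ifP => _; last by exists 0.
    by rewrite -EFinB; eexists.
  by rewrite [X in (X < _)%E](lebesgue_tuple_box N mA) Ex -EFin_expe ltry.
have hT x : (`]-T, T[%classic : set R) x -> `|x| < T by rewrite /= in_itv/= -ltr_norml.
have tI : (`]-T, T[%classic : set R) t by rewrite /= in_itv/= -ltr_norml.
have h1 x : (`]-T, T[%classic : set R) x ->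
    lam.-integrable setT (EFin \o (fun y : RN => f x (row_of_tuple y))).
  by move=> /hT xT; apply: (cmb_integrable (cf x xT)).
have h2 x (y : RN) : (`]-T, T[%classic : set R) x -> setT y ->
    derivable (fun s => f s (row_of_tuple y)) x 1.
  by move=> /hT xT _; have [] := fd x (row_of_tuple y) xT.
have h3 (y : RN) : 0 <= K * \1_B y by rewrite mulr_ge0.
have h4 x (y : RN) : (`]-T, T[%classic : set R) x -> setT y ->
    `|partial1of2 (fun s y => f s (row_of_tuple y)) x y| <= K * \1_B y.
  move=> /hT xT _; rewrite fE// indicE.
  case: (boolP (y \in B)) => yB; first by rewrite mulr1 dfK.
  rewrite mulr0 (dfM _ _ xT) ?normr0//; rewrite ltNge; apply/negP => h.
  move/negP: yB; apply; rewrite inE => j /=.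
  rewrite in_itv/= -ler_norml.
  have -> : (tnth y j : R) = (row_of_tuple y) 0 j by rewrite mxE.
  by apply: (le_trans (rV_coord_le_norm _ _)); exact: le_trans h (ler_norm _).
have D1 := derivable_under_integral measurableT tI h1 h2 h3 Gint h4.
have D2 := differentiation_under_integral measurableT tI h1 h2 h3 Gint h4.
split; first exact: D1.
rewrite -derive1E; etransitivity; first exact: D2.
by rewrite /lint; apply: eq_Rintegral => y _; exact: fE.
Qed.

(** Translating [H] along the i-th axis does not change its integral; differentiating this constant
    under the integral sign at 0 gives the claim. Translations of length less than 1 enlarge the
    support to radius M + 1. *)
Lemma lint_partial (i : 'I_N) (H dH : V -> R) (M : R) :
  (forall v, is_derive v (ei i) H (dH v)) -> continuous H -> continuous dH ->
  (forall v, M < `|v| -> H v = 0) -> (forall v, M < `|v| -> dH v = 0) ->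
  lint dH = 0.
Proof.
move=> hd cH cdH H0 dH0.
have [K0 hK0] := rV_ball_bounded M cdH.
pose K : R := K0.
have hK v : `|dH v| <= `|K|.
  have [/hK0 h|/dH0 ->] := leP `|v| M; first by apply: le_trans h (ler_norm _).
  by rewrite normr0.
have cbH : cmb H by exact: cmb_cont H0.
have shE v (x : R) : x *: ei i + 1 *: v = v + x *: ei i by rewrite scale1r addrC.
have cf x : cmb (fun v => H (v + x *: ei i)).
  have := cmb_affine (x *: ei i) ltr01 cbH; congr cmb; apply/funext => v.
  by rewrite shE.
have F0 x : lint (fun v => H (v + x *: ei i)) = lint H.
  have := lint_affine (x *: ei i) ltr01 cbH.
  rewrite invr1 expr1n mul1r => <-; congr lint; apply/funext => v.
  by rewrite shE.
have := @lint_derive (fun x v => H (v + x *: ei i)) (fun x v => dH (v + x *: ei i))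
  1 `|K| (M + 1).
case/(_ (fun t _ => cf t) _ (fun t y _ => hK _) _ 0 _).
- by move=> t y _; apply: (@is_derive_line _ _ H y); exact: hd.
- move=> t y t1 My; apply: dH0; rewrite -(ltrD2r 1); apply: lt_le_trans My _.
  rewrite -[X in `|X| <= _](addrK (t *: ei i)); apply: (le_trans (ler_normB _ _)).
  by rewrite lerD2l normrZ norm_delta_rV mulr1 ltW.
- by rewrite normr0.
move=> _; rewrite (_ : (fun t => _) = cst (lint H)); last by apply/funext => x; exact: F0.
rewrite derive_cst => ->; congr lint; apply/funext => y.
by rewrite scale0r addr0.
Qed.

End ibp.

Section differentiability.
Context {R : realType} {N : nat}.
Local Notation V := 'rV[R]_N.
Local Notation ei i := (delta_mx 0 i : V).

Let trunc (k : nat) (h : V) : V := \row_i (if (i < k)%N then h 0 i else 0).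

Let norm_trunc k h : `|trunc k h| <= `|h|.
Proof.
apply: rV_norm_le => // i; rewrite mxE; case: ifP => _; last by rewrite normr0.
exact: rV_coord_le_norm.
Qed.

Let truncS (k : 'I_N) h : trunc k.+1 h = trunc k h + h 0 k *: ei k.
Proof.
apply/rowP => i; rewrite !mxE eqxx /= ltnS; case: (ltngtP i k) => ik.
- by rewrite (negbTE (_ : i != k)) ?mulr0 ?addr0//; apply: contraTneq ik => ->; rewrite ltnn.
- by rewrite (negbTE (_ : i != k)) ?mulr0 ?addr0//; apply: contraTneq ik => ->; rewrite ltnn.
- by rewrite (val_inj ik) eqxx mulr1 add0r.
Qed.

(** The increment from v to v + h u is telescoped through the points [w k], which change one
    coordinate at a time; the mean value theorem applies on each of these axis-parallel segments. *)
Lemma is_derive_dir (F : V -> R) (dF : 'I_N -> V -> R) (v u : V) :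
  (\near v, forall i, is_derive v (ei i) F (dF i v)) ->
  (forall i, {for v, continuous (dF i)}) ->
  is_derive v u F (\sum_i u 0 i * dF i v).
Proof.
move=> hd cd.
suff H : h^-1 *: ((F \o shift v) (h *: u) - F v) @[h --> 0^'] -->
    (\sum_i u 0 i * dF i v : R).
  by apply: DeriveDef; [apply/cvg_ex; eexists; exact: H|exact: cvg_lim].
apply/cvgrPdist_le => e e0.
pose S : R := 1 + \sum_i `|u 0 i|.
have S0 : 0 < S by rewrite ltr_pwDl// sumr_ge0.
have e'0 : 0 < e / S by rewrite divr_gt0.
have cdn' : \forall w \near v, forall i : 'I_N, `|dF i v - dF i w| <= e / S.
  have H i : \forall w \near v, `|dF i v - dF i w| <= e / S.
    by have /cvgrPdist_le := cd i; exact.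
  exact: (@filter_forall _ _ (fun i w => `|dF i v - dF i w| <= e / S) (nbhs v) _ H).
have /nbhs_ballP[r /= r0 hr] : \forall w \near v,
   (forall i : 'I_N, is_derive w (ei i) F (dF i w)) /\
   (forall i : 'I_N, `|dF i v - dF i w| <= e / S) by apply: filterI.
(* Every intermediate point is v plus a truncation of h u plus a step along one axis, both of norm
   at most |h| |u|; hence the 2, while + 1 covers u = 0. *)
have r'0 : 0 < r / (2 * `|u| + 1).
  by rewrite divr_gt0// ltr_wpDl// mulr_ge0.
near=> h.
have h0 : h != 0 by near: h; exact: nbhs_dnbhs_neq.
have hr' : `|h| < r / (2 * `|u| + 1).
  near: h; apply: dnbhs0_lt => //.
have hsmall : `|h| * (2 * `|u|) < r.
  move: hr'; rewrite ltr_pdivlMr; last by rewrite ltr_wpDl// mulr_ge0.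
  by apply: le_lt_trans; rewrite ler_wpM2l// lerDl.
pose w k := v + trunc k (h *: u).
have wS (k : 'I_N) : w k.+1 = w k + (h * u 0 k) *: ei k.
  by rewrite /w truncS addrA mxE.
have near_w (k : 'I_N) s : `|s| <= `|h * u 0 k| -> ball v r (w k + s *: ei k).
  move=> hs; rewrite -ball_normE /= /w opprD opprD addrA addrA subrr sub0r.
  rewrite -opprD normrN; apply: le_lt_trans hsmall.
  rewrite mulr2n mulrDl mul1r mulrDr; apply: le_trans (ler_normD _ _) _; apply: lerD.
    by apply: le_trans (norm_trunc _ _) _; rewrite normrZ.
  have -> : `|s *: ei k| = `|s|.
    by rewrite normrZ norm_delta_rV mulr1.
  by apply: (le_trans hs); rewrite normrM ler_wpM2l// rV_coord_le_norm.
have mv (k : 'I_N) : exists2 s, `|s| <= `|h * u 0 k| &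
    F (w k.+1) - F (w k) = dF k (w k + s *: ei k) * (h * u 0 k).
  rewrite wS; apply: MVT_line => s hs.
  by have [+ _] := hr _ (near_w k s hs); exact.
have tel : F (h *: u + v) - F v = \sum_(k < N) (F (w k.+1) - F (w k)).
  rewrite -(big_mkord predT (fun k => F (w k.+1) - F (w k))) telescope_sumr// /w.
  congr (F _ - F _).
    by rewrite addrC; congr (_ + _); apply/rowP => i; rewrite !mxE ltn_ord.
  by rewrite (_ : trunc 0 _ = 0) ?addr0//; apply/rowP => i; rewrite !mxE.
rewrite /= tel scaler_sumr -sumrB.
apply: (@le_trans _ _ (\sum_i `|u 0 i| * (e / S))).
  apply: le_trans (ler_norm_sum _ _ _) _; apply: ler_sum => k _.
  have [s hs ->] := mv k.
  have -> : u 0 k * dF k v - h^-1 *: (dF k (w k + s *: ei k) * (h * u 0 k)) =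
     u 0 k * (dF k v - dF k (w k + s *: ei k)).
    by rewrite -[_ *: _]/(h^-1 * _); field.
  rewrite normrM ler_wpM2l//.
  by have [_ +] := hr _ (near_w k s hs); exact.
rewrite -mulr_suml mulrA ler_pdivrMr// mulrC ler_wpM2l ?(ltW e0)//.
by rewrite /S lerDr.
Unshelve. all: by end_near. Qed.

End differentiability.

(** * Polar coordinates *)

Lemma continuous_at_sum (R : realType) (U : topologicalType) (I : Type) (s : seq I) (P : pred I)
    (F : I -> U -> R) (v : U) : (forall i, {for v, continuous (F i)}) ->
  {for v, continuous (fun w => \sum_(i <- s | P i) F i w)}.
Proof.
move=> cF; elim: s => [|i s ih].
  rewrite (_ : (fun _ => _) = cst 0); first exact: cst_continuous.
  by apply/funext => w; rewrite big_nil.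
rewrite (_ : (fun _ => _) = (fun w => (if P i then F i w else 0) + \sum_(i <- s | P i) F i w)).
  apply: continuousD; last exact: ih.
  by case: (P i) => //; exact: cst_continuous.
by apply/funext => w; rewrite big_cons; case: (P i); rewrite ?add0r.
Qed.

Section radial_maps.
Context {R : realType} {n : nat}.
Local Notation N := (n.+1 + n.+1)%N.
Local Notation V := 'rV[R]_N.

Implicit Types (v w : V) (r : R).

Definition sqn v : R := \sum_i v 0 i ^+ 2.

Lemma sqn_ge0 v : 0 <= sqn v.
Proof. by apply: sumr_ge0 => i _; exact: sqr_ge0. Qed.

Lemma sqn_eq0 v : (sqn v == 0) = (v == 0).
Proof.
apply/eqP/eqP => [h|->]; last first.
  by rewrite /sqn big1// => i _; rewrite mxE expr0n.
apply/rowP => i; rewrite mxE; apply/eqP; rewrite -sqrf_eq0; apply/eqP.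
by apply: (psumr_eq0P _ h) => // j _; exact: sqr_ge0.
Qed.

Lemma sqn_gt0 v : (0 < sqn v) = (v != 0).
Proof. by rewrite lt_neqAle sqn_ge0 andbT eq_sym sqn_eq0. Qed.

Lemma enormE v : enorm v = Num.sqrt (sqn v). Proof. by []. Qed.

Lemma enorm_sqr v : enorm v ^+ 2 = sqn v.
Proof. by rewrite enormE sqr_sqrtr// sqn_ge0. Qed.

Lemma enorm_ge0 v : 0 <= enorm v. Proof. exact: sqrtr_ge0. Qed.

Lemma enorm_eq0 v : (enorm v == 0) = (v == 0).
Proof. by rewrite -sqn_eq0 -enorm_sqr sqrf_eq0. Qed.

Lemma enorm_gt0 v : (0 < enorm v) = (v != 0).
Proof. by rewrite lt_neqAle enorm_ge0 andbT eq_sym enorm_eq0. Qed.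

Lemma sqnZ r v : sqn (r *: v) = r ^+ 2 * sqn v.
Proof. by rewrite /sqn mulr_sumr; apply: eq_bigr => i _; rewrite mxE exprMn. Qed.

Lemma enormZ r v : 0 <= r -> enorm (r *: v) = r * enorm v.
Proof. by move=> r0; rewrite !enormE sqnZ sqrtrM ?sqr_ge0// sqrtr_sqr ger0_norm. Qed.

Lemma norm_le_enorm v : `|v| <= enorm v.
Proof.
apply: rV_norm_le; first exact: enorm_ge0.
move=> i; rewrite -sqrtr_sqr enormE ler_wsqrtr// /sqn (bigD1 i)//= lerDl.
by apply: sumr_ge0 => j _; exact: sqr_ge0.
Qed.

Lemma continuous_coord (i : 'I_N) : continuous (fun v : V => v 0 i : R).
Proof. exact: coord_continuous. Qed.

Lemma continuous_sqn : continuous sqn.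
Proof.
move=> v; apply: continuous_at_sum => i.
exact: (continuous_comp (@continuous_coord i v) (@exprn_continuous _ 2 _)).
Qed.

Lemma continuous_enorm : continuous (@enorm R N).
Proof.
move=> v; rewrite (_ : @enorm R N = Num.sqrt \o sqn)//.
by apply: continuous_comp; [exact: continuous_sqn|exact: sqrt_continuous].
Qed.

Lemma realify_inj m : injective (@realify R m).
Proof.
move=> z w /eq_row_mx[h1 h2]; apply/rowP => j.
move/rowP: h1 => /(_ j); rewrite !mxE; move/rowP: h2 => /(_ j); rewrite !mxE.
by case: (z 0 j) => a b; case: (w 0 j) => c e /= -> ->.
Qed.

Lemma sqn_realify (z : sphere R n) : sqn (realify (val z)) = 1.
Proof.
have := realify_norm (val z); rewrite (eqP (valP z)) => /(congr1 (@complex.Re R)).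
by [].
Qed.

Lemma realify_neq0 (z : sphere R n) : realify (val z) != 0.
Proof. by rewrite -sqn_gt0 sqn_realify ltr01. Qed.

Lemma radial_realify (z : sphere R n) : radial (realify (val z)) = z.
Proof.
apply/val_inj/realify_inj; rewrite val_radial enorm_eq0 (negbTE (realify_neq0 z)).
by rewrite enormE sqn_realify sqrtr1 invr1 scale1r.
Qed.

Lemma realify_radial (v : V) : v != 0 ->
  realify (val (radial v)) = (enorm v)^-1 *: v.
Proof. by move=> v0; rewrite val_radial enorm_eq0 (negbTE v0). Qed.

Lemma radialZ (r : R) (v : V) : 0 < r -> radial (r *: v) = radial v.
Proof.
move=> r0; apply/val_inj/realify_inj; rewrite !val_radial !enorm_eq0.
rewrite scaler_eq0 (gt_eqF r0)/=; case: eqVneq => // v0.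
by rewrite enormZ ?(ltW r0)// scalerA invfM mulrAC mulVf ?mul1r// gt_eqF.
Qed.

End radial_maps.

Section polar.
Context {R : realType} {n : nat}.
Local Notation N := (n.+1 + n.+1)%N.
Local Notation RN := (N.-tuple (measurableTypeR R)).
Local Notation lam := (lebesgue_tuple R N).
Local Open Scope ereal_scope.

Let dil (r : R) : RN -> RN := aff_tuple [tuple 0%R | i < N] r.

Let row_dil r t : @row_of_tuple R n (dil r t) = r *: row_of_tuple t.
Proof. by apply/rowP => i; rewrite !mxE !tnth_mktuple add0r. Qed.

Let nrm (t : RN) : R := enorm (row_of_tuple t).
Let dir (t : RN) : sphere R n := radial (row_of_tuple t).

Let nrm_dil r t : (0 < r)%R -> nrm (dil r t) = (r * nrm t)%R.
Proof. by move=> r0; rewrite /nrm row_dil enormZ// ltW. Qed.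

Let dir_dil r t : (0 < r)%R -> dir (dil r t) = dir t.
Proof. by move=> r0; rewrite /dir row_dil radialZ. Qed.

Let nrm_ge0 t : (0 <= nrm t)%R. Proof. exact: enorm_ge0. Qed.

Let measurable_nrm : measurable_fun [set: RN] nrm.
Proof. by have := meas_cont (@continuous_enorm R n). Qed.

Let measurable_dil r : measurable_fun [set: RN] (dil r).
Proof. exact: measurable_aff_tuple. Qed.

Let measurable_dir : measurable_fun [set: RN] dir.
Proof. exact: measurable_radial. Qed.

Let scale (r : R) (f : RN -> R) : (0 < r)%R ->
  measurable_fun setT f -> (forall y, (0 <= f y)%R) ->
  \int[lam]_y (f y)%:E = \int[lam]_y (r ^+ N * f (dil r y))%:E.
Proof.
move=> r0 mf f0.
under [RHS]eq_integral do rewrite EFinM.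
rewrite ge0_integralZl//; last 3 first.
- by apply/measurable_EFinP; exact: measurableT_comp.
- by move=> t _; rewrite lee_fin.
- by rewrite lee_fin exprn_ge0// ltW.
rewrite (@ge0_integral_tuple_affine _ _ _ _ (EFin \o f) r0)//; last first.
  exact/measurable_EFinP.
by rewrite muleA -EFinM -exprMn mulfV ?expr1n ?mul1e// gt_eqF.
Qed.

Let mulc (k : R) (f : RN -> R) : (0 <= k)%R ->
  measurable_fun setT f -> (forall y, (0 <= f y)%R) ->
  k%:E * \int[lam]_y (f y)%:E = \int[lam]_y (k * f y)%:E.
Proof.
move=> k0 mf f0; under [RHS]eq_integral do rewrite EFinM.
rewrite ge0_integralZl//; first exact/measurable_EFinP.
by move=> t _; rewrite lee_fin.
Qed.

Section swap.
Variables (w u : R -> R) (g : sphere R n -> R).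
Hypotheses (mw : measurable_fun setT w) (mu : measurable_fun setT u)
  (mg : measurable_fun setT g).
Hypotheses (w0 : forall x, (0 <= w x)%R) (u0 : forall x, (0 <= u x)%R)
  (g0 : forall z, (0 <= g z)%R) (w00 : w 0 = 0%R) (u00 : u 0 = 0%R).

(* Dilating by |s| in t, exchanging the integrals, then dilating by 1/|t| and
   |s| moves the factor g from the weight w to the weight u(1/r) r^(-2N). With
   u(r) = r^(-2N) on [1, oo) the latter is the indicator of
   the punctured ball defining sphere_vol. *)
Lemma polar_swap :
  (\int[lam]_t (u (nrm t))%:E) * (\int[lam]_t (w (nrm t) * g (dir t))%:E) =
  (\int[lam]_t (w (nrm t))%:E) *
    (\int[lam]_t (u (nrm t)^-1 * (nrm t)^-1 ^+ (N + N) * g (dir t))%:E).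
Proof.
have mgd : measurable_fun [set: RN] (g \o dir) by exact: measurableT_comp.
have mwn : measurable_fun [set: RN] (w \o nrm) by exact: measurableT_comp.
have mun : measurable_fun [set: RN] (u \o nrm) by exact: measurableT_comp.
have m1 : measurable_fun [set: RN * RN] (nrm \o fst) by exact: measurableT_comp.
have m2 : measurable_fun [set: RN * RN] (nrm \o snd) by exact: measurableT_comp.
have minv : measurable_fun [set: RN] (fun t => (nrm t)^-1)%R.
  rewrite (_ : (fun _ => _) = (fun t => nrm t `^ (-1)))%R.
    exact: (measurableT_comp (measurable_powR _)).
  by apply/funext => t; rewrite powR_inv1.
have mgd2 : measurable_fun [set: RN * RN] (g \o dir \o snd) by exact: measurableT_comp.
pose K (p : RN * RN) := (u (nrm p.1) * nrm p.1 ^+ N * w (nrm p.1 * nrm p.2) * g (dir p.2))%R.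
have mK : measurable_fun [set: RN * RN] (EFin \o K).
  apply/measurable_EFinP; apply: measurable_funM => //.
  apply: measurable_funM; last first.
    by apply: (measurableT_comp mw); exact: measurable_funM.
  apply: measurable_funM; first exact: (measurableT_comp mu).
  exact: measurable_funX.
have K0 p : 0 <= (EFin \o K) p.
  by rewrite lee_fin !mulr_ge0// exprn_ge0.
pose L (p : RN * RN) := (u (nrm p.2 * (nrm p.1)^-1) * nrm p.2 ^+ N *
   (nrm p.1)^-1 ^+ (N + N) * w (nrm p.2) * g (dir p.1))%R.
have mL : measurable_fun [set: RN * RN] (EFin \o L).
  have mi1 : measurable_fun [set: RN * RN] (fun p => (nrm p.1)^-1)%R.
    exact: (measurableT_comp minv).
  apply/measurable_EFinP; apply: measurable_funM; last exact: (measurableT_comp mgd).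
  apply: measurable_funM; last exact: (measurableT_comp mw).
  apply: measurable_funM; last exact: measurable_funX.
  apply: measurable_funM; last exact: measurable_funX.
  by apply: (measurableT_comp mu); exact: measurable_funM.
have L0 p : 0 <= (EFin \o L) p.
  by rewrite lee_fin !mulr_ge0// exprn_ge0// ?invr_ge0.
have sec1 (s : RN) (F : RN * RN -> R) : measurable_fun setT (EFin \o F) ->
    measurable_fun [set: RN] (fun t => F (s, t)).
  move=> /measurable_EFinP mF.
  by apply: (measurableT_comp mF); exact: pair1_measurable.
have sec2 (s : RN) (F : RN * RN -> R) : measurable_fun setT (EFin \o F) ->
    measurable_fun [set: RN] (fun t => F (t, s)).
  move=> /measurable_EFinP mF.
  by apply: (measurableT_comp mF); exact: pair2_measurable.
have mwg : measurable_fun [set: RN] (fun t => w (nrm t) * g (dir t))%R by exact: measurable_funM.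
have wg0 t : (0 <= w (nrm t) * g (dir t))%R by rewrite mulr_ge0.
have mug : measurable_fun [set: RN] (fun t => u (nrm t)^-1 * (nrm t)^-1 ^+ (N + N) * g (dir t))%R.
  apply: measurable_funM => //; apply: measurable_funM; last exact: measurable_funX.
  exact: measurableT_comp.
have ug0 t : (0 <= u (nrm t)^-1 * (nrm t)^-1 ^+ (N + N) * g (dir t))%R.
  by rewrite !mulr_ge0// exprn_ge0// invr_ge0.
have pos t : nrm t != 0%R -> (0 < nrm t)%R by move=> t0; rewrite lt_neqAle eq_sym t0 nrm_ge0.
transitivity (\int[lam]_s \int[lam]_t (EFin \o K) (s, t)).
  rewrite muleC -ge0_integralZl//; last 3 first.
  - exact/measurable_EFinP.
  - by move=> t _; rewrite lee_fin.
  - by apply: integral_ge0 => t _; rewrite lee_fin.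
  apply: eq_integral => s _; rewrite muleC mulc//.
  have [s0|/pos sp] := eqVneq (nrm s) 0%R.
    by rewrite !integral0_eq// => t _ /=; rewrite /K /= ?s0 u00 ?mul0r.
  rewrite (scale sp)//; last 2 first.
  - exact: measurable_funM.
  - by move=> t; rewrite mulr_ge0.
  apply: eq_integral => t _; rewrite nrm_dil// dir_dil//; congr EFin.
  by rewrite /K /=; ring.
rewrite (fubini_tonelli _ mK)//.
transitivity (\int[lam]_t \int[lam]_s (EFin \o L) (t, s)).
  apply: eq_integral => t _.
  have [t0|/pos tp] := eqVneq (nrm t) 0%R.
    rewrite !integral0_eq// => s _ /=; rewrite /K /L /= ?t0 ?mulr0 ?w00 ?mulr0 ?mul0r//.
    by rewrite invr0 expr0n /= !(mulr0, mul0r).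
  have tip : (0 < (nrm t)^-1)%R by rewrite invr_gt0.
  rewrite (@scale _ (fun s => K (s, t)) tip); last 2 first.
  - exact: sec2.
  - by move=> s; rewrite -lee_fin; exact: K0.
  apply: eq_integral => s _; rewrite /=; congr EFin.
  rewrite /K /L /= nrm_dil// (mulrC (nrm t)^-1%R) mulfVK ?gt_eqF// exprMn (exprD _ N N).
  by ring.
rewrite (fubini_tonelli _ mL)//.
rewrite -ge0_integralZr//; last 3 first.
- exact/measurable_EFinP.
- by move=> t _; rewrite lee_fin.
- by apply: integral_ge0 => t _; rewrite lee_fin.
apply: eq_integral => s _; rewrite mulc//.
have [s0|/pos sp] := eqVneq (nrm s) 0%R.
  by rewrite !integral0_eq// => t _ /=; rewrite ?/L /= s0 w00 ?mulr0 mul0r.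
rewrite (@scale _ (fun t => L (t, s)) sp); last 2 first.
- exact: sec2.
- by move=> t; rewrite -lee_fin; exact: L0.
apply: eq_integral => t _; rewrite /=; congr EFin.
rewrite /L /= nrm_dil// dir_dil//.
have -> : (nrm s / (nrm s * nrm t) = (nrm t)^-1)%R.
  by rewrite invfM mulrA mulfV ?gt_eqF// mul1r.
rewrite invfM exprMn.
have e1 : (nrm s ^+ N * nrm s ^+ N * (nrm s)^-1 ^+ (N + N) = 1)%R.
  by rewrite -exprD -exprMn mulfV ?expr1n// gt_eqF.
transitivity ((nrm s ^+ N * nrm s ^+ N * (nrm s)^-1 ^+ (N + N)) *
  (w (nrm s) * (u (nrm t)^-1 * (nrm t)^-1 ^+ (N + N) * g (dir t))))%R; first by ring.
by rewrite e1 mul1r.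
Qed.

End swap.

Local Notation PB := (@punctured_ball R n).
Let mPB : measurable PB. Proof. exact: measurable_punctured_ball. Qed.

Lemma ge0_integral_mrestr (f : RN -> \bar R) :
  measurable_fun setT f -> (forall t, 0 <= f t) ->
  \int[mrestr lam mPB]_t f t = \int[lam]_(t in PB) f t.
Proof.
move=> mf f0.
rewrite -(setUv PB) ge0_integral_setU//; last 3 first.
- exact: measurableC.
- by rewrite setUv.
- by rewrite disj_set2E setICr.
rewrite [X in _ + X](_ : _ = 0) ?adde0.
  apply: eq_measure_integral => A mA sA.
  by transitivity (lam (A `&` PB)); [|rewrite (setIidl sA)].
rewrite (eq_measure_integral mzero) ?integral_measure_zero// => A mA sA.
transitivity (lam (A `&` PB)); first by [].
rewrite /mzero (_ : A `&` PB = set0) ?measure0//.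
by rewrite -subset0 => t [/sA].
Qed.

Lemma ge0_integral_sphere_vol (g : sphere R n -> R) :
  measurable_fun setT g -> (forall z, 0 <= g z)%R ->
  \int[sphere_vol R n]_z (g z)%:E =
    ((fine (lam PB))^-1)%:E * \int[lam]_(t in PB) (g (dir t))%:E.
Proof.
move=> mg g0.
have k0 : (0 <= (fine (lam PB))^-1)%R by rewrite invr_ge0 fine_ge0.
have := @ge0_integral_pushforward _ _ _ _ R _ measurable_dir (mrestr lam mPB) setT
  (EFin \o g) measurableT.
rewrite preimage_setT ge0_integral_mrestr; last 2 first.
- by apply/measurable_EFinP; exact: measurableT_comp.
- by move=> t; rewrite lee_fin.
move=> <-; last 2 first.
- exact/measurable_EFinP.
- by move=> z _; rewrite lee_fin.
rewrite (eq_measure_integral (mscale (NngNum k0) (pushforward (mrestr lam mPB) dir))).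
  rewrite ge0_integral_mscale//; first exact/measurable_EFinP.
  by move=> z _; rewrite lee_fin.
move=> A mA _; rewrite /= /sphere_vol /mscale /=; congr (_ * _).
by rewrite /pushforward /mrestr setIC.
Qed.

Lemma ge0_polar (w : R -> R) (g : sphere R n -> R) :
  measurable_fun setT w -> (forall x, 0 <= w x)%R -> w 0%R = 0%R ->
  measurable_fun setT g -> (forall z, 0 <= g z)%R ->
  \int[lam]_t (w (nrm t) * g (dir t))%:E =
  \int[lam]_t (w (nrm t))%:E * \int[sphere_vol R n]_z (g z)%:E.
Proof.
move=> mw w0 w00 mg g0.
have PBlty := @punctured_ball_lty R n; have PBgt0 := @punctured_ball_gt0 R n.
have [b b0 PBE] : exists2 b : R, (0 < b)%R & lam PB = b%:E.
  by move: PBlty PBgt0; case: (lam PB) => //= b _; rewrite lte_fin => b0; exists b.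
pose u (r : R) : R := if (1 <= r)%R then ((r `^ (-1)) ^+ (N + N))%R else 0%R.
have mu : measurable_fun setT u.
  apply: measurable_fun_ifT => //.
    exact: measurable_fun_ler.
  by apply: measurable_funX; exact: measurable_powR.
have u0 x : (0 <= u x)%R.
  rewrite /u; case: ifP => // x1.
  by rewrite exprn_ge0// powR_ge0.
have u00 : u 0%R = 0%R by rewrite /u lt_geF// ltr01.
have uE t : (u (nrm t)^-1 * (nrm t)^-1 ^+ (N + N))%R = \1_PB t :> R.
  rewrite indicE /u; case: ifP => h.
    have n0 : (0 < nrm t)%R.
      by rewrite lt_neqAle nrm_ge0 andbT eq_sym; apply: contraTneq h => ->; rewrite invr0 lt_geF// ltr01.
    rewrite powR_inv1 ?invr_ge0// invrK -exprMn mulfV ?gt_eqF// expr1n mem_set//.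
    rewrite /punctured_ball/= n0/=; move: h; rewrite invf_ge1//.
  rewrite mul0r memNset// => -/andP[n0 n1]; move/negP: h; apply.
  by rewrite invf_ge1.
have swapE (w' : R -> R) (g' : sphere R n -> R) :
  measurable_fun setT w' -> (forall x, 0 <= w' x)%R -> w' 0%R = 0%R ->
  measurable_fun setT g' -> (forall z, 0 <= g' z)%R ->
  (\int[lam]_t (u (nrm t))%:E) * (\int[lam]_t (w' (nrm t) * g' (dir t))%:E) =
  (\int[lam]_t (w' (nrm t))%:E) * (b%:E * \int[sphere_vol R n]_z (g' z)%:E).
  move=> mw' w'0 w'00 mg' g'0; rewrite polar_swap//; congr (_ * _).
  rewrite ge0_integral_sphere_vol// PBE muleA -EFinM mulfV ?gt_eqF// mul1e.
  rewrite [RHS]integral_mkcond; apply: eq_integral => t _.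
  rewrite uE patchE indicE; case: (t \in PB); by rewrite ?mul1r ?mul0r.
(* Testing the exchange identity with g = 1 and w the indicator of (0, 1] identifies the constant:
   the integral of u(|t|) is the volume b of the punctured ball. *)
have cu : \int[lam]_t (u (nrm t))%:E = b%:E.
  pose w1 (r : R) : R := if (0 < r <= 1)%R then 1%R else 0%R.
  have mw1 : measurable_fun setT w1.
    apply: measurable_fun_ifT => //; apply: measurable_and.
      exact: measurable_fun_ltr.
    exact: measurable_fun_ler.
  have w10 x : (0 <= w1 x)%R by rewrite /w1; case: ifP.
  have w100 : w1 0%R = 0%R by rewrite /w1 ltxx.
  have intw1 : \int[lam]_t (w1 (nrm t))%:E = b%:E.
    rewrite -PBE -(setIT PB) -integral_indic//; apply: eq_integral => t _.
    rewrite indicE /w1; case: ifP => h; first by rewrite mem_set.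
    by rewrite memNset// => /=; rewrite /punctured_ball/= => h'; rewrite h' in h.
  have := swapE w1 (cst 1%R) mw1 w10 w100 (measurable_cst _) (fun=> ler01).
  under [X in _ * X = _]eq_integral do rewrite mulr1.
  rewrite intw1.
  have -> : \int[sphere_vol R n]_z (cst 1 z : R)%:E = 1.
    rewrite -[LHS]/(\int[sphere_vol R n]_z (cst 1%E z)) integral_cst//.
    by rewrite mul1e; exact: (@probability_setT _ _ _ (sphere_vol R n)).
  rewrite mule1.
  rewrite muleC => /(congr1 (fun x => (b^-1)%:E * x)).
  by rewrite !muleA -EFinM mulVf ?gt_eqF// !mul1e.
have := swapE w g mw w0 w00 mg g0; rewrite cu muleCA.
move=> /(congr1 (fun x => (b^-1)%:E * x)).
by rewrite !muleA -EFinM mulVf ?gt_eqF// !mul1e.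
Qed.

End polar.

Section real_polar.
Context {R : realType} {n : nat}.
Local Notation N := (n.+1 + n.+1)%N.
Local Notation V := 'rV[R]_N.
Implicit Types (w : R -> R) (g : sphere R n -> R).

Lemma bounded_sphere_integrable g M : measurable_fun setT g ->
  (forall z, `|g z| <= M) -> (sphere_vol R n).-integrable setT (EFin \o g).
Proof.
move=> mg gM; apply: measurable_bounded_integrable => //.
  rewrite [X in (X < _)%E](_ : _ = 1%E) ?ltry//.
  exact: (@probability_setT _ _ _ (sphere_vol R n)).
exists M; split; first exact: num_real.
by move=> x Mx z _ /=; apply: le_trans (ltW Mx); exact: gM.
Qed.

Lemma cmb_radial w g M : measurable_fun setT w ->
  cmb (fun v : V => w (enorm v)) -> measurable_fun setT g -> (forall z, `|g z| <= M) ->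
  cmb (fun v : V => w (enorm v) * g (radial v)).
Proof.
move=> mw [mwe [K hK]] mg gM; split.
  apply: measurable_funM; first exact: mwe.
  exact: (measurableT_comp mg (@measurable_radial R n)).
exists (Num.max (K * M) K) => v; split.
  by rewrite normrM le_max ler_pM//; exact: (hK v).1.
by rewrite gt_max => /andP[_ h]; rewrite (hK v).2// mul0r.
Qed.

Lemma lint_polar w g M : measurable_fun setT w -> (forall x, 0 <= w x) -> w 0 = 0 ->
  cmb (fun v : V => w (enorm v)) -> measurable_fun setT g -> (forall z, `|g z| <= M) ->
  lint (fun v : V => w (enorm v) * g (radial v)) =
  lint (fun v : V => w (enorm v)) * (\int[sphere_vol R n]_z g z)%R.
Proof.
move=> mw w0 w00 cw mg gM.
have pos (h : sphere R n -> R) (K : R) : measurable_fun setT h -> (forall z, 0 <= h z) -> (forall z, `|h z| <= K) ->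
    lint (fun v : V => w (enorm v) * h (radial v)) =
    lint (fun v : V => w (enorm v)) * (\int[sphere_vol R n]_z h z)%R.
  move=> mh h0 hK; rewrite /lint /Rintegral (ge0_polar mw w0 w00 mh h0) fineM//.
    by apply: integrable_fin_num => //; exact: (cmb_integrable cw).
  by apply: integrable_fin_num => //; exact: (bounded_sphere_integrable mh hK).
have M0 : 0 <= M by exact: le_trans (gM (sphere_point)).
(* The nonnegative case applies to g + M; the shift is removed at the end by linearity. *)
pose h z := g z + M.
have mh : measurable_fun setT h by exact: measurable_funD.
have h0 z : 0 <= h z by rewrite /h -lerBlDr sub0r; have := gM z; rewrite ler_norml => /andP[].
have hM z : `|h z| <= M + M.
  by apply: (le_trans (ler_normD _ _)); rewrite lerD// ger0_norm.
have cM z : `|(fun=> M) z| <= M by rewrite ger0_norm.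
have := pos h _ mh h0 hM.
have -> : (\int[sphere_vol R n]_z h z)%R = (\int[sphere_vol R n]_z g z)%R + M.
  rewrite RintegralD//; last 2 first.
  - exact: bounded_sphere_integrable gM.
  - by apply: (@bounded_sphere_integrable (fun=> M) M) => //= z; rewrite ger0_norm.
  rewrite Rintegral_cst// [X in fine X](_ : _ = 1%E) ?mulr1//.
  exact: (@probability_setT _ _ _ (sphere_vol R n)).
have -> : (fun v : V => w (enorm v) * h (radial v)) =
   (fun v : V => w (enorm v) * g (radial v) + M * w (enorm v)).
  by apply/funext => v; rewrite /h mulrDr [X in _ + X]mulrC.
rewrite lintD; last 2 first.
- exact: cmb_radial gM.
- exact: cmbZ.
by rewrite lintZ// mulrDr [X in _ = _ + X -> _]mulrC => /addIr.
Qed.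

End real_polar.

(** * Differential calculus off the origin *)

Section chain_rules.
Context {R : realType}.

Lemma is_derive_lineE (U : normedModType R) (H : U -> R) (v u : U) (d : R) :
  is_derive v u H d <-> is_derive (0:R) (1:R) (fun y => H (v + y *: u)) d.
Proof.
split; first by move=> h; apply: is_derive_line; rewrite scale0r addr0.
have E : (fun h : R => h^-1 *: (((fun y => H (v + y *: u)) \o shift 0) (h *: 1) -
           (fun y => H (v + y *: u)) 0)) =
         (fun h : R => h^-1 *: ((H \o shift v) (h *: u) - H v)).
  apply/funext => h /=; rewrite scale0r !addr0; congr (_ *: (H _ - _)).
  by rewrite [_%:A]mulr1 addrC.
move=> [dH dE]; split; first by rewrite /derivable -E.
by rewrite -dE /derive E.
Qed.

Lemma is_derive_comp1 (U : normedModType R) (h : R -> R) (H : U -> R) (v u : U) (d d' : R) :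
  is_derive (H v) (1:R) h d' -> is_derive v u H d -> is_derive v u (fun w => h (H w)) (d' * d).
Proof.
move=> hd /is_derive_lineE Hd; apply/is_derive_lineE.
apply: (@is_derive1_comp _ h (fun y => H (v + y *: u)) 0 d' d) => //.
by rewrite scale0r addr0.
Qed.

Lemma is_derive_affine (U : normedModType R) (H : U -> R) (x v u : U) (t d : R) :
  is_derive (x + t *: v) u H d -> is_derive v u (fun w => H (x + t *: w)) (t * d).
Proof.
move=> /is_derive_lineE hd; apply/is_derive_lineE.
rewrite (_ : (fun y => _) =
    (fun y : R => (fun s => H (x + t *: v + s *: u)) (t * y))); last first.
  by apply/funext => y; rewrite scalerDr scalerA addrA.
have h0 : is_derive (t * 0 : R) (1:R) (fun s => H (x + t *: v + s *: u)) d by rewrite mulr0.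
rewrite mulrC; apply: (@is_derive1_comp _ _ (fun y : R => t * y) 0 d t h0).
have := @is_deriveZ _ _ _ (id : R -> R) t 0 1 1 _.
by rewrite [t *: 1]mulr1; apply; exact: is_derive_id.
Qed.

(** A cutoff profile of class C^1, which is enough for one integration by parts. *)
Definition pos2 (x : R) : R := Num.max 0 x ^+ 2.

Lemma continuous_max0 : continuous (fun x : R => Num.max 0 x).
Proof.
move=> x; apply: (@continuous_max _ _ (fun=> 0) id x); first exact: cvg_cst.
exact: cvg_id.
Qed.

Lemma is_derive_pos2 (x : R) : is_derive x (1:R) pos2 (2 * Num.max 0 x).
Proof.
have [x0|x0|->] := ltgtP x 0.
- rewrite mulr0.
  have := @is_derive_cst R R R 0 x 1; apply: near_eq_is_derive.
  near=> y; have y0 : y < 0 by near: y; exact: lt_nbhsl.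
  by rewrite /cst /pos2 (max_idPl (ltW y0)) expr0n.
- apply: (@near_eq_is_derive _ _ _ (fun y : R => y ^+ 2)).
    near=> y; have y0 : 0 < y by near: y; exact: lt_nbhsr.
    by rewrite /pos2 (max_idPr (ltW y0)).
  have := @is_deriveX _ _ (id : R -> R) 2 x 1 1 (is_derive_id _ _).
  by congr (is_derive _ _ _ _); rewrite /= expr1 [_ *: 1]mulr1.
- rewrite mulr0.
  suff H : h^-1 *: ((pos2 \o shift 0) (h *: 1) - pos2 0) @[h --> 0^'] --> (0 : R).
    by apply: DeriveDef; [apply/cvg_ex; eexists; exact: H|exact: cvg_lim].
  apply/cvgrPdist_le => e e0; near=> h.
  rewrite sub0r normrN /= addr0 [_%:A]mulr1 /pos2 maxxx expr0n subr0 normrM.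
  have h0 : h != 0 by near: h; exact: nbhs_dnbhs_neq.
  rewrite normfV ler_pdivrMl ?normr_gt0// normrX expr2 [leRHS]mulrC.
  have hm : `|Num.max 0 h| <= `|h|.
    by rewrite maxEle; case: ifP => // _; rewrite normr0.
  apply: ler_pM => //; apply: (le_trans hm).
  by apply/ltW; near: h; exact: dnbhs0_lt.
Unshelve. all: by end_near. Qed.

Lemma is_derive_sumr (U : normedModType R) (I : Type) (s : seq I) (P : pred I) (F : I -> U -> R) (dF : I -> R)
   (v u : U) :
  (forall i, is_derive v u (F i) (dF i)) ->
  is_derive v u (fun w => \sum_(i <- s | P i) F i w) (\sum_(i <- s | P i) dF i).
Proof.
move=> h; elim: s => [|i s ih].
  rewrite big_nil (_ : (fun _ => _) = cst 0); first exact: is_derive_cst.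
  by apply/funext => w; rewrite big_nil.
rewrite big_cons (_ : (fun _ => _) =
    (if P i then F i else cst 0) + (fun w => \sum_(i <- s | P i) F i w)).
  case: (P i); first exact: is_deriveD.
  by have := @is_deriveD _ _ _ (cst 0) _ v u 0 _ (is_derive_cst _ _ _) ih; rewrite add0r.
by apply/funext => w; rewrite big_cons fctE; case: (P i); rewrite ?add0r.
Qed.

Lemma continuous_atM (U : topologicalType) (F G : U -> R) (v : U) :
  {for v, continuous F} -> {for v, continuous G} ->
  {for v, continuous (fun w => F w * G w)}.
Proof. by move=> cF cG; exact: cvgM. Qed.

Lemma continuous_atD (U : topologicalType) (F G : U -> R) (v : U) :
  {for v, continuous F} -> {for v, continuous G} ->
  {for v, continuous (fun w => F w + G w)}.
Proof. by move=> cF cG; exact: cvgD. Qed.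

Lemma continuous_atZ (U : topologicalType) (k : R) (F : U -> R) (v : U) :
  {for v, continuous F} -> {for v, continuous (fun w => k * F w)}.
Proof. by move=> cF; apply: continuous_atM => //; exact: cvg_cst. Qed.

End chain_rules.

Section C2_calculus.
Context {R : realType} {n : nat}.
Local Notation N := (n.+1 + n.+1)%N.
Local Notation V := 'rV[R]_N.
Local Notation ei i := (delta_mx 0 i : V).
Implicit Types (v w : V) (F G : V -> R) (dF dG : 'I_N -> V -> R) (ddF ddG : 'I_N -> 'I_N -> V -> R).

Lemma is_derive_coord v (i j : 'I_N) :
  is_derive v (ei i) (fun w : V => w 0 j : R) ((i == j)%:R : R).
Proof.
apply/is_derive_lineE.
rewrite (_ : (fun y => _) = (fun y : R => v 0 j + (i == j)%:R *: y)); last first.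
  by apply/funext => y; rewrite !mxE eqxx /= eq_sym mulrC.
have := @is_deriveD _ _ _ (fun=> v 0 j) (fun y : R => (i == j)%:R *: y) 0 1 0 (i == j)%:R.
rewrite add0r; apply.
have := @is_deriveZ _ _ _ (id : R -> R) (i == j)%:R 0 1 1 _.
by rewrite [_ *: 1]mulr1; apply; exact: is_derive_id.
Qed.

Lemma is_derive_sqn v (i : 'I_N) : is_derive v (ei i) (@sqn R n) (2 * v 0 i).
Proof.
have := @is_derive_sumr _ _ _ (index_enum 'I_N) predT (fun j w => (w 0 j : R) ^+ 2)
  (fun j => 2 * v 0 j * (i == j)%:R) v (ei i) _.
rewrite (bigD1 i)//= eqxx mulr1 big1 ?addr0; first last.
  by move=> j ji; rewrite eq_sym (negbTE ji) mulr0.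
apply=> j; have := @is_deriveX _ _ (fun w : V => w 0 j : R) 2 v (ei i) _ (is_derive_coord v i j).
by congr (is_derive _ _ _ _); rewrite /= expr1.
Qed.

(** The partial derivatives are carried as explicit functions, so that sums and products are
    differentiated without computing with ['D_]. The origin is left out because a nonconstant
    function that is constant along rays is not continuous there. *)
Definition C2data F dF ddF : Prop := forall v, v != 0 ->
  [/\ {for v, continuous F}, forall i, is_derive v (ei i) F (dF i v),
    forall i, {for v, continuous (dF i)},
    forall i j, is_derive v (ei j) (dF i) (ddF i j v) &
    forall i j, {for v, continuous (ddF i j)}].

Definition lap ddF v : R := \sum_i ddF i i v.

Lemma near_neq0 v : v != 0 -> \forall w \near v, w != 0.
Proof.
move=> v0; have : \forall w \near v, 0 < sqn w.
  have cs : sqn w @[w --> v] --> sqn v by exact: continuous_sqn.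
  by apply: (cvgr_gt (sqn v) cs); rewrite sqn_gt0.
by apply: filterS => w; rewrite sqn_gt0.
Qed.

Lemma C2data_dir F dF ddF v u : C2data F dF ddF -> v != 0 ->
  is_derive v u F (\sum_i u 0 i * dF i v).
Proof.
move=> h v0; apply: is_derive_dir.
  by have := near_neq0 v0; apply: filterS => w /h[].
by have [] := h _ v0.
Qed.

Lemma C2_onP F : C2_on [set v | v != 0] F ->
  C2data F (fun i => 'D_(ei i) F) (fun i j => 'D_(ei j) ('D_(ei i) F)).
Proof.
move=> h v v0; have [cF hF] := h v v0; split => //.
- by move=> i; have [dF _ _] := hF i; exact: derivableP.
- by move=> i; have [_ cdF _] := hF i.
- by move=> i j; have [_ _ /(_ j)[ddF _]] := hF i; exact: derivableP.
- by move=> i j; have [_ _ /(_ j)[_ cddF]] := hF i.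
Qed.

Lemma C2data_on F dF ddF : C2data F dF ddF ->
  C2_on [set v | v != 0] F /\ forall v, v != 0 -> laplacian F v = lap ddF v.
Proof.
move=> h.
have E1 i w : w != 0 -> 'D_(ei i) F w = dF i w by move=> /h[_ /(_ i)[]].
have nE1 i v : v != 0 -> \forall w \near v, dF i w = 'D_(ei i) F w.
  by move=> /near_neq0; apply: filterS => w /E1.
have D2 i j v : v != 0 -> is_derive v (ei j) ('D_(ei i) F) (ddF i j v).
  move=> v0; apply: (near_eq_is_derive (nE1 i v v0)).
  by have [_ _ _ + _] := h v v0; apply.
have E2 i j w : w != 0 -> 'D_(ei j) ('D_(ei i) F) w = ddF i j w by move=> /(D2 i j)[].
have nE2 i j v : v != 0 -> \forall w \near v, ddF i j w = 'D_(ei j) ('D_(ei i) F) w.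
  by move=> /near_neq0; apply: filterS => w /E2.
split; last by move=> v v0; apply: eq_bigr => i _; exact: E2.
move=> v v0; have [cF d1 c1 d2 c2] := h v v0; split => // i; split.
- by have [] := d1 i.
- rewrite /prop_for /continuous_at E1//.
  exact: (cvg_trans (near_eq_cvg (nE1 i v v0)) (c1 i)).
- move=> j; split; first by have [] := D2 i j v v0.
  rewrite /prop_for /continuous_at E2//.
  exact: (cvg_trans (near_eq_cvg (nE2 i j v v0)) (c2 i j)).
Qed.

Lemma C2data_mul F dF ddF G dG ddG : C2data F dF ddF -> C2data G dG ddG ->
  C2data (fun v => F v * G v) (fun i v => dF i v * G v + F v * dG i v)
    (fun i j v => ddF i j v * G v + dF i v * dG j v + (dF j v * dG i v + F v * ddG i j v)).
Proof.
move=> hF hG v v0; have [cF d1F c1F d2F c2F] := hF v v0; have [cG d1G c1G d2G c2G] := hG v v0.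
have prod (A B : V -> R) (a b : R) u : is_derive v u A a -> is_derive v u B b ->
    is_derive v u (fun w => A w * B w) (a * B v + A v * b).
  move=> hA hB; have := @is_deriveM _ _ A B v u a b hA hB.
  by congr (is_derive _ _ _ _); rewrite addrC; congr (_ + _); rewrite [LHS]mulrC.
split.
- exact: continuous_atM.
- by move=> i; apply: prod.
- by move=> i; apply: continuous_atD; apply: continuous_atM.
- move=> i j; apply: is_deriveD; exact: prod.
- by move=> i j; apply: continuous_atD; apply: continuous_atD; apply: continuous_atM.
Qed.

Lemma C2data_sum (I : Type) (s : seq I) (c : I -> R) (F : I -> V -> R) (dF : I -> 'I_N -> V -> R)
    (ddF : I -> 'I_N -> 'I_N -> V -> R) :
  (forall i, C2data (F i) (dF i) (ddF i)) ->
  C2data (fun v => \sum_(i <- s) c i * F i v) (fun k v => \sum_(i <- s) c i * dF i k v)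
    (fun k l v => \sum_(i <- s) c i * ddF i k l v).
Proof.
move=> h v v0.
have sc (a : R) (A : V -> R) u (k : R) : is_derive v u A a -> is_derive v u (fun w => k * A w) (k * a).
  by move=> hA; apply: (@is_deriveZ _ _ _ A k v u a hA).
have cc (A : V -> R) (k : R) : {for v, continuous A} -> {for v, continuous (fun w => k * A w)}.
  exact: continuous_atZ.
split.
- by apply: continuous_at_sum => i; apply: cc; have [] := h i v v0.
- by move=> k; apply: is_derive_sumr => i; apply: sc; have [] := h i v v0.
- by move=> k; apply: continuous_at_sum => i; apply: cc; have [] := h i v v0.
- by move=> k l; apply: is_derive_sumr => i; apply: sc; have [] := h i v v0.
- by move=> k l; apply: continuous_at_sum => i; apply: cc; have [] := h i v v0.
Qed.

Definition rho (a : R) v : R := sqn v `^ (a / 2).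

Lemma is_derive_rho a v i : v != 0 -> is_derive v (ei i) (rho a) (a * v 0 i * rho (a - 2) v).
Proof.
move=> v0; have s0 : 0 < sqn v by rewrite sqn_gt0.
have := is_derive_comp1 (is_derive1_powR (a / 2) s0) (is_derive_sqn v i).
congr (is_derive _ _ _ _); rewrite /rho.
have -> : a / 2 - 1 = (a - 2) / 2 by field.
by field.
Qed.

Lemma continuous_rho a v : v != 0 -> {for v, continuous (rho a)}.
Proof.
move=> v0; have s0 : 0 < sqn v by rewrite sqn_gt0.
apply: (@continuous_comp _ _ _ (@sqn R n) (fun s => s `^ (a / 2))); first exact: continuous_sqn.
apply: differentiable_continuous; apply/derivable1_diffP.
by apply: derivable_powR; rewrite in_itv/= s0.
Qed.

Lemma C2data_rho a : C2data (rho a) (fun i v => a * v 0 i * rho (a - 2) v)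
  (fun i j v => a * (j == i)%:R * rho (a - 2) v + a * v 0 i * ((a - 2) * v 0 j * rho (a - 2 - 2) v)).
Proof.
move=> v v0.
have ca (i : 'I_N) : {for v, continuous (fun w : V => a * w 0 i)}.
  by apply: continuous_atZ; exact: continuous_coord.
split.
- exact: continuous_rho.
- by move=> i; exact: is_derive_rho.
- by move=> i; apply: continuous_atM; [exact: ca|exact: continuous_rho].
- move=> i j.
  have h1 : is_derive v (ei j) (fun w : V => a * w 0 i) (a * (j == i)%:R).
    exact: (@is_deriveZ _ _ _ (fun w : V => w 0 i : R) a v (ei j) _ (is_derive_coord v j i)).
  have := @is_deriveM _ _ _ _ v (ei j) _ _ h1 (@is_derive_rho (a - 2) v j v0).
  by congr (is_derive _ _ _ _); rewrite addrC; congr (_ + _); rewrite [LHS]mulrC.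
- move=> i j; apply: continuous_atD.
    by apply: continuous_atZ; exact: continuous_rho.
  apply: continuous_atM; first exact: ca.
  apply: continuous_atM; last exact: continuous_rho.
  by apply: continuous_atZ; exact: continuous_coord.
Qed.

Lemma rhoD a b v : v != 0 -> rho a v * rho b v = rho (a + b) v.
Proof.
move=> v0; rewrite /rho -powRD; first by rewrite mulrDl.
by rewrite sqn_eq0 v0 implybT.
Qed.

Lemma rho2 v : rho 2 v = sqn v.
Proof. by rewrite /rho divff ?pnatr_eq0// powRr1// sqn_ge0. Qed.

Lemma rho0 v : rho 0 v = 1.
Proof. by rewrite /rho mul0r powRr0. Qed.

(** This is the Laplacian of |v|^a F for F homogeneous of degree b, homogeneity entering through
    Euler's identity. It serves with a = k, b = 0 to lift an eigenfunction to a harmonic function,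
    and with a = -k, b = k to bring a polynomial of degree k down to degree 0. *)
Lemma lap_rho_mul (a b : R) F dF ddF v : v != 0 ->
  \sum_i v 0 i * dF i v = b * F v ->
  lap (fun i j v => (a * (j == i)%:R * rho (a - 2) v +
         a * v 0 i * ((a - 2) * v 0 j * rho (a - 2 - 2) v)) * F v +
      a * v 0 i * rho (a - 2) v * dF j v +
      (a * v 0 j * rho (a - 2) v * dF i v + rho a v * ddF i j v)) v =
  a * (a + N%:R - 2 + 2 * b) * rho (a - 2) v * F v + rho a v * lap ddF v.
Proof.
move=> v0 euler; rewrite /lap mulr_sumr.
have s : sqn v * rho (a - 2 - 2) v = rho (a - 2) v.
  by rewrite -rho2 rhoD//; congr rho; ring.
transitivity (\sum_(i < N) (a * rho (a - 2) v * F v +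
   a * (a - 2) * (v 0 i ^+ 2 * rho (a - 2 - 2) v) * F v +
   2 * a * rho (a - 2) v * (v 0 i * dF i v) + rho a v * ddF i i v)).
  by apply: eq_bigr => i _; rewrite eqxx /=; ring.
rewrite !big_split /= sumr_const card_ord -!mulr_suml -!mulr_sumr euler.
rewrite -mulr_suml -/(sqn v) s -mulr_natl.
by congr (_ + _); ring.
Qed.

End C2_calculus.

Section eigenfunctions.
Context {R : realType} {n : nat}.
Local Notation N := (n.+1 + n.+1)%N.
Local Notation V := 'rV[R]_N.
Local Notation ei i := (delta_mx 0 i : V).
Local Notation S := (sphere R n).
Implicit Types (v w : V) (f g : S -> R) (z : S).

Lemma annulus_bounded (G : V -> R) (a b : R) : 0 < a ->
  (forall v, v != 0 -> {for v, continuous G}) ->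
  exists K, forall v, a <= enorm v <= b -> `|G v| <= K.
Proof.
move=> a0 cG; pose A := [set v : V | a <= enorm v <= b].
have cA : compact A.
  apply: bounded_closed_compact.
    exists b; split; [exact: num_real|move=> x bx v /= /andP[_ vb]].
    by apply: le_trans (norm_le_enorm v) _; exact: le_trans vb (ltW bx).
  have -> : A = (@enorm R N) @^-1` [set x | a <= x] `&` (@enorm R N) @^-1` [set x | x <= b].
    by apply/seteqP; split => v /=; [move=> /andP|move=> [h1 h2]; apply/andP].
  apply: closedI.
    by apply: (preimage_closed _ (@closed_ge _ _)) => y _; exact: continuous_enorm.
  by apply: (preimage_closed _ (@closed_le _ _)) => y _; exact: continuous_enorm.
have cGA : compact (G @` A).
  apply: continuous_compact => //; apply: continuous_in_subspaceT => v.
  rewrite inE => /andP[av _]; apply: cG.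
  by rewrite -enorm_gt0; exact: lt_le_trans av.
have [K [_ hK]] := compact_bounded cGA.
exists (K + 1) => v vA; apply: (hK (K + 1)); first by rewrite ltrDl.
by exists v.
Qed.

Lemma measurable_sphere_coord (i : 'I_N) :
  measurable_fun [set: S] (fun z => realify (val z) 0 i : R).
Proof.
move=> _ B mB; rewrite setTI; apply: sub_sigma_algebra.
rewrite -bigcup_seq; exists i; first by rewrite /= mem_index_enum.
by exists B => //; rewrite setTI.
Qed.

Lemma measurable_sphere_continuous (G : V -> R) :
  (forall v, v != 0 -> {for v, continuous G}) ->
  measurable_fun [set: S] (fun z => G (realify (val z))).
Proof.
move=> cG; apply: (@measurable_continuous_coord _ _ _ _ (fun z : S => realify (val z))).
- exact: measurable_sphere_coord.
- by move=> z; apply: cG; exact: realify_neq0.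
Qed.

Lemma radial_extZ f (c : R) v : 0 < c -> radial_ext f (c *: v) = radial_ext f v.
Proof. by move=> c0; rewrite /radial_ext radialZ. Qed.

Lemma radial_ext_realify f z : radial_ext f (realify (val z)) = f z.
Proof. by rewrite /radial_ext radial_realify. Qed.

Lemma C2_sphere_cont f : C2_sphere f -> forall v, v != 0 -> {for v, continuous (radial_ext f)}.
Proof. by move=> h v v0; have [] := h v v0. Qed.

Lemma C2_sphere_measurable f : C2_sphere f -> measurable_fun [set: S] f.
Proof.
move=> hf; have := measurable_sphere_continuous (C2_sphere_cont hf).
by congr measurable_fun; apply/funext => z; rewrite radial_ext_realify.
Qed.

Lemma C2_sphere_bounded f : C2_sphere f -> exists M, forall z, `|f z| <= M.
Proof.
move=> hf; have [K hK] := annulus_bounded 1 ltr01 (C2_sphere_cont hf).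
exists K => z; rewrite -radial_ext_realify; apply: hK.
by rewrite enormE sqn_realify sqrtr1 lexx.
Qed.

Section homogeneous0.
Variables (f : S -> R) (dF : 'I_N -> V -> R) (ddF : 'I_N -> 'I_N -> V -> R).
Hypothesis hF : C2data (radial_ext f) dF ddF.

Lemma euler0 v : v != 0 -> \sum_i v 0 i * dF i v = 0.
Proof.
move=> v0; have [_ <-] := C2data_dir v hF v0.
suff : is_derive v v (radial_ext f) 0 by case.
apply/is_derive_lineE; have := @is_derive_cst R R R (radial_ext f v) 0 1.
apply: near_eq_is_derive; near=> y.
rewrite /cst -[X in radial_ext f (X + _)]scale1r -scalerDl radial_extZ//.
suff : - 1 < y by rewrite -subr_gt0 opprK addrC.
near: y; apply: lt_nbhsr; exact: ltrN10.
Unshelve. all: by end_near. Qed.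

Lemma dF_homog (c : R) i v : 0 < c -> v != 0 -> dF i v = c * dF i (c *: v).
Proof.
move=> c0 v0.
have cv0 : c *: v != 0 by rewrite scaler_eq0 negb_or gt_eqF.
have [_ d1 _ _ _] := hF v0; have [_ d1c _ _ _] := hF cv0.
have [_ <-] := d1 i.
have := @is_derive_affine _ _ (radial_ext f) 0 v (ei i) c (dF i (c *: v)).
have -> : (fun w => radial_ext f (0 + c *: w)) = radial_ext f.
  by apply/funext => w; rewrite add0r radial_extZ.
by rewrite add0r => /(_ (d1c i))[_ ->].
Qed.

Lemma ddF_homog (c : R) i j v : 0 < c -> v != 0 -> ddF i j v = c ^+ 2 * ddF i j (c *: v).
Proof.
move=> c0 v0.
have cv0 : c *: v != 0 by rewrite scaler_eq0 negb_or gt_eqF.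
have [_ _ _ d2 _] := hF v0; have [_ _ _ d2c _] := hF cv0.
have [_ <-] := d2 i j.
have := @is_derive_affine _ _ (dF i) 0 v (ei j) c (ddF i j (c *: v)).
rewrite add0r => /(_ (d2c i j)) h.
have := @is_deriveZ _ _ _ _ c v (ei j) _ h.
suff nE : \near v, (c \*: (fun w => dF i (0 + c *: w))) v = dF i v.
  move=> /(near_eq_is_derive nE)[_ ->].
  by rewrite -[_ *: _]/(c * _) mulrA -expr2.
have := near_neq0 v0; apply: filterS => w w0 /=.
by rewrite add0r [RHS](dF_homog i c0 w0).
Qed.

End homogeneous0.

Variable d : nat.

(** The eigenvalue equation is given on the sphere only. Second derivatives of a function
    homogeneous of degree 0 are homogeneous of degree -2, which extends the equation to all v != 0
    with a factor |v|^-2. *)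
Lemma eigen_data f k : eigenspace_LB R n d k f -> exists dF ddF,
  [/\ C2data (radial_ext f) dF ddF,
    forall v, v != 0 -> \sum_i v 0 i * dF i v = 0 &
    forall v, v != 0 -> lap ddF v = - theta R d k * rho (-2) v * radial_ext f v].
Proof.
move=> [/C2_onP hF hL]; do 2 eexists; split; first exact: hF.
  by move=> v v0; exact: (euler0 hF v0).
move=> v v0.
have c0 : 0 < (enorm v)^-1 by rewrite invr_gt0 enorm_gt0.
transitivity ((enorm v)^-1 ^+ 2 * laplacian (radial_ext f) (realify (val (radial v)))).
  rewrite realify_radial// /lap /laplacian mulr_sumr; apply: eq_bigr => i _.
  exact: (ddF_homog hF).
have := hL (radial v); rewrite /laplace_beltrami => /eqP; rewrite eqr_oppLR => /eqP ->.
rewrite /radial_ext exprVn enorm_sqr.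
have -> : rho (-2) v = (sqn v)^-1.
  by rewrite /rho mulNr divff ?pnatr_eq0// powR_inv1// sqn_ge0.
by ring.
Qed.

End eigenfunctions.

Section cutoff.
Context {R : realType} {n : nat}.
Local Notation N := (n.+1 + n.+1)%N.
Local Notation V := 'rV[R]_N.
Local Notation ei i := (delta_mx 0 i : V).

Lemma continuous_at0 (U : topologicalType) (F : U -> R) (v : U) : (\forall w \near v, F w = 0) ->
  {for v, continuous F}.
Proof.
move=> h; have Fv : F v = 0 by exact: nbhs_singleton h.
have : F w @[w --> v] --> (0 : R).
  apply/cvgrPdist_le => e e0; apply: filterS h => w ->.
  by rewrite subrr normr0 ltW.
by rewrite -Fv.
Qed.

(** [A] may be singular outside [U]: there the cutoff vanishes on a whole neighbourhood and the
    product is locally 0. *)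
Lemma continuous_cutoff (c A : V -> R) (U : set V) : continuous c ->
  (forall v, U v \/ \forall w \near v, c w = 0) ->
  (forall v, U v -> {for v, continuous A}) -> continuous (fun v => c v * A v).
Proof.
move=> cc h cA v; have [Uv|nv] := h v.
  exact: (continuous_atM (cc v) (cA v Uv)).
apply: continuous_at0.
by apply: filterS nv => w ->; rewrite mul0r.
Qed.

Lemma is_derive_cutoff (c A : V -> R) (dc dA : V -> R) (u : V) (U : set V) :
  (forall v, is_derive v u c (dc v)) ->
  (forall v, U v \/ \forall w \near v, c w = 0 /\ dc w = 0) ->
  (forall v, U v -> is_derive v u A (dA v)) ->
  forall v, is_derive v u (fun v => c v * A v) (dc v * A v + c v * dA v).
Proof.
move=> hc h hA v; have [Uv|nv] := h v.
  have := @is_deriveM _ _ _ _ v u _ _ (hc v) (hA v Uv).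
  by congr (is_derive _ _ _ _); rewrite addrC; congr (_ + _); rewrite [LHS]mulrC.
have [c0 dc0] : c v = 0 /\ dc v = 0 by exact: nbhs_singleton nv.
rewrite c0 dc0 !mul0r add0r.
have := @is_derive_cst R V R 0 v u; apply: near_eq_is_derive.
by apply: filterS nv => w [-> _]; rewrite mul0r.
Qed.

(** Positive exactly for 1 < |v| < 2, so that [annulus_cut] is a C^1 radial cutoff supported away
    from the origin. *)
Definition annulus_fun (v : V) : R := (sqn v - 1) * (4 - sqn v).
Definition annulus_cut (v : V) : R := pos2 (annulus_fun v).

Lemma continuous_annulus_fun : continuous annulus_fun.
Proof.
move=> v; have : {for v, continuous (fun w => (sqn w - 1) * (4 - sqn w))}; last by [].
have c1 : {for v, continuous (@sqn R n)} by exact: continuous_sqn.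
apply: continuous_atM; apply: continuous_atD => //; try exact: cst_continuous.
exact: continuousN.
Qed.

Lemma is_derive_annulus_cut v i : is_derive v (ei i) annulus_cut
  (4 * Num.max 0 (annulus_fun v) * (5 - 2 * sqn v) * v 0 i).
Proof.
have h1 : is_derive v (ei i) (fun w : V => sqn w - 1) (2 * v 0 i).
  have := @is_deriveB R V R (@sqn R n) (cst 1) v (ei i) _ _ (is_derive_sqn v i) (is_derive_cst _ _ _).
  by rewrite subr0.
have h2 : is_derive v (ei i) (fun w : V => 4 - sqn w) (- (2 * v 0 i)).
  have := @is_deriveB R V R (cst 4) (@sqn R n) v (ei i) _ _ (is_derive_cst _ _ _) (is_derive_sqn v i).
  by rewrite sub0r.
have h3 := @is_deriveM _ _ _ _ v (ei i) _ _ h1 h2.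
have := is_derive_comp1 (is_derive_pos2 (annulus_fun v)) h3.
congr (is_derive _ _ _ _).
rewrite -![_ *: _]/(_ * _).
set m := Num.max _ _.
by ring.
Qed.

Lemma annulus_fun_out v : (sqn v < 1) || (4 < sqn v) -> annulus_fun v < 0.
Proof.
rewrite /annulus_fun => /orP[h|h]; first by rewrite nmulr_rlt0 ?subr_lt0// subr_gt0; lra.
by rewrite pmulr_rlt0 ?subr_gt0 ?subr_lt0//; lra.
Qed.

Lemma sqn_norm (M : R) (v : V) : 0 <= M -> M < `|v| -> M ^+ 2 < sqn v.
Proof.
move=> M0 Mv; rewrite -enorm_sqr ltrXn2r// ?nnegrE ?enorm_ge0//.
exact: lt_le_trans Mv (norm_le_enorm v).
Qed.

Lemma annulus_cutP (v : V) : v != 0 \/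
  \forall w \near v, annulus_cut w = 0 /\ Num.max 0 (annulus_fun w) = 0.
Proof.
have [->|v0] := eqVneq v 0; [right|by left].
have : \forall w \near (0 : V), sqn w < 1.
  have cs : sqn w @[w --> (0:V)] --> sqn (0 : V) by exact: continuous_sqn.
  apply: (cvgr_lt (sqn (0:V)) cs).
  by rewrite (_ : sqn 0 = 0) ?ltr01//; apply/eqP; rewrite sqn_eq0.
apply: filterS => w w1; have := @annulus_fun_out w; rewrite w1 => /(_ isT)/ltW h.
by rewrite /annulus_cut /pos2 (max_idPl h) expr0n.
Qed.

(** By continuity G exceeds G v0 / 2 on a sup-norm ball of radius r about v0; rescaling by r turns
    the estimate into one on the cube [-1/2, 1/2]^N, of volume 1. *)
Lemma lint_gt0 (G : V -> R) (v0 : V) : cmb G -> continuous G ->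
  (forall v, 0 <= G v) -> 0 < G v0 -> 0 < lint G.
Proof.
move=> cG contG G0 Gv0.
have : \forall w \near v0, G v0 / 2 < G w.
  by apply: (cvgr_gt (G v0) (contG v0)); rewrite ltr_pdivrMr// mulr_natr mulr2n ltrDl.
move=> /nbhs_ballP[r /= r0 hr].
pose B := tuple_box N (`[- (1/2), 1/2]%classic : set (measurableTypeR R)).
have mA : measurable (`[- (1/2), 1/2]%classic : set (measurableTypeR R)).
  exact: measurable_itv.
have mB : measurable B by exact: measurable_tuple_box.
have := lint_affine v0 r0 cG.
suff : 0 < lint (fun v => G (v0 + r *: v)).
  by move=> h E; move: h; rewrite E pmulr_rgt0// exprn_gt0// invr_gt0.
have cG' := cmb_affine v0 r0 cG.
have lB : lebesgue_tuple R N B = 1%:E.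
  have lA : @lebesgue_measure R `[- (1/2), 1/2]%classic = 1%:E.
    rewrite lebesgue_measure_itv/= lte_fin ifT; last by lra.
    by rewrite -EFinB; congr (_%:E); lra.
  by rewrite [LHS](lebesgue_tuple_box N mA) lA -EFin_expe expr1n.
apply: (@lt_le_trans _ _ (G v0 / 2)); first by rewrite divr_gt0.
rewrite -lee_fin /lint /Rintegral fineK; last first.
  by apply: integrable_fin_num => //; exact: (cmb_integrable cG').
apply: (@le_trans _ _ (\int[lebesgue_tuple R N]_(t in B) (G v0 / 2)%:E)%E).
  by rewrite integral_cst// [X in (_ * X)%E]lB mule1.
apply: (@le_trans _ _ (\int[lebesgue_tuple R N]_(t in B) (G (v0 + r *: row_of_tuple t))%:E)%E).
  apply: ge0_le_integral => //.
  - by move=> t _; rewrite lee_fin divr_ge0// ltW.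
  - by apply: measurable_funTS; apply/measurable_EFinP; exact: cG'.1.
  - move=> t Bt; rewrite lee_fin; apply/ltW/hr.
    rewrite -ball_normE /= opprD addNKr normrN normrZ gtr0_norm//.
    apply: (@le_lt_trans _ _ (r * (1/2))); last by lra.
    rewrite ler_wpM2l ?(ltW r0)//; apply: rV_norm_le => [|i]; first lra.
    by have := Bt i; rewrite /= in_itv/= -ler_norml mxE.
apply: ge0_subset_integral => //.
  by apply/measurable_EFinP; exact: cG'.1.
by move=> t _; rewrite lee_fin.
Qed.

End cutoff.

(** * Orthogonality of the eigenspaces *)

Lemma continuous_at_all (U T : topologicalType) (F : U -> T) :
  (forall v, {for v, continuous F}) -> continuous F.
Proof. by move=> h v; exact: h. Qed.

Section orthogonality.
Context {R : realType} {n : nat}.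
Local Notation N := (n.+1 + n.+1)%N.
Local Notation V := 'rV[R]_N.
Local Notation ei i := (delta_mx 0 i : V).
Variable d : nat.

(** The factor |v|^-2 is the one in the Laplacian of the radial extension of an eigenfunction. With
    it the divergence becomes a radial weight times a function on the sphere, ready for polar
    coordinates. *)
Let annulus_w (x : R) : R := pos2 ((x ^+ 2 - 1) * (4 - x ^+ 2)) * x `^ (-2).

Let annulus_wE (v : V) : annulus_w (enorm v) = annulus_cut v * rho (-2) v.
Proof.
rewrite /annulus_w enorm_sqr; congr (_ * _).
rewrite /rho -enorm_sqr -powR_mulrn ?enorm_ge0// -powRrM; congr (_ `^ _).
by field.
Qed.

Let annulus_w0 : annulus_w 0 = 0.
Proof. by rewrite /annulus_w powR0 ?mulr0// oppr_eq0 pnatr_eq0. Qed.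

Let annulus_w_ge0 x : 0 <= annulus_w x.
Proof. by rewrite mulr_ge0 ?powR_ge0// /pos2 sqr_ge0. Qed.

Let measurable_annulus_w : measurable_fun setT annulus_w.
Proof.
apply: measurable_funM; last exact: measurable_powR.
apply: measurable_funX; apply: measurable_maxr => //.
apply: measurable_funM; [apply: measurable_funB => //; exact: measurable_funX|].
by apply: measurable_funB => //; exact: measurable_funX.
Qed.

Lemma annulus_cut_out (v : V) : 2 < `|v| ->
  annulus_cut v = 0 /\ Num.max 0 (annulus_fun v) = 0.
Proof.
move=> h; have : 4 < sqn v.
  by have := sqn_norm (ler0n _ 2) h; rewrite -natrX.
move=> h4; have := @annulus_fun_out _ _ v; rewrite h4 orbT => /(_ isT)/ltW h0.
by rewrite /annulus_cut /pos2 (max_idPl h0) expr0n.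
Qed.

Lemma continuous_annulus_cut : continuous (@annulus_cut R n).
Proof.
move=> v; apply: (@continuous_comp _ _ _ (@annulus_fun R n) (@pos2 R)).
  exact: continuous_annulus_fun.
apply: (@continuous_comp _ _ _ (fun x : R => Num.max 0 x) (fun x : R => x ^+ 2)).
  exact: continuous_max0.
exact: exprn_continuous.
Qed.

Let cut_neq0 (v : V) : v != 0 \/ \forall w \near v, annulus_cut w = 0.
Proof.
by case: (annulus_cutP v) => [|h]; [left|right]; last by apply: filterS h => w [].
Qed.

Let cmb_cut (A : V -> R) : (forall v, v != 0 -> {for v, continuous A}) ->
  cmb (fun v => annulus_cut v * A v).
Proof.
move=> cA; apply: (@cmb_cont _ _ _ 2).
  exact: (continuous_cutoff continuous_annulus_cut cut_neq0 cA).
by move=> v /annulus_cut_out[-> _]; rewrite mul0r.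
Qed.

Lemma theta_inj k l : (0 < d)%N -> k != l -> theta R d k - theta R d l != 0.
Proof.
move=> d0 kl; have d3 : (1 : R) <= d%:R by rewrite ler1n.
have -> : theta R d k - theta R d l = (k%:R - l%:R) * (k%:R + l%:R + d%:R - 1).
  by rewrite /theta; ring.
rewrite mulf_neq0//; first by rewrite subr_eq0 eqr_nat.
case: (ltngtP k l) kl => // kl _; rewrite gt_eqF//.
  have : (1 : R) <= l%:R by rewrite ler1n (leq_ltn_trans _ kl).
  by have := ler0n R k; lra.
have : (1 : R) <= k%:R by rewrite ler1n (leq_ltn_trans _ kl).
by have := ler0n R l; lra.
Qed.

(* Integrate div (c (G grad F - F grad G)) = 0, with F, G the radial extensions
   and c a radial cutoff: grad c is radial while F and G are constant on rays. *)
Lemma eigenspace_orthogonal k l f g : d = (N - 1)%N -> k != l ->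
  eigenspace_LB R n d k f -> eigenspace_LB R n d l g -> inner f g = 0.
Proof.
move=> dE kl hf hg.
have [dF [ddF [hF eF lF]]] := eigen_data hf.
have [dG [ddG [hG eG lG]]] := eigen_data hg.
pose F := radial_ext f; pose G := radial_ext g.
pose W (i : 'I_N) (v : V) : R := dF i v * G v - F v * dG i v.
pose dW (i : 'I_N) (v : V) : R := ddF i i v * G v - F v * ddG i i v.
pose c' (i : 'I_N) (v : V) : R := 4 * Num.max 0 (annulus_fun v) * (5 - 2 * sqn v) * v 0 i.
have hW (i : 'I_N) (v : V) : v != 0 -> is_derive v (ei i) (W i) (dW i v).
  move=> v0; have [_ d1 _ d2 _] := hF v v0; have [_ e1 _ e2 _] := hG v v0.
  have h1 := @is_deriveM _ _ _ _ v (ei i) _ _ (d2 i i) (e1 i).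
  have h2 := @is_deriveM _ _ _ _ v (ei i) _ _ (d1 i) (e2 i i).
  have := @is_deriveB _ _ _ _ _ v (ei i) _ _ h1 h2.
  congr (is_derive _ _ _ _); rewrite -![_ *: _]/(_ * _) /dW.
  by rewrite /F /G; ring.
have cW (i : 'I_N) (v : V) : v != 0 -> {for v, continuous (W i)}.
  move=> v0; have [c0 _ c1 _ _] := hF v v0; have [e0 _ e1 _ _] := hG v v0.
  apply: continuous_atD; first exact: continuous_atM.
  by apply: continuousN; exact: continuous_atM.
have cdW (i : 'I_N) (v : V) : v != 0 -> {for v, continuous (dW i)}.
  move=> v0; have [c0 _ _ _ c2] := hF v v0; have [e0 _ _ _ e2] := hG v v0.
  apply: continuous_atD; first exact: continuous_atM.
  by apply: continuousN; exact: continuous_atM.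
have cc' i : continuous (c' i).
  apply: continuous_at_all => v; apply: continuous_atM; last exact: continuous_coord.
  apply: continuous_atM; last first.
    apply: continuous_atD; first exact: cst_continuous.
    by apply: continuousN; apply: continuous_atZ; exact: continuous_sqn.
  apply: continuous_atZ.
  apply: (@continuous_comp _ _ _ (@annulus_fun R n) (fun x => Num.max 0 x)).
    exact: continuous_annulus_fun.
  exact: continuous_max0.
have outc' (i : 'I_N) (v : V) : Num.max 0 (annulus_fun v) = 0 -> c' i v = 0.
  by rewrite /c' => ->; rewrite mulr0 !mul0r.
have nc' (i : 'I_N) (v : V) : v != 0 \/ \forall w \near v, annulus_cut w = 0 /\ c' i w = 0.
  case: (annulus_cutP v) => [|h]; [by left|right].
  by apply: filterS h => w [-> /outc' ->].
have nc'' (i : 'I_N) (v : V) : v != 0 \/ \forall w \near v, c' i w = 0.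
  case: (nc' i v) => [|h]; [by left|right].
  by apply: filterS h => w [].
have cc'W i : continuous (fun v => c' i v * W i v).
  exact: (continuous_cutoff (cc' i) (nc'' i) (cW i)).
have ccdW i : continuous (fun v => annulus_cut v * dW i v).
  exact: (continuous_cutoff continuous_annulus_cut cut_neq0 (cdW i)).
have I0 i : lint (fun v => c' i v * W i v + annulus_cut v * dW i v) = 0.
  apply: (@lint_partial _ _ i (fun v => annulus_cut v * W i v) _ 2).
  - apply: (@is_derive_cutoff _ _ _ _ (c' i) (dW i) (ei i) [set v | v != 0]) => //.
    - by move=> v; exact: is_derive_annulus_cut.
    - by move=> v; exact: nc'.
  - exact: (continuous_cutoff continuous_annulus_cut cut_neq0 (cW i)).
  - by apply: continuous_at_all => v; apply: continuous_atD; [exact: cc'W|exact: ccdW].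
  - by move=> v /annulus_cut_out[-> _]; rewrite mul0r.
  - by move=> v /annulus_cut_out[-> /outc' ->]; rewrite !mul0r addr0.
have cmb1 i : cmb (fun v => c' i v * W i v).
  apply: (cmb_cont (cc'W i)) (_ : forall v, 2 < `|v| -> _).
  by move=> v /annulus_cut_out[_ /outc' ->]; rewrite mul0r.
have cmb2 i : cmb (fun v => annulus_cut v * dW i v).
  by apply: cmb_cut => v v0; exact: cdW.
have E (v : V) : \sum_i (c' i v * W i v + annulus_cut v * dW i v) =
    (theta R d l - theta R d k) * (annulus_w (enorm v) * (F v * G v)).
  rewrite annulus_wE.
  have [v0|v0] := eqVneq v 0.
    have [|[a0 m0]] : v != 0 \/ annulus_cut v = 0 /\ Num.max 0 (annulus_fun v) = 0.
        by case: (annulus_cutP v) => [|h]; [left|right; exact: nbhs_singleton h].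
      by rewrite v0 eqxx.
    by rewrite big1 ?a0 ?(mul0r, mulr0)// => i _; rewrite (outc' i v m0) !mul0r addr0.
  rewrite big_split /= -mulr_sumr.
  have -> : \sum_i c' i v * W i v = 0.
    transitivity (4 * Num.max 0 (annulus_fun v) * (5 - 2 * sqn v) *
       ((\sum_i v 0 i * dF i v) * G v - F v * \sum_i v 0 i * dG i v)).
      rewrite mulr_suml mulr_sumr -sumrB mulr_sumr; apply: eq_bigr => i _.
      by rewrite /c' /W; ring.
    by rewrite eF// eG// mul0r mulr0 subrr mulr0.
  have -> : \sum_i dW i v = lap ddF v * G v - F v * lap ddG v.
    by rewrite /dW sumrB -mulr_suml -mulr_sumr.
  by rewrite lF// lG// -/(F v) -/(G v); ring.
have thkl : theta R d l - theta R d k != 0 by apply: theta_inj; rewrite 1?eq_sym// dE addSn addnS subn1.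
have [Mf hMf] := C2_sphere_bounded hf.1; have [Mg hMg] := C2_sphere_bounded hg.1.
have mfg : measurable_fun setT (fun z => f z * g z).
  by apply: measurable_funM; [exact: C2_sphere_measurable hf.1|exact: C2_sphere_measurable hg.1].
have cw : cmb (fun v : V => annulus_w (enorm v)).
  have := @cmb_cut (rho (-2)) (fun v => @continuous_rho _ _ (-2) v).
  by congr cmb; apply/funext => v; rewrite annulus_wE.
have fgM z : `|f z * g z| <= Mf * Mg by rewrite normrM ler_pM.
have cwfg := cmb_radial measurable_annulus_w cw mfg fgM.
have : lint (fun v => \sum_i (c' i v * W i v + annulus_cut v * dW i v)) = 0.
  rewrite lint_sum ?big1// => i; exact: cmbD.
rewrite (_ : (fun v => _) = (fun v => (theta R d l - theta R d k) *
    (annulus_w (enorm v) * (f (radial v) * g (radial v))))); last first.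
  by apply/funext => v; rewrite E.
rewrite lintZ// => /eqP; rewrite mulf_eq0 (negbTE thkl)/=.
rewrite (lint_polar measurable_annulus_w annulus_w_ge0 annulus_w0 cw mfg fgM).
rewrite mulf_eq0 gt_eqF/=; first by move/eqP.
(* Here |v1|^2 = 2 lies strictly between 1 and 4, so the radial weight is positive at v1 and its
   integral can be cancelled. *)
pose v1 : V := (Num.sqrt 2) *: ei ord0.
have sv1 : sqn v1 = 2.
  rewrite /v1 sqnZ sqr_sqrtr// /sqn (bigD1 ord0)//= big1 ?addr0 => [|j j0].
    by rewrite mxE !eqxx expr1n mulr1.
  by rewrite mxE (negbTE j0) andbF expr0n.
have v10 : v1 != 0 by rewrite -sqn_gt0 sv1.
apply: (@lint_gt0 _ _ _ v1) => //.
- rewrite (_ : (fun v => _) = (fun v : V => annulus_cut v * rho (-2) v)).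
    exact: (continuous_cutoff continuous_annulus_cut cut_neq0 (fun v => @continuous_rho _ _ (-2) v)).
  by apply/funext => v; exact: annulus_wE.
- rewrite annulus_wE mulr_gt0//; last by rewrite powR_gt0// sv1.
  by rewrite /annulus_cut /pos2 /annulus_fun sv1 exprn_gt0// lt_max; apply/orP; right; lra.
Qed.

End orthogonality.

(** * The mean value property *)

Section triangle.
Context {R : realType} {n : nat}.
Local Notation N := (n.+1 + n.+1)%N.
Local Notation V := 'rV[R]_N.
Implicit Types v w : V.

(** Coordinatewise Young's inequality with weights |w|/|v| and |v|/|w|: summed over the coordinates,
    the right-hand sides add up to exactly (|v| + |w|)^2. *)
Lemma enormD v w : enorm (v + w) <= enorm v + enorm w.
Proof.
have [->|v0] := eqVneq v 0; first by rewrite add0r lerDr enorm_ge0.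
have [->|w0] := eqVneq w 0; first by rewrite addr0 lerDl enorm_ge0.
have a0 : 0 < enorm v by rewrite enorm_gt0.
have b0 : 0 < enorm w by rewrite enorm_gt0.
have h : sqn (v + w) <= (1 + enorm w / enorm v) * sqn v + (1 + enorm v / enorm w) * sqn w.
  rewrite /sqn !mulr_sumr -big_split; apply: ler_sum => i _; rewrite !mxE /=.
  set x := v 0 i; set y := w 0 i.
  have -> : (1 + enorm w / enorm v) * x ^+ 2 + (1 + enorm v / enorm w) * y ^+ 2 =
      (x + y) ^+ 2 + (enorm w * x - enorm v * y) ^+ 2 / (enorm v * enorm w).
    by field; rewrite !gt_eqF.
  by rewrite lerDl divr_ge0 ?sqr_ge0// mulr_ge0// ltW.
rewrite -(ler_pXn2r (n := 2))// ?nnegrE ?enorm_ge0 ?addr_ge0 ?enorm_ge0//.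
rewrite enorm_sqr; apply: (le_trans h); rewrite -!enorm_sqr.
suff -> : (1 + enorm w / enorm v) * enorm v ^+ 2 + (1 + enorm v / enorm w) * enorm w ^+ 2 =
  (enorm v + enorm w) ^+ 2 by [].
by field; rewrite !gt_eqF.
Qed.

Lemma enormN v : enorm (- v) = enorm v.
Proof. by rewrite !enormE -scaleN1r sqnZ sqrrN expr1n mul1r. Qed.

Lemma enorm_annulus v w : enorm v - enorm w <= enorm (v + w) <= enorm v + enorm w.
Proof.
rewrite enormD andbT lerBlDr -{1}(addrK w v) -[enorm w]enormN.
exact: enormD.
Qed.

End triangle.

Section mean_value.
Context {R : realType} {n : nat}.
Local Notation N := (n.+1 + n.+1)%N.
Local Notation V := 'rV[R]_N.
Local Notation ei i := (delta_mx 0 i : V).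

Definition harmonic (F : V -> R) : Prop := exists dF ddF, C2data F dF ddF /\
  forall v, v != 0 -> lap ddF v = 0.

Lemma harmonic_sum (I : Type) (s : seq I) (c : I -> R) (F : I -> V -> R) :
  (forall i, harmonic (F i)) -> harmonic (fun v => \sum_(i <- s) c i * F i v).
Proof.
move=> /choice[dF /choice[ddF h]].
exists (fun k v => \sum_(i <- s) c i * dF i k v), (fun k l v => \sum_(i <- s) c i * ddF i k l v).
split; first by apply: C2data_sum => i; exact: (h i).1.
move=> v v0; rewrite /lap exchange_big /= big1// => i _.
by rewrite -mulr_sumr [X in _ * X](h i).2 ?mulr0.
Qed.

(** By [lap_rho_mul] with b = 0 the factor |v|^k contributes k (k + N - 2), which is theta_k as d =
    N - 1, and cancels the eigenvalue of f. *)
Lemma harmonic_lift d k f : d = (N - 1)%N -> eigenspace_LB R n d k f ->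
  harmonic (fun v => rho k%:R v * f (radial v)).
Proof.
move=> dE /eigen_data[dF [ddF [hF eF lF]]].
have := C2data_mul (@C2data_rho R n k%:R) hF => h.
do 2 eexists; split; first exact: h.
move=> v v0; rewrite (@lap_rho_mul _ _ k%:R 0)//; last by rewrite eF// mul0r.
rewrite lF// /theta dE natrB; last by rewrite addSn.
have e : rho k%:R v * rho (-2) v = rho (k%:R - 2) v by rewrite rhoD.
by rewrite -[X in X * _ + _ = _]mulrA -e /radial_ext; ring.
Qed.

(** Preferred to the indicator of the ball because phi(y) y is the gradient of a compactly supported
    C^1 function, the [psi] below. *)
Definition phi (y : V) : R := Num.max 0 (1 - sqn y).

Lemma phi_ge0 y : 0 <= phi y. Proof. by rewrite le_max lexx. Qed.

Lemma phi_le1 y : phi y <= 1.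
Proof. by rewrite ge_max ler01 lerBlDr lerDl sqn_ge0. Qed.

Lemma phi_out y : 1 <= sqn y -> phi y = 0.
Proof. by move=> h; apply/max_idPl; rewrite subr_le0. Qed.

Lemma phi_out_norm (y : V) : 1 < `|y| -> phi y = 0.
Proof. by move=> h; apply/phi_out/ltW; have := sqn_norm ler01 h; rewrite expr1n. Qed.

Lemma continuous_phi : continuous phi.
Proof.
move=> v; apply: (@continuous_comp _ _ _ (fun y => 1 - sqn y) (fun x => Num.max 0 x)).
  apply: continuous_atD; first exact: cst_continuous.
  by apply: continuousN; exact: continuous_sqn.
exact: continuous_max0.
Qed.

Lemma cmb_phi : cmb phi.
Proof. by apply: (@cmb_cont _ _ _ 1 continuous_phi) => v; exact: phi_out_norm. Qed.

Lemma lint_phi_gt0 : 0 < lint phi.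
Proof.
apply: (@lint_gt0 _ _ phi 0); [exact: cmb_phi|exact: continuous_phi|exact: phi_ge0|].
by rewrite /phi (_ : sqn 0 = 0) ?subr0 ?lt_max ?ltr01 ?orbT//; apply/eqP; rewrite sqn_eq0.
Qed.

Let psi (y : V) : R := - (1/4) * pos2 (1 - sqn y).

Let continuous_psi : continuous psi.
Proof.
apply: continuous_at_all => v; apply: continuous_atZ.
apply: (@continuous_comp _ _ _ phi (fun x : R => x ^+ 2)); first exact: continuous_phi.
exact: exprn_continuous.
Qed.

Let is_derive_psi v i : is_derive v (ei i) psi (phi v * v 0 i).
Proof.
have h2 : is_derive v (ei i) (fun w : V => 1 - sqn w) (- (2 * v 0 i)).
  have := @is_deriveB R V R (cst 1) (@sqn R n) v (ei i) _ _ (is_derive_cst _ _ _) (is_derive_sqn v i).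
  by rewrite sub0r.
have := @is_deriveZ _ _ _ _ (- (1/4)) _ _ _ (@is_derive_comp1 R V (@pos2 R) (fun w => 1 - sqn w) v (ei i) _ _ (is_derive_pos2 (1 - sqn v)) h2).
congr (is_derive _ _ _ _).
by rewrite -![_ *: _]/(_ * _) /phi; field.
Qed.

Let psi_phi0 v : phi v = 0 -> psi v = 0.
Proof. by rewrite /psi /pos2 /phi => ->; rewrite expr0n mulr0. Qed.

Section mv.
Variables (F : V -> R) (dF : 'I_N -> V -> R) (ddF : 'I_N -> 'I_N -> V -> R) (x : V).
Hypotheses (hF : C2data F dF ddF) (hL : forall v, v != 0 -> lap ddF v = 0).
Hypothesis x1 : enorm x = 1.

(** Differentiation in t takes place on an open interval containing every radius up to 1/2, while x
    + t y keeps distance at least 1/4 from the origin, where F may be singular. *)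
Let inside (t : R) (y : V) : `|t| < 3/4 -> sqn y <= 1 -> 1/4 <= enorm (x + t *: y) <= 7/4.
Proof.
move=> t1 y1.
have : enorm (t *: y) <= 3/4.
  rewrite enormE sqnZ sqrtrM ?sqr_ge0// sqrtr_sqr -enormE.
  have : enorm y <= 1 by rewrite enormE -sqrtr1 ler_wsqrtr.
  by move=> h; apply: (@le_trans _ _ (3/4 * 1)); [apply: ler_pM => //; [exact: enorm_ge0|exact: ltW]|lra].
by have := enorm_annulus x (t *: y); rewrite x1 => /andP[h1 h2] h3; apply/andP; split; lra.
Qed.

Let inside_neq0 (t : R) (y : V) : `|t| < 3/4 -> sqn y <= 1 -> x + t *: y != 0.
Proof.
by move=> t1 y1; have /andP[h _] := inside t1 y1; rewrite -enorm_gt0; lra.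
Qed.

Let dich (t : R) (y : V) : `|t| < 3/4 -> x + t *: y != 0 \/ \forall w \near y, phi w = 0.
Proof.
move=> t1; have [y1|y1] := leP (sqn y) 1; [by left; exact: inside_neq0|right].
have cs : sqn w @[w --> y] --> sqn y by exact: continuous_sqn.
have : \forall w \near y, 1 < sqn w by apply: (cvgr_gt (sqn y) cs).
by apply: filterS => w /ltW /phi_out.
Qed.

Let cA (A : V -> R) (t : R) : (forall v, v != 0 -> {for v, continuous A}) ->
  forall y : V, x + t *: y != 0 -> {for y, continuous (fun y : V => A (x + t *: y))}.
Proof.
move=> cA y y0; apply: (@continuous_comp _ _ _ (fun y : V => x + t *: y) A); last exact: cA.
apply: (@continuousD _ _ _ (cst x) (fun y : V => t *: y) y); first exact: cst_continuous.
exact: scaler_continuous.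
Qed.

Let phiA_cont (A : V -> R) (t : R) : `|t| < 3/4 -> (forall v, v != 0 -> {for v, continuous A}) ->
  continuous (fun y : V => phi y * A (x + t *: y)).
Proof.
move=> t1 hA; apply: (continuous_cutoff continuous_phi (U := [set y | x + t *: y != 0])).
  by move=> y; exact: dich.
by move=> y; exact: cA.
Qed.

(* The gradient of psi is phi(y) y, so the derivative in t of the integral of
   phi(y) F(x + t y) is, by parts, minus the integral of t psi times the
   Laplacian of F. *)
Lemma mean_value r : 0 < r -> r <= 1/2 ->
  lint (fun y => phi y * F (x + r *: y)) = F x * lint phi.
Proof.
move=> r0 r12.
pose f (t : R) (y : V) : R := phi y * F (x + t *: y).
pose df (t : R) (y : V) : R := phi y * \sum_i y 0 i * dF i (x + t *: y).
have cF v : v != 0 -> {for v, continuous F} by move=> /hF[].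
have cdF i v : v != 0 -> {for v, continuous (dF i)} by move=> /hF[].
have cddF i j v : v != 0 -> {for v, continuous (ddF i j)} by move=> /hF[].
have cf t : `|t| < 3/4 -> cmb (f t).
  move=> t1; apply: (@cmb_cont _ _ _ 1); first exact: phiA_cont.
  by move=> v /phi_out_norm; rewrite /f => ->; rewrite mul0r.
have fd t y : `|t| < 3/4 -> is_derive t (1:R) (f ^~ y) (df t y).
  move=> t1; have [y1|/ltW /phi_out y1] := leP (sqn y) 1; last first.
    rewrite /f /df y1 mul0r (_ : (fun t => _) = cst 0); first exact: is_derive_cst.
    by apply/funext => s; rewrite mul0r.
  have := @is_derive_line _ _ F x y t _ (C2data_dir y hF (inside_neq0 t1 y1)).
  by move=> h; have := @is_deriveZ _ _ _ _ (phi y) t 1 _ h.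
have [K hK] : exists K, forall t y, `|t| < 3/4 -> `|df t y| <= K.
  have /choice[Ki hKi] : forall i, exists K, forall v, 1/4 <= enorm v <= 7/4 -> `|dF i v| <= K.
    by move=> i; apply: annulus_bounded; [lra|exact: cdF].
  exists (\sum_i `|Ki i|) => t y t1.
  have [y1|/ltW /phi_out y1] := leP (sqn y) 1; last first.
    by rewrite /df y1 mul0r normr0; apply: sumr_ge0.
  rewrite normrM (ger0_norm (phi_ge0 y)).
  apply: (@le_trans _ _ (1 * \sum_i `|y 0 i * dF i (x + t *: y)|)).
    by apply: ler_pM => //; [exact: phi_ge0|exact: phi_le1|exact: ler_norm_sum].
  rewrite mul1r; apply: ler_sum => i _; rewrite normrM -[leRHS]mul1r.
  apply: ler_pM => //.
    apply: (le_trans (rV_coord_le_norm _ _)); apply: (le_trans (norm_le_enorm _)).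
    by rewrite enormE -sqrtr1 ler_wsqrtr.
  by apply: le_trans (ler_norm _); apply: hKi; exact: inside.
have dfM t y : `|t| < 3/4 -> 1 < `|y| -> df t y = 0.
  by move=> _ /phi_out_norm h; rewrite /df h mul0r.
have df0 t : `|t| < 3/4 -> lint (df t) = 0.
  move=> t1.
  have cphii i : continuous (fun y : V => phi y * y 0 i).
    apply: continuous_at_all => y; apply: continuous_atM; first exact: continuous_phi.
    exact: continuous_coord.
  have dich' (i : 'I_N) (y : V) : x + t *: y != 0 \/ \forall w \near y, phi w * w 0 i = 0.
    by case: (dich y t1) => h; [left|right; apply: filterS h => w ->; rewrite mul0r].
  have dich2 (y : V) : x + t *: y != 0 \/ \forall w \near y, psi w = 0.
    by case: (dich y t1) => h; [left|right; apply: filterS h => w /psi_phi0].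
  have c1 i : continuous (fun y : V => phi y * y 0 i * dF i (x + t *: y)).
    apply: (continuous_cutoff (cphii i) (dich' i)) => y; apply: cA; exact: cdF.
  have c2 i : continuous (fun y : V => psi y * (t * ddF i i (x + t *: y))).
    apply: (continuous_cutoff continuous_psi dich2) => y y0; apply: continuous_atZ.
    by apply: cA => //; exact: cddF.
  have I0 i : lint (fun y => phi y * y 0 i * dF i (x + t *: y) +
      psi y * (t * ddF i i (x + t *: y))) = 0.
    apply: (@lint_partial _ _ i (fun y => psi y * dF i (x + t *: y)) _ 1).
    - apply: (@is_derive_cutoff _ _ psi (fun y => dF i (x + t *: y))
        (fun y => phi y * y 0 i) (fun y => t * ddF i i (x + t *: y)) (ei i)
        [set y | x + t *: y != 0]).
      + by move=> v; exact: is_derive_psi.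
      + move=> y; case: (dich y t1) => h; [by left|right].
        by apply: filterS h => w h; rewrite (psi_phi0 h) h mul0r.
      + move=> v v0; apply: is_derive_affine; have [_ _ _ + _] := hF v0; exact.
    - apply: (continuous_cutoff continuous_psi dich2) => y; apply: cA; exact: cdF.
    - by apply: continuous_at_all => v; apply: continuous_atD; [exact: c1|exact: c2].
    - by move=> v /phi_out_norm/psi_phi0 ->; rewrite mul0r.
    - by move=> v /phi_out_norm h; rewrite (psi_phi0 h) h !mul0r addr0.
  have cm1 i : cmb (fun y : V => phi y * y 0 i * dF i (x + t *: y)).
    by apply: (@cmb_cont _ _ _ 1 (c1 i)) => v /phi_out_norm ->; rewrite !mul0r.
  have cm2 i : cmb (fun y : V => psi y * (t * ddF i i (x + t *: y))).
    by apply: (@cmb_cont _ _ _ 1 (c2 i)) => v /phi_out_norm/psi_phi0 ->; rewrite !mul0r.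
  transitivity (lint (fun y => \sum_i (phi y * y 0 i * dF i (x + t *: y) +
      psi y * (t * ddF i i (x + t *: y))))); last first.
    by rewrite lint_sum ?big1// => i; exact: cmbD.
  congr lint; apply/funext => y; rewrite big_split /= -!mulr_sumr /df.
  have -> : psi y * (t * \sum_i ddF i i (x + t *: y)) = 0.
    have [y0|y0] := eqVneq (x + t *: y) 0; last by rewrite [X in _ * (_ * X)]hL// !mulr0.
    case: (dich y t1) => [|h]; first by rewrite y0 eqxx.
    by rewrite (psi_phi0 (nbhs_singleton h)) mul0r.
  by rewrite addr0 mulr_sumr; apply: eq_bigr => i _; rewrite mulrA.
have der := lint_derive cf fd hK dfM.
have [|s sr E] := @MVT_line R R (fun t => lint (f t)) (fun=> 0) 0 1 r.
  move=> s; rewrite (gtr0_norm r0) => sr; rewrite add0r [_%:A]mulr1.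
  have s34 : `|s| < 3/4 by lra.
  by rewrite -(df0 s s34); exact: der.
move: E; rewrite mul0r add0r [_%:A]mulr1 => /eqP; rewrite subr_eq0 => /eqP ->.
rewrite /f -lintZ; last exact: cmb_phi.
by congr lint; apply/funext => y; rewrite scale0r addr0 mulrC.
Qed.

End mv.

End mean_value.

(** * Even powers of harmonic functions and the kernel bound *)

Lemma bernoulli_even (R : realDomainType) (s : nat) (x : R) :
  1 + (s.*2)%:R * x <= (1 + x) ^+ s.*2.
Proof.
have [x1|x1] := leP (-1) x.
  elim: s.*2 => [|m ih]; first by rewrite expr0 mul0r addr0.
  rewrite exprSr; apply: (@le_trans _ _ ((1 + m%:R * x) * (1 + x))).
    rewrite -natr1 (_ : (1 + m%:R * x) * (1 + x) = 1 + (m%:R + 1) * x + m%:R * x ^+ 2); last by ring.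
    by rewrite lerDl mulr_ge0// ?sqr_ge0// ler0n.
  by apply: ler_wpM2r => //; rewrite -(lerD2l 1) in x1; lra.
case: s => [|s]; first by rewrite expr0 mul0r addr0.
apply: (@le_trans _ _ 0); last by rewrite -mul2n exprM exprn_ge0// sqr_ge0.
have : 1 <= s.+1.*2%:R :> R by rewrite ler1n.
by move=> h; nra.
Qed.

(** Bernoulli's inequality at (a - c) / c, multiplied by c^(2s). Integrated against the weight [phi]
    it plays the role of Jensen's inequality and turns the mean value property into a sub-mean value
    property of even powers. *)
Lemma even_power_tangent (R : realFieldType) (s : nat) (a c : R) : (0 < s)%N ->
  c ^+ s.*2 + (s.*2)%:R * c ^+ s.*2.-1 * (a - c) <= a ^+ s.*2.
Proof.
move=> s0; have ev x : 0 <= x ^+ s.*2 :> R by rewrite -mul2n exprM exprn_ge0// sqr_ge0.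
have [->|c0] := eqVneq c 0.
  have s2 : (0 < s.*2.-1)%N by case: s s0 {ev} => // s _; rewrite doubleS.
  by rewrite !expr0n !gtn_eqF// ?double_gt0// mulr0 mul0r addr0.
have := ler_wpM2l (ev c) (bernoulli_even s ((a - c) / c)).
have e1 : c ^+ s.*2 = c * c ^+ s.*2.-1 by rewrite -exprS prednK// double_gt0.
have -> : 1 + (a - c) / c = a / c by field.
have -> : c ^+ s.*2 * (a / c) ^+ s.*2 = a ^+ s.*2.
  by rewrite -exprMn mulrCA divff// mulr1.
apply: le_trans.
by rewrite e1 le_eqVlt; apply/orP; left; apply/eqP; field.
Qed.

Section window.
Context {R : realType} {n : nat}.
Local Notation N := (n.+1 + n.+1)%N.
Local Notation V := 'rV[R]_N.

(** A shell around the unit sphere replaces the ball about x: it contains the open ball of radius r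
    and is invariant under rotations, so polar coordinates and orthonormality apply. The half-open
    bounds make it a difference of two closed balls centred at 0. *)
Definition win (r x : R) : R := if 1 - r < x <= 1 + r then 1 else 0.

Lemma win_ge0 r x : 0 <= win r x. Proof. by rewrite /win; case: ifP. Qed.

Lemma measurable_win r : measurable_fun setT (win r).
Proof.
apply: measurable_fun_ifT => //; apply: measurable_and.
  exact: measurable_fun_ltr.
exact: measurable_fun_ler.
Qed.

Lemma win0 r : r <= 1/2 -> win r 0 = 0.
Proof. by move=> r1; rewrite /win ifF//; apply/negP => /andP[h _]; lra. Qed.

Lemma cmb_window (A : V -> R) (r : R) : 0 < r -> r <= 1/2 ->
  (forall v, v != 0 -> {for v, continuous A}) -> cmb (fun v => win r (enorm v) * A v).
Proof.
move=> r0 r1 cA; split.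
  pose v1 : V := const_mx 1.
  have v10 : v1 != 0.
    by apply/eqP => /rowP/(_ ord0); rewrite !mxE => /eqP; rewrite oner_eq0.
  have mn : measurable_fun setT (fun t => enorm (@row_of_tuple R n t)).
    exact: (meas_cont (@continuous_enorm R n)).
  pose f (t : N.-tuple (measurableTypeR R)) : V :=
    if enorm (row_of_tuple t) == 0 then v1 else row_of_tuple t.
  have f0 t : f t != 0 by rewrite /f enorm_eq0; case: ifPn.
  have mA : measurable_fun setT (A \o f).
    apply: measurable_continuous_coord => [i|t]; last exact: cA.
    rewrite (_ : (fun _ => _) = (fun t : N.-tuple (measurableTypeR R) =>
      if enorm (row_of_tuple t) == 0 then v1 0 i else (row_of_tuple t : V) 0 i)).
      apply: measurable_fun_ifT => //; first exact: measurable_fun_eqr.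
      exact: measurable_row_coord.
    by apply/funext => t; rewrite /f; case: ifP.
  rewrite /meas (_ : _ \o _ = (fun t => win r (enorm (row_of_tuple t)) * (A \o f) t)).
    apply: measurable_funM => //; apply: (measurableT_comp (measurable_win r)); exact: mn.
  apply/funext => t /=; rewrite /f; case: eqVneq => // ->.
  by rewrite win0// !mul0r.
have [K hK] : exists K, forall v, 1 - r <= enorm v <= 1 + r -> `|A v| <= K.
  by apply: annulus_bounded; [lra|exact: cA].
exists (Num.max `|K| (1 + r)) => v; split.
  rewrite /win; case: ifP => [/andP[h1 h2]|_]; last by rewrite mul0r normr0 le_max normr_ge0.
  by rewrite mul1r le_max (le_trans _ (ler_norm K))// hK// h2 (ltW h1).
rewrite gt_max => /andP[_ h]; rewrite /win ifF ?mul0r//; apply/negP => /andP[_ h2].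
by have := norm_le_enorm v; lra.
Qed.

Definition ball_vol : R := lint (fun v : V => if enorm v <= 1 then 1 else 0).

Let cmb_ball (a : R) : cmb (fun v : V => if enorm v <= a then 1 else 0).
Proof.
split.
  have mn : measurable_fun setT (fun t => enorm (@row_of_tuple R n t)).
    exact: (meas_cont (@continuous_enorm R n)).
  by apply: measurable_fun_ifT => //; exact: measurable_fun_ler.
exists (Num.max 1 a) => v; split; first by case: ifP; rewrite ?normr1 ?normr0 le_max ?lexx ?ler01.
rewrite gt_max => /andP[_ h]; rewrite ifF//; apply/negP => h2.
by have := norm_le_enorm v; lra.
Qed.

Lemma ball_vol_gt0 : 0 < ball_vol.
Proof.
apply: (lt_le_trans (@lint_phi_gt0 R n)); apply: le_lint; [exact: cmb_phi|exact: cmb_ball|].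
move=> v; case: ifPn => [_|h]; first exact: phi_le1.
by rewrite phi_out// -enorm_sqr expr_ge1 ?enorm_ge0// ltW// ltNge.
Qed.

Lemma ball_vol_ge0 : 0 <= ball_vol.
Proof. exact: ltW ball_vol_gt0. Qed.

Let lint_ball (a : R) : 0 < a ->
  lint (fun v : V => if enorm v <= a then 1 else 0) = a ^+ N * ball_vol.
Proof.
move=> a0; have := lint_affine 0 a0 (cmb_ball a).
have -> : (fun v : V => if enorm (0 + a *: v) <= a then 1 else 0) =
    (fun v : V => if enorm v <= 1 then 1 else 0) :> (V -> R).
  apply/funext => v; rewrite add0r enormZ ?(ltW a0)//.
  by rewrite -[X in _ <= X](mulr1 a) ler_pM2l.
by rewrite -/ball_vol => ->; rewrite mulrA -exprMn mulfV ?expr1n ?mul1r// gt_eqF.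
Qed.

Lemma cmb_win r : 0 < r -> r <= 1/2 -> cmb (fun v : V => win r (enorm v)).
Proof.
move=> r0 r1; have := @cmb_window (cst 1) r r0 r1 (fun v _ => @cst_continuous V R 1 v).
by congr cmb; apply/funext => v; rewrite /cst mulr1.
Qed.

(** That the shell has volume of order r is what improves the normalization r^-N of the ball to r^-d
    in the kernel bound. *)
Lemma lint_win r : 0 < r -> r <= 1/2 ->
  lint (fun v : V => win r (enorm v)) <= 2 * N%:R * 2 ^+ N * ball_vol * r.
Proof.
move=> r0 r1.
have -> : (fun v : V => win r (enorm v)) = (fun v : V => (if enorm v <= 1 + r then 1 else 0) +
    (-1) * (if enorm v <= 1 - r then 1 else 0)).
  apply/funext => v; rewrite /win; case: (leP (enorm v) (1 - r)) => h.
    by rewrite /= mulr1 ifT ?subrr//; lra.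
  by rewrite /= mulr0 addr0.
rewrite lintD; last 2 first.
- exact: cmb_ball.
- by apply: cmbZ; exact: cmb_ball.
rewrite lintZ; last exact: cmb_ball.
rewrite !lint_ball; [|lra|lra].
rewrite mulN1r -mulrBl mulrAC ler_wpM2r ?ball_vol_ge0//.
rewrite subrXX (_ : 1 + r - (1 - r) = 2 * r); last by ring.
rewrite (_ : 2 * N%:R * 2 ^+ N * r = 2 * r * (N%:R * 2 ^+ N)); last by ring.
rewrite ler_wpM2l//; first lra.
rewrite mulr_natl -[X in _ *+ X]card_ord -sumr_const; apply: ler_sum => i _.
have a1 : 1 + r <= 2 by lra.
have a0 : 0 <= 1 + r by lra.
have b1 : 1 - r <= 1 by lra.
have b0 : 0 <= 1 - r by lra.
rewrite -[leRHS]mulr1; apply: ler_pM; rewrite ?exprn_ge0//; last exact: exprn_ile1.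
apply: (@le_trans _ _ (2 ^+ (N.-1 - i))); first by apply: lerXn2r; rewrite ?nnegrE.
rewrite ler_weXn2l ?ler1n//; apply: leq_trans (leq_subr _ _) (leq_pred _).
Qed.

Variables (F : V -> R) (x : V) (r : R).
Hypotheses (hF : harmonic F) (x1 : enorm x = 1) (r0 : 0 < r) (r12 : r <= 1/2).

(** The tangent inequality at F x is integrated against phi over the ball of radius r about x, where
    the mean value property removes the linear part. Then phi <= 1 and the ball is enlarged to the
    shell. *)
Lemma power_mean_value s : (0 < s)%N ->
  F x ^+ s.*2 * lint (@phi R n) <=
  r^-1 ^+ N * lint (fun v => win r (enorm v) * F v ^+ s.*2).
Proof.
move=> s0; have [dF [ddF [hC hL]]] := hF.
have cF v : v != 0 -> {for v, continuous F} by move=> /hC[].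
have cFs v : v != 0 -> {for v, continuous (fun w => F w ^+ s.*2)}.
  by move=> /cF cv; exact: (continuous_comp cv (@exprn_continuous R s.*2 (F v))).
have cW := cmb_window r0 r12 cFs.
have cW1 := cmb_window r0 r12 cF.
have cWx := cmb_affine x r0 cW.
have cW1x := cmb_affine x r0 cW1.
have mv := mean_value hC hL x1 r0 r12.
rewrite -(lint_affine x r0 cW).
have near_x (y : V) : sqn y < 1 -> win r (enorm (x + r *: y)) = 1.
  move=> y1; have yr : enorm (r *: y) < r.
    rewrite enormZ ?(ltW r0)// -[X in _ < X]mulr1 ltr_pM2l//.
    by rewrite enormE -sqrtr1 ltr_sqrt.
  rewrite /win ifT//.
  by have := enorm_annulus x (r *: y); rewrite x1 => /andP[h1 h2]; apply/andP; split; lra.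
have phiF : (fun y => phi y * F (x + r *: y)) =
    (fun y => phi y * (win r (enorm (x + r *: y)) * F (x + r *: y))).
  apply/funext => y; have [/near_x ->|/phi_out ->] := ltP (sqn y) 1; last by rewrite !mul0r.
  by rewrite mul1r.
have cphiF : cmb (fun y => phi y * F (x + r *: y)).
  by rewrite phiF; apply: cmbM => //; exact: cmb_phi.
pose k := s.*2%:R * F x ^+ s.*2.-1.
have key y : (F x ^+ s.*2 - k * F x) * phi y + k * (phi y * F (x + r *: y)) <=
    win r (enorm (x + r *: y)) * F (x + r *: y) ^+ s.*2.
  have -> : (F x ^+ s.*2 - k * F x) * phi y + k * (phi y * F (x + r *: y)) =
    phi y * (F x ^+ s.*2 + k * (F (x + r *: y) - F x)) by ring.
  have ev a : 0 <= a ^+ s.*2 :> R by rewrite -mul2n exprM exprn_ge0// sqr_ge0.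
  have [/near_x ->|/phi_out ->] := ltP (sqn y) 1; last by rewrite mul0r mulr_ge0// win_ge0.
  apply: (le_trans (ler_wpM2l (phi_ge0 y) (even_power_tangent _ _ s0))).
  by apply: ler_wpM2r => //; exact: phi_le1.
have := le_lint (cmbD (cmbZ _ (@cmb_phi R n)) (cmbZ k cphiF)) cWx key.
rewrite lintD; last 2 first.
- by apply: cmbZ; exact: cmb_phi.
- exact: cmbZ.
rewrite lintZ; last exact: cmb_phi.
rewrite lintZ// mv.
by apply: le_trans; rewrite le_eqVlt; apply/orP; left; apply/eqP; ring.
Qed.

End window.

(** Chosen so that (1 + r)^(2M) <= e: in the shell, the square of a homogeneous function of degree
    at most M is at most e times its value at the radial projection to the sphere. *)
Definition window_radius {R : realType} (M : nat) : R := (2 * M%:R)^-1.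

Lemma window_radius_gt0 (R : realType) M : (0 < M)%N -> 0 < window_radius M :> R.
Proof. by move=> M0; rewrite invr_gt0 mulr_gt0 ?ltr0n. Qed.

Lemma window_radius_le (R : realType) M : (0 < M)%N -> window_radius M <= 1 / 2 :> R.
Proof.
move=> M0; rewrite /window_radius div1r lef_pV2 ?posrE ?mulr_gt0 ?ltr0n//.
by rewrite ler_peMr// ler1n.
Qed.

Lemma window_radiusM (R : realType) M : (0 < M)%N -> window_radius M * (M + M)%:R = 1 :> R.
Proof. by move=> M0; rewrite /window_radius natrD; field; rewrite pnatr_eq0 -lt0n. Qed.

Section orthonormal_kernel.
Context {R : realType} {n : nat}.
Local Notation N := (n.+1 + n.+1)%N.
Local Notation V := 'rV[R]_N.
Local Notation S := (sphere R n).

Lemma rho_enorm k (v : V) : rho k%:R v = enorm v ^+ k.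
Proof.
by rewrite /rho -enorm_sqr -powR_mulrn ?enorm_ge0// -powRrM -powR_mulrn ?enorm_ge0//;
  congr (_ `^ _); field.
Qed.

(** The field [hs_span] combines completeness with the order of the list: an eigenspace of degree
    below [deg i0] is exhausted before index [i0]. *)
Record harmonic_system (d : nat) (xi : nat -> S -> R) (deg : nat -> nat) : Prop := {
  hs_eigen : forall i, eigenspace_LB R n d (deg i) (xi i);
  hs_ortho : forall i j, inner (xi i) (xi j) = (i == j)%:R;
  hs_span : forall k i0 f, (k < deg i0)%N -> eigenspace_LB R n d k f ->
    exists a : 'I_i0 -> R, f = (fun z => \sum_(i < i0) a i * xi i z) }.

Variables (d : nat) (xi : nat -> S -> R) (deg : nat -> nat).
Hypotheses (dE : d = (N - 1)%N) (hxi : harmonic_system d xi deg).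

Lemma xi_measurable i : measurable_fun setT (xi i).
Proof. by apply: C2_sphere_measurable; have [] := hs_eigen hxi i. Qed.

Lemma xi_bounded i : exists M, forall z, `|xi i z| <= M.
Proof. by apply: C2_sphere_bounded; have [] := hs_eigen hxi i. Qed.

Definition lift_comb (D : nat) (c : 'I_D -> R) (v : V) : R :=
  \sum_i c i * (rho (deg i)%:R v * xi i (radial v)).

Lemma harmonic_lift_comb D (c : 'I_D -> R) : harmonic (lift_comb c).
Proof.
by apply: harmonic_sum => i; apply: (harmonic_lift dE); exact: (hs_eigen hxi).
Qed.

Lemma lift_comb_sphere D (c : 'I_D -> R) z :
  lift_comb c (realify (val z)) = \sum_i c i * xi i z.
Proof.
apply: eq_bigr => i _; rewrite rho_enorm enormE sqn_realify sqrtr1 expr1n mul1r.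
by rewrite radial_realify.
Qed.

Let wgt (r : R) (a b : nat) (x : R) : R := win r x * x ^+ a * x ^+ b.

Let wgt_ge0 r a b x : r <= 1/2 -> 0 <= wgt r a b x.
Proof.
rewrite /wgt /win => r1; case: ifP => [/andP[h _]|_]; last by rewrite !mul0r.
by rewrite mul1r mulr_ge0// exprn_ge0//; lra.
Qed.

Let measurable_wgt r a b : measurable_fun setT (wgt r a b).
Proof.
apply: measurable_funM; last exact: measurable_funX.
by apply: measurable_funM; [exact: measurable_win|exact: measurable_funX].
Qed.

Let cmb_wgt r a b : 0 < r -> r <= 1/2 -> cmb (fun v : V => wgt r a b (enorm v)).
Proof.
move=> r0 r1; have := @cmb_window R n (fun v => enorm v ^+ a * enorm v ^+ b) r r0 r1.
rewrite (_ : (fun v => _ * (_ * _)) = (fun v => wgt r a b (enorm v))); last first.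
  by apply/funext => v; rewrite mulrA.
apply=> v _; apply: continuous_atM;
  exact: (continuous_comp (@continuous_enorm R n v) (@exprn_continuous R _ _)).
Qed.

Lemma lint_win_square D (c : 'I_D -> R) r : 0 < r -> r <= 1/2 ->
  lint (fun v => win r (enorm v) * lift_comb c v ^+ 2) =
  \sum_i c i ^+ 2 * lint (fun v : V => win r (enorm v) * enorm v ^+ (deg i) * enorm v ^+ (deg i)).
Proof.
move=> r0 r1.
pose T i j (v : V) := wgt r (deg i) (deg j) (enorm v) * (xi i (radial v) * xi j (radial v)).
have prodM i j : exists M, forall z, `|xi i z * xi j z| <= M.
  have [a ha] := xi_bounded i; have [b hb] := xi_bounded j.
  by exists (a * b) => z; rewrite normrM ler_pM.
have mp i j : measurable_fun setT (fun z => xi i z * xi j z).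
  by apply: measurable_funM; exact: xi_measurable.
have cT i j : cmb (T i j).
  have [M hM] := prodM i j.
  exact: (cmb_radial (measurable_wgt r (deg i) (deg j)) (cmb_wgt _ _ r0 r1) (mp i j) hM).
rewrite (_ : (fun v => _) = (fun v => \sum_(i < D) \sum_(j < D) (c i * c j) * T i j v)).
  rewrite lint_sum; last first.
    by move=> i; apply: cmb_sum => j; apply: cmbZ.
  apply: eq_bigr => i _; rewrite lint_sum; last by move=> j; apply: cmbZ.
  have polar (j : 'I_D) : lint (T i j) = lint (fun v : V => wgt r (deg i) (deg j) (enorm v)) * ((i : nat) == (j : nat))%:R.
    have [M hM] := prodM i j.
    have w00 : wgt r (deg i) (deg j) 0 = 0 by rewrite /wgt win0// !mul0r.
    rewrite /T (lint_polar (measurable_wgt r (deg i) (deg j)) _ w00 (cmb_wgt _ _ r0 r1) (mp i j) hM).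
      by rewrite -(hs_ortho hxi).
    by move=> x; exact: wgt_ge0.
  rewrite (bigD1 i)//= big1 ?addr0; last first.
    by move=> j ji; rewrite lintZ// polar eq_sym -val_eqE in ji *; rewrite (negbTE ji) !mulr0.
  by rewrite lintZ// polar eqxx mulr1 expr2.
apply/funext => v; rewrite expr2 /lift_comb mulr_suml mulr_sumr; apply: eq_bigr => i _.
rewrite mulr_sumr mulr_sumr; apply: eq_bigr => j _.
by rewrite /T /wgt !rho_enorm; ring.
Qed.

Lemma win_pow_le (M k : nat) (r x : R) : (k <= M)%N -> 0 < r -> r <= 1/2 ->
  win r x * x ^+ k * x ^+ k <= expR (r * (M + M)%:R) * win r x.
Proof.
move=> kM r0 r1; rewrite /win; case: ifP => [/andP[h1 h2]|_]; last by rewrite !mul0r mulr0.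
rewrite mul1r mulr1 -exprD.
have x0 : 0 <= x by lra.
apply: (@le_trans _ _ ((1 + r) ^+ (k + k))).
  by apply: lerXn2r; rewrite ?nnegrE//; lra.
apply: (@le_trans _ _ ((1 + r) ^+ (M + M))).
  by rewrite ler_weXn2l ?leq_add//; lra.
apply: (@le_trans _ _ (expR r ^+ (M + M))).
  by apply: lerXn2r; rewrite ?nnegrE ?expR_ge0// ?expR_ge1Dx//; lra.
by rewrite -expRM_natr.
Qed.

Definition kernel_const : R :=
  expR 1 * (2 * N%:R * 2 ^+ N * @ball_vol R n) * 2 ^+ d / lint (@phi R n).

Lemma kernel_const_gt0 : 0 < kernel_const.
Proof.
rewrite /kernel_const divr_gt0 ?lint_phi_gt0// !mulr_gt0 ?expR_gt0 ?exprn_gt0//.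
exact: ball_vol_gt0.
Qed.

(** The mean value inequality for squares is applied at z to the kernel F = sum_i xi_i(z) xi_i
    itself. Then F(z) is the sum K to be bounded, and by orthonormality the shell integral of F^2 is
    at most K times a quantity of order r. Cancelling one K leaves r^(1-N), of order M^d. *)
Lemma kernel_bound D (P : pred 'I_D) (M : nat) z : (0 < M)%N ->
  (forall i, P i -> (deg i <= M)%N) ->
  \sum_(i < D | P i) xi i z ^+ 2 <= kernel_const * M%:R ^+ d.
Proof.
move=> M0 hP; set K := \sum_(i < D | P i) _.
have K0 : 0 <= K by apply: sumr_ge0 => i _; exact: sqr_ge0.
pose r : R := window_radius M; have r0 := window_radius_gt0 R M0; have r1 := window_radius_le R M0.
rewrite -/r in r0 r1.
pose c (i : 'I_D) := if P i then xi i z else 0.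
have KE : lift_comb c (realify (val z)) = K.
  rewrite lift_comb_sphere /K [RHS]big_mkcond; apply: eq_bigr => i _; rewrite /c.
  by case: (P i); rewrite ?mul0r ?expr2.
have x1 : enorm (realify (val z)) = 1 by rewrite enormE sqn_realify sqrtr1.
have := power_mean_value (harmonic_lift_comb c) x1 r0 r1 (ltn0Sn 0).
rewrite KE lint_win_square// => h.
have lp := @lint_phi_gt0 R n.
have h2 : \sum_i c i ^+ 2 * lint (fun v : V => win r (enorm v) * enorm v ^+ deg i * enorm v ^+ deg i)
    <= K * (expR 1 * (2 * N%:R * 2 ^+ N * @ball_vol R n * r)).
  rewrite /K mulr_suml [leRHS]big_mkcond; apply: ler_sum => i _; rewrite /c.
  case: ifPn => Pi; last by rewrite expr0n mul0r.
  rewrite ler_wpM2l ?sqr_ge0//.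
  apply: (@le_trans _ _ (lint (fun v : V => expR 1 * win r (enorm v)))).
    apply: le_lint; [exact: cmb_wgt|by apply: cmbZ; exact: cmb_win|move=> v].
    by rewrite -(window_radiusM R M0); apply: win_pow_le => //; exact: hP.
  rewrite lintZ; last exact: cmb_win.
  by rewrite ler_wpM2l ?expR_ge0//; exact: lint_win.
have [->|Kn0] := eqVneq K 0.
  rewrite mulr_ge0 ?exprn_ge0// /kernel_const divr_ge0 ?(ltW lp)// !mulr_ge0 ?expR_ge0 ?exprn_ge0//.
  exact: ball_vol_ge0.
have Kp : 0 < K by rewrite lt_neqAle eq_sym Kn0.
have {h2} h3 : K * K * lint (@phi R n) <=
    K * (expR 1 * (2 * N%:R * 2 ^+ N * @ball_vol R n) * (r^-1 ^+ N * r)).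
  rewrite -expr2; apply: (le_trans h); have rN0 : 0 <= r^-1 ^+ N by rewrite exprn_ge0// invr_ge0 ltW.
  apply: (le_trans (ler_wpM2l rN0 h2)).
  by rewrite le_eqVlt; apply/orP; left; apply/eqP; ring.
rewrite -mulrA ler_pM2l// in h3.
rewrite /kernel_const mulrAC ler_pdivlMr//; apply: (le_trans h3).
rewrite le_eqVlt; apply/orP; left; apply/eqP.
have -> : r^-1 ^+ N * r = 2 ^+ d * M%:R ^+ d.
  have -> : N = d.+1 by rewrite dE subn1.
  by rewrite exprSr -mulrA mulVf ?mulr1 ?gt_eqF// /r /window_radius invrK exprMn.
by ring.
Qed.

End orthonormal_kernel.

(** * Khinchine's inequality *)

Section khinchine.
Context {R : realType}.

Definition sg (b : bool) : R := if b then 1 else -1.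

(** The constant in the exponent is not sharp. It permits a split at |x| = 1/2: exp y <= 1 + y + 2
    y^2 below, |x| <= 2 x^2 above. *)
Lemma expR_sum_opp_le (x : R) : expR x + expR (- x) <= 2 * expR (2 * x ^+ 2).
Proof.
have key (y : R) : `|y| <= 1/2 -> expR y <= 1 + y + 2 * y ^+ 2.
  rewrite ler_norml => /andP[h1 h2].
  have y1 : 0 < 1 - y by lra.
  have := expR_ge1Dx (- y); rewrite expRN => h.
  have e0 := expR_gt0 y.
  have : expR y * (1 - y) <= 1.
    by rewrite -[leRHS](@mulfV _ (expR y)) ?gt_eqF// ler_pM2l.
  move=> h3; rewrite -(ler_pM2r y1); apply: (le_trans h3).
  have : 0 <= y ^+ 2 * (1 - 2 * y) by rewrite mulr_ge0 ?sqr_ge0//; lra.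
  rewrite (_ : (1 + y + 2 * y ^+ 2) * (1 - y) = 1 + y ^+ 2 * (1 - 2 * y)); last by ring.
  by move=> ?; lra.
have [h|h] := leP `|x| (1/2).
  have := key _ h; have := key (- x); rewrite normrN sqrrN => /(_ h) => a b.
  by have := expR_ge1Dx (2 * x ^+ 2); lra.
have big (y : R) : `|y| = `|x| -> expR y <= expR (2 * x ^+ 2).
  move=> yx; rewrite ler_expR; apply: (le_trans (ler_norm y)); rewrite yx.
  by rewrite -real_normK ?num_real//; nra.
by have := big x erefl; have := big (- x) (normrN x); lra.
Qed.

Lemma even_power_expR (s : nat) (x : R) :
  x ^+ s.*2 <= (s.*2)`!%:R * (expR x + expR (- x)).
Proof.
have f0 : 0 < (s.*2)`!%:R :> R by rewrite ltr0n fact_gt0.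
have nn (y : R) : 0 <= y -> y ^+ s.*2 / (s.*2)`!%:R <= expR y.
  case: s f0 => [|s] f0 y0.
    by rewrite expr0 fact0 divr1; have := expR_ge1Dx y; lra.
  by rewrite doubleS; have := expR_ge1Dxn (s.*2).+1 y0; lra.
rewrite mulrC -ler_pdivrMr//.
have [x0|x0] := leP 0 x; first by apply: (le_trans (nn _ x0)); rewrite lerDl expR_ge0.
have /nn : 0 <= - x by lra.
rewrite -mul2n exprM sqrrN -exprM mul2n => h; apply: (le_trans h).
by rewrite lerDr expR_ge0.
Qed.

Section signs.
Variables (D : nat).
Local Notation signs := {ffun 'I_D -> bool}.
Implicit Types a : 'I_D -> R.

Let sum_expR a : \sum_i a i ^+ 2 <= 1 ->
  \sum_(e : signs) expR (\sum_i sg (e i) * a i) <= 2 ^+ D * expR 2.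
Proof.
move=> a1.
under eq_bigr do rewrite expR_sum.
rewrite -(bigA_distr_bigA (fun i b => expR (sg b * a i))) /=.
apply: (@le_trans _ _ (\prod_(i < D) (2 * expR (2 * a i ^+ 2)))).
  apply: ler_prod => i _; rewrite big_bool /= mul1r mulN1r.
  by rewrite addr_ge0 ?expR_ge0//= expR_sum_opp_le.
rewrite big_split /= prodr_const card_ord -expR_sum -mulr_sumr.
by rewrite ler_wpM2l ?exprn_ge0// ler_expR; lra.
Qed.

(** After scaling to A = 1, an even power is at most (2s)! times a sum of two exponentials, whose
    average over the signs factorizes. The 2s-th root of this bound grows like s rather than the
    optimal s^(1/2), which the value 2 chosen for C3 allows. *)
Lemma khinchine a (A : R) s : 0 < A -> \sum_i a i ^+ 2 <= A ->
  \sum_(e : signs) (\sum_i sg (e i) * a i) ^+ s.*2 <=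
  2 ^+ D * (2 * expR 2 * (s.*2)`!%:R * A ^+ s).
Proof.
move=> A0 aA; pose b i := a i / Num.sqrt A.
have sA : 0 < Num.sqrt A by rewrite sqrtr_gt0.
have b1 : \sum_i b i ^+ 2 <= 1.
  under eq_bigr do rewrite /b expr_div_n sqr_sqrtr ?(ltW A0)//.
  by rewrite -mulr_suml ler_pdivrMr// mul1r.
have nb1 : \sum_i (- b i) ^+ 2 <= 1.
  by under eq_bigr do rewrite sqrrN.
have E (e : signs) : (\sum_i sg (e i) * a i) ^+ s.*2 = A ^+ s * (\sum_i sg (e i) * b i) ^+ s.*2.
  rewrite -{1}[A](sqr_sqrtr (ltW A0)) -exprM mul2n -exprMn mulr_sumr.
  by congr (_ ^+ _); apply: eq_bigr => i _; rewrite /b; field; rewrite gt_eqF.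
under eq_bigr do rewrite E.
rewrite -mulr_sumr [leRHS](_ : _ = A ^+ s * ((s.*2)`!%:R * (2 ^+ D * expR 2 + 2 ^+ D * expR 2))); last by ring.
rewrite ler_wpM2l ?exprn_ge0 ?(ltW A0)//.
apply: (@le_trans _ _ (\sum_(e : signs) (s.*2)`!%:R * (expR (\sum_i sg (e i) * b i) +
    expR (\sum_i sg (e i) * - b i)))).
  apply: ler_sum => e _; apply: (le_trans (even_power_expR _ _)).
  by rewrite -sumrN le_eqVlt; under [X in _ == _ * (_ + expR X)]eq_bigr do rewrite mulrN; rewrite eqxx.
rewrite -mulr_sumr ler_wpM2l// big_split/=.
by rewrite lerD// sum_expR.
Qed.

End signs.

Lemma markov_count (T : finType) (Q : T -> R) (B : R) : 0 < B ->
  (forall t, 0 <= Q t) -> \sum_t Q t <= #|T|%:R * B ->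
  (#|T| <= 2 * #|[set t | (Q t <= 2 * B)%R]%SET|)%N.
Proof.
move=> B0 Q0 hQ; set G := [set t | _]%SET.
have h : (#|~: G|%:R * (2 * B) <= #|T|%:R * B).
  apply: le_trans hQ; rewrite [leRHS](bigID (mem (~: G))) /=.
  rewrite -[leLHS]addr0; apply: lerD; last by apply: sumr_ge0.
  rewrite mulr_natl -sumr_const; apply: ler_sum => t.
  by rewrite !inE -ltNge => /ltW.
have {h} : (#|~: G| * 2 <= #|T|)%N.
  by rewrite -(ler_nat R) natrM -(ler_pM2r B0) -mulrA.
by have := cardsC G; rewrite -cardsT; lia.
Qed.

End khinchine.

(** * Random sums of harmonics on the sphere *)

Section sphere_integral.
Context {R : realType} {n : nat}.
Local Notation S := (sphere R n).
Local Notation nu := (sphere_vol R n).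
Implicit Types (f g : S -> R).

(* bms: bounded and measurable on the sphere *)
Definition bms g := measurable_fun setT g /\ exists M, forall z, `|g z| <= M.

Definition sint g : R := (\int[nu]_z g z)%R.

Lemma bms_integrable g : bms g -> nu.-integrable setT (EFin \o g).
Proof. by move=> [mg [M hM]]; exact: bounded_sphere_integrable hM. Qed.

Lemma bms_cst (c : R) : bms (fun=> c).
Proof. by split; [exact: measurable_cst|exists `|c|]. Qed.

Lemma bmsD f g : bms f -> bms g -> bms (fun z => f z + g z).
Proof.
move=> [mf [M hM]] [mg [K hK]]; split; first exact: measurable_funD.
by exists (M + K) => z; apply: (le_trans (ler_normD _ _)); exact: lerD.
Qed.

Lemma bmsM f g : bms f -> bms g -> bms (fun z => f z * g z).
Proof.
move=> [mf [M hM]] [mg [K hK]]; split; first exact: measurable_funM.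
by exists (M * K) => z; rewrite normrM ler_pM.
Qed.

Lemma bmsZ c f : bms f -> bms (fun z => c * f z).
Proof. by move=> hf; apply: bmsM => //; exact: bms_cst. Qed.

Lemma bmsX f k : bms f -> bms (fun z => f z ^+ k).
Proof.
move=> [mf [M hM]]; split; first exact: measurable_funX.
by exists (M ^+ k) => z; rewrite normrX lerXn2r// ?nnegrE//; exact: le_trans (hM z).
Qed.

Lemma bms_sum (I : Type) (r : seq I) (P : pred I) (F : I -> S -> R) :
  (forall i, P i -> bms (F i)) -> bms (fun z => \sum_(i <- r | P i) F i z).
Proof.
move=> hF; elim: r => [|i r ih].
  by rewrite (_ : (fun z => _) = fun=> 0); [exact: bms_cst|apply/funext => z; rewrite big_nil].
have [Pi|/negbTE Pi] := boolP (P i); last first.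
  by rewrite (_ : (fun z => _) = (fun z => \sum_(i <- r | P i) F i z))//; apply/funext => z; rewrite big_cons Pi.
rewrite (_ : (fun z => _) = (fun z => F i z + \sum_(i <- r | P i) F i z)).
  by apply: bmsD => //; exact: hF.
by apply/funext => z; rewrite big_cons Pi.
Qed.

Lemma sint_cst (c : R) : sint (fun=> c) = c.
Proof.
rewrite /sint Rintegral_cst// [X in fine X](_ : _ = 1%E) ?mulr1//.
exact: (@probability_setT _ _ _ nu).
Qed.

Lemma sintD f g : bms f -> bms g -> sint (fun z => f z + g z) = sint f + sint g.
Proof. by move=> hf hg; rewrite /sint RintegralD//; exact: bms_integrable. Qed.

Lemma sintZ c f : bms f -> sint (fun z => c * f z) = c * sint f.
Proof. by move=> hf; rewrite /sint RintegralZl//; exact: bms_integrable. Qed.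

Lemma le_sint f g : bms f -> bms g -> (forall z, f z <= g z) -> sint f <= sint g.
Proof. by move=> hf hg h; apply: le_Rintegral => //; exact: bms_integrable. Qed.

Lemma sint_ge0 f : (forall z, 0 <= f z) -> 0 <= sint f.
Proof. by move=> h; apply: Rintegral_ge0. Qed.

Lemma sint_sum (I : Type) (r : seq I) (P : pred I) (F : I -> S -> R) :
  (forall i, P i -> bms (F i)) ->
  sint (fun z => \sum_(i <- r | P i) F i z) = \sum_(i <- r | P i) sint (F i).
Proof.
move=> hF; elim: r => [|i r ih].
  rewrite big_nil -[RHS](sint_cst 0); congr sint.
  by apply/funext => z; rewrite big_nil.
rewrite big_cons; case: ifPn => Pi; last first.
  by rewrite -ih; congr sint; apply/funext => z; rewrite big_cons (negbTE Pi).
rewrite -ih -sintD; [|exact: hF|exact: bms_sum].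
by congr sint; apply/funext => z; rewrite big_cons Pi.
Qed.

End sphere_integral.

Definition moment_const (R : realType) (s : nat) (B : R) : R :=
  2 * expR 2 * (s.*2)`!%:R * B ^+ s.

Lemma moment_const_gt0 (R : realType) s (B : R) : 0 < B -> 0 < moment_const s B.
Proof.
by move=> B0; rewrite /moment_const !mulr_gt0 ?expR_gt0 ?exprn_gt0 ?ltr0n ?fact_gt0.
Qed.

Section random_sums.
Context {R : realType} {n : nat}.
Local Notation N := (n.+1 + n.+1)%N.
Local Notation V := 'rV[R]_N.
Local Notation S := (sphere R n).
Variables (d : nat) (xi : nat -> S -> R) (deg : nat -> nat).
Hypotheses (dE : d = (N - 1)%N) (hxi : harmonic_system d xi deg).
Variables (D : nat) (c : 'I_D -> R) (A : R).
Hypotheses (A0 : 0 < A) (cA : forall z, \sum_i (c i * xi i z) ^+ 2 <= A).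
Local Notation K := moment_const.
Local Notation signs := {ffun 'I_D -> bool}.

Definition signed_sum (e : signs) (z : S) : R := \sum_i sg (e i) * (c i * xi i z).

Lemma bms_xi i : bms (xi i).
Proof. by split; [exact: xi_measurable hxi i|exact: xi_bounded hxi i]. Qed.

Lemma bms_signed_sum e : bms (signed_sum e).
Proof. by apply: bms_sum => i _; apply: bmsZ; apply: bmsZ; exact: bms_xi. Qed.

Let card_signs : #|{: signs}|%:R = 2 ^+ D :> R.
Proof. by rewrite card_ffun card_bool card_ord natrX. Qed.

Lemma moment_typical s :
  (#|{: signs}| <= 2 * #|[set e | (sint (fun z => signed_sum e z ^+ s.*2) <= 2 * K s A)%R]%SET|)%N.
Proof.
apply: markov_count; first exact: moment_const_gt0.
  by move=> e; apply: sint_ge0 => z; rewrite -mul2n exprM exprn_ge0// sqr_ge0.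
rewrite card_signs -sint_sum => [|e _]; last by apply: bmsX; exact: bms_signed_sum.
rewrite -[leRHS](@sint_cst R n); apply: le_sint => [||z].
- by apply: bms_sum => e _; apply: bmsX; exact: bms_signed_sum.
- exact: bms_cst.
by apply: khinchine.
Qed.

Variables (M : nat).
Hypotheses (M0 : (0 < M)%N) (hM : forall i, c i != 0 -> (deg i <= M)%N).

Let r : R := window_radius M.
Let r0 : 0 < r. Proof. exact: window_radius_gt0. Qed.
Let r1 : r <= 1/2. Proof. exact: window_radius_le. Qed.

Let F (e : signs) (v : V) : R := lift_comb xi deg (fun i => sg (e i) * c i) v.

Let F_sphere e z : F e (realify (val z)) = signed_sum e z.
Proof. by rewrite /F lift_comb_sphere; apply: eq_bigr => i _; rewrite mulrA. Qed.

Let Q s (e : signs) : R := lint (fun v => win r (enorm v) * F e v ^+ s.*2).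

Let cmb_Q s e : cmb (fun v => win r (enorm v) * F e v ^+ s.*2).
Proof.
have [dF [ddF [hC _]]] := harmonic_lift_comb dE hxi (fun i => sg (e i) * c i).
apply: cmb_window => // v /hC [cF _ _ _ _].
exact: (continuous_comp cF (@exprn_continuous R s.*2 _)).
Qed.

(** This makes [khinchine] applicable at each point of the shell, not only on the sphere, at the
    price of replacing A by e A. *)
Let F_sum v : win r (enorm v) * \sum_i (c i * (rho (deg i)%:R v * xi i (radial v))) ^+ 2 <=
  expR 1 * A * win r (enorm v).
Proof.
apply: (@le_trans _ _ (\sum_i (c i * xi i (radial v)) ^+ 2 * (expR 1 * win r (enorm v)))).
  rewrite mulr_sumr; apply: ler_sum => i _.
  have [->|ci] := eqVneq (c i) 0; first by rewrite !mul0r expr0n mulr0 mul0r.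
  rewrite rho_enorm (_ : win r _ * _ = (c i * xi i (radial v)) ^+ 2 *
    (win r (enorm v) * enorm v ^+ deg i * enorm v ^+ deg i)); last by ring.
  rewrite ler_wpM2l ?sqr_ge0//.
  by rewrite -(window_radiusM R M0); apply: win_pow_le => //; exact: hM.
rewrite -mulr_suml (_ : expR 1 * A * _ = A * (expR 1 * win r (enorm v))); last by ring.
by rewrite ler_wpM2r// mulr_ge0 ?expR_ge0 ?win_ge0.
Qed.

Let sum_Q s : \sum_e Q s e <= 2 ^+ D * (K s (expR 1 * A) * lint (fun v : V => win r (enorm v))).
Proof.
rewrite /Q -lint_sum => [|e]; last exact: cmb_Q.
rewrite mulrA -lintZ; last exact: cmb_win.
apply: le_lint; [by apply: cmb_sum => e; exact: cmb_Q|by apply: cmbZ; exact: cmb_win|move=> v].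
rewrite -mulr_sumr; have := F_sum v; rewrite /win; case: ifP => _; last by rewrite !mul0r !mulr0 lexx.
rewrite !mul1r !mulr1 => h.
have eA : 0 < expR 1 * A by rewrite mulr_gt0 ?expR_gt0.
have := khinchine s eA h.
congr (_ <= _); apply: eq_bigr => e _; congr (_ ^+ _).
by apply: eq_bigr => i _; rewrite mulrA.
Qed.

(** Markov's inequality is applied to the single number [Q s e], a shell integral which controls the
    sum at every z at once by the mean value inequality. The loss is a factor M^d on the 2s-th
    power, harmless once s is of order log m. *)
Lemma sup_typical s : (0 < s)%N ->
  (#|{: signs}| <= 2 * #|[set e | `[< forall z, (signed_sum e z ^+ s.*2 <=
    2 * @kernel_const R n d * M%:R ^+ d * K s (expR 1 * A))%R >]]%SET|)%N.
Proof.
move=> s0; have eA : 0 < expR 1 * A by rewrite mulr_gt0 ?expR_gt0.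
have lp := @lint_phi_gt0 R n.
pose W := 2 * N%:R * 2 ^+ N * @ball_vol R n.
have W0 : 0 < W by rewrite /W !mulr_gt0 ?exprn_gt0// ball_vol_gt0.
have KB : 2 * @kernel_const R n d * M%:R ^+ d * K s (expR 1 * A) =
    expR 1 * (r^-1 ^+ N * (2 * (K s (expR 1 * A) * (W * r)))) / lint (@phi R n).
  have -> : r^-1 ^+ N = r^-1 * (2 ^+ d * M%:R ^+ d).
    have -> : N = d.+1 by rewrite dE subn1.
    by rewrite exprS /r /window_radius invrK exprMn.
  rewrite /kernel_const -/W; field.
  by rewrite (gt_eqF lp) gt_eqF//.
have B0 : 0 < K s (expR 1 * A) * (W * r) by rewrite mulr_gt0 ?moment_const_gt0// mulr_gt0.
apply: leq_trans (markov_count (Q := Q s) B0 _ _) _.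
- by move=> e; apply: lint_ge0 => v; rewrite mulr_ge0 ?win_ge0// -mul2n exprM exprn_ge0// sqr_ge0.
- rewrite card_signs; apply: (le_trans (sum_Q s)); rewrite ler_wpM2l ?exprn_ge0//.
  by rewrite ler_wpM2l ?(ltW (moment_const_gt0 _ _))//; exact: lint_win.
apply: leq_mul => //; apply/subset_leq_card/fintype.subsetP => e; rewrite !inE => hQ.
apply/asboolP => z; rewrite KB ler_pdivlMr//.
have x1 : enorm (realify (val z)) = 1 by rewrite enormE sqn_realify sqrtr1.
have := power_mean_value (harmonic_lift_comb dE hxi (fun i => sg (e i) * c i)) x1 r0 r1 s0.
rewrite -/(F e _) F_sphere => h; apply: (le_trans h).
have rN0 : 0 <= r^-1 ^+ N by rewrite exprn_ge0// invr_ge0 ltW.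
apply: (le_trans (ler_wpM2l rN0 hQ)).
rewrite ler_peMl//; last by have := expR_ge1Dx (1 : R); lra.
by rewrite mulr_ge0// mulr_ge0// ltW.
Qed.

End random_sums.

(** * Sign vectors in the cube *)

Section cube.
Variable R : realFieldType.

Lemma sum_tuple_cons D (F : D.+1.-tuple bool -> R) :
  \sum_t F t = \sum_(b : bool) \sum_(t : D.-tuple bool) F [tuple of b :: t].
Proof.
rewrite (pair_big xpredT xpredT (fun b (t : D.-tuple bool) => F [tuple of b :: t])) /=.
rewrite (reindex (fun p : bool * D.-tuple bool => [tuple of p.1 :: p.2])) //.
exists (fun t : D.+1.-tuple bool => (thead t, [tuple of behead t])) => [[b t]|t] _ /=.
  by rewrite theadE; congr pair; exact: val_inj.
by apply: val_inj => /=; case: t => -[|b t].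
Qed.

(** Indicators of two sets at Hamming distance at least r, with C = 2^-r, give a bound 2^-r (9/2)^D
    for the product of their cardinals. At r = D/4 it beats the trivial 4^D, as 2^(1/4) > 9/8.
    General f, g and C are needed for the induction: summing over all coordinates but the first
    yields functions of the first bit, with C multiplied by 2 when the bits differ. *)
Lemma cube_sum D (f g : D.-tuple bool -> R) (C : R) :
  (forall x, 0 <= f x) -> (forall y, 0 <= g y) ->
  (forall x y, f x * g y <= C * 2 ^+ (\sum_i (tnth x i != tnth y i))%N) ->
  (\sum_x f x) * (\sum_y g y) <= C * (9 / 2) ^+ D.
Proof.
elim: D => [|D ih] in f g C * => f0 g0 fg.
  have all1 (F : 0.-tuple bool -> R) : \sum_x F x = F [tuple].
    by rewrite (bigD1 [tuple])//= big1 ?addr0// => t /eqP[]; exact: tuple0.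
  by rewrite !all1; have := fg [tuple] [tuple]; rewrite big_ord0 !expr0.
have C0 : 0 <= C.
  have := fg [tuple of nseq D.+1 true] [tuple of nseq D.+1 true].
  by move=> /(le_trans (mulr_ge0 (f0 _) (g0 _))); rewrite pmulr_lge0// exprn_gt0.
rewrite !sum_tuple_cons !big_bool /=.
pose F a := \sum_(t : D.-tuple bool) f [tuple of a :: t].
pose G a := \sum_(t : D.-tuple bool) g [tuple of a :: t].
rewrite -/(F true) -/(F false) -/(G true) -/(G false).
have FG a b : F a * G b <= C * 2 ^+ (a != b) * (9 / 2) ^+ D.
  apply: ih => // x y; apply: (le_trans (fg _ _)).
  rewrite big_ord_recl /= !tnth0 exprD mulrA le_eqVlt; apply/orP; left.
  by under eq_bigr do rewrite !tnthS.
have F0 a : 0 <= F a by apply: sumr_ge0.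
have G0 a : 0 <= G a by apply: sumr_ge0.
have := FG true true; have := FG false false; have := FG true false; have := FG false true.
rewrite /= !expr0 !expr1 !mulr1 exprS; set T := (9 / 2) ^+ D.
have T0 : 0 <= C * T by rewrite mulr_ge0// exprn_ge0// divr_ge0.
move=> h01 h10 h00 h11.
have hpq : (F true * G false) * (F false * G true) <= (C * T) ^+ 2.
  rewrite (_ : _ * _ = (F true * G true) * (F false * G false)); last by ring.
  by rewrite expr2; apply: ler_pM => //; rewrite mulr_ge0.
(* p, q <= 2X and p q <= X^2 give p + q <= 5/2 X, as (2X - p)(2X - q) >= 0. *)
have : F true * G false + F false * G true <= 5 / 2 * (C * T).
  have p0 : 0 <= F true * G false by rewrite mulr_ge0.
  have q0 : 0 <= F false * G true by rewrite mulr_ge0.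
  move: hpq h01 h10 p0 q0.
  set p := F true * G false; set q := F false * G true.
  rewrite [C * 2 * T](_ : _ = 2 * (C * T)); last by ring.
  move: T0; set X := C * T => X0 hpq hq hp p0 q0.
  have [X00|X1] := eqVneq X 0; first by rewrite X00 in hp hq *; lra.
  have Xp : 0 < X by rewrite lt_neqAle eq_sym X1.
  have : 0 <= (2 * X - p) * (2 * X - q) by rewrite mulr_ge0//; lra.
  by rewrite -(ler_pM2l Xp) => ?; nra.
by move=> ?; rewrite [leRHS](_ : _ = 9 / 2 * (C * T)); [lra|ring].
Qed.

Lemma separated_sets D (A B : {set {ffun 'I_D -> bool}}) r :
  (forall x y, x \in A -> y \in B -> (r <= #|[set i | x i != y i]%SET|)%N) ->
  #|A|%:R * #|B|%:R * 2 ^+ r <= (9 / 2) ^+ D :> R.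
Proof.
move=> AB; pose u (t : D.-tuple bool) := [ffun i => tnth t i].
have cardE (X : {set {ffun 'I_D -> bool}}) : #|X|%:R = \sum_t (u t \in X)%:R :> R.
  rewrite -sum1_card natr_sum big_mkcond /=.
  rewrite (reindex u) /=; last first.
    exists (fun e : {ffun 'I_D -> bool} => [tuple e i | i < D]) => [t|e] _.
      by apply: eq_from_tnth => i; rewrite tnth_mktuple ffunE.
    by apply/ffunP => i; rewrite ffunE tnth_mktuple.
  by apply: eq_bigr => t _; case: (u t \in X).
have := @cube_sum D (fun t => (u t \in A)%:R) (fun t => (u t \in B)%:R) (2 ^- r).
rewrite -!cardE => h.
rewrite -ler_pdivlMr ?exprn_gt0// mulrC [leRHS]mulrC mulrC; apply: h => [x|y|x y]; rewrite ?ler0n//.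
rewrite [leRHS]mulrC ler_pdivlMr ?exprn_gt0//.
case: (boolP (u x \in A)) => xA; last by rewrite !mul0r exprn_ge0.
case: (boolP (u y \in B)) => yB; last by rewrite mulr0 mul0r exprn_ge0.
rewrite !mul1r ler_weXn2l ?ler1n//.
apply: (leq_trans (AB _ _ xA yB)); rewrite -sum1_card big_mkcond /=.
by apply: leq_sum => i _; rewrite inE !ffunE; case: (_ != _).
Qed.

(** The sum of x^|W| over all W is (1 + x)^D, and x <= 1 makes each small set contribute at least
    x^m. *)
Lemma card_small_sets D m (x : R) : 0 < x -> x <= 1 ->
  #|[set W : {set 'I_D} | (#|W| <= m)%N]%SET|%:R * x ^+ m <= (1 + x) ^+ D.
Proof.
move=> x0 x1.
have -> : (1 + x) ^+ D = \sum_(W : {set 'I_D}) x ^+ #|W|.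
  have := @bigA_distr R 0 1 *%R +%R 'I_D (fun=> x) (fun=> 1).
  rewrite prodr_const card_ord addrC => ->; apply: eq_bigr => W _.
  by rewrite -big_mkcond /= prodr_const.
rewrite mulr_natl -sumr_const [leRHS](bigID (mem [set W : {set 'I_D} | (#|W| <= m)%N]%SET)) /=.
rewrite -[leLHS]addr0 lerD//; last by apply: sumr_ge0 => W _; rewrite exprn_ge0// ltW.
by apply: ler_sum => W; rewrite inE => h; apply: ler_wiXn2l => //; exact: ltW.
Qed.

End cube.

(** The source of the 64 in K: the K-th power of 10/11 has to beat the factor 32^m in the number of
    sets W. The exponent is reached by three squarings down to 1/2 and an eighth power. *)
Lemma ten_elevenths_pow (R : realFieldType) : (10 / 11) ^+ 64 <= 1 / 256 :> R.
Proof.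
have h2 : (10 / 11) ^+ 2 <= 5 / 6 :> R by rewrite expr2; lra.
have h4 : (5 / 6) ^+ 2 <= 7 / 10 :> R by rewrite expr2; lra.
have h8 : (7 / 10) ^+ 2 <= 1 / 2 :> R by rewrite expr2; lra.
have sq (a b c : R) k : 0 <= a -> 0 <= b -> a ^+ k <= b -> b ^+ 2 <= c -> a ^+ (k * 2) <= c.
  by move=> a0 b0 ab bc; rewrite exprM (le_trans _ bc)// lerXn2r ?nnegrE ?exprn_ge0.
have p : (10 / 11) ^+ (2 * 2 * 2) <= 1 / 2 :> R.
  have p4 : (10 / 11) ^+ (2 * 2) <= 7 / 10 :> R by apply: (sq _ (5/6) _ 2 _ _ h2 h4); lra.
  by apply: (sq _ (7/10) _ (2 * 2)%N _ _ p4 h8); lra.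
rewrite (_ : 64 = 2 * 2 * 2 * 8)%N// exprM (_ : 1 / 256 = (1 / 2) ^+ 8 :> R); last by field.
by apply: lerXn2r => //; rewrite nnegrE; [rewrite exprn_ge0//|]; lra.
Qed.

(** Growth rates per four coordinates: (33/32)^4 for the number of sets W, 16 for the whole cube,
    and 6561/512 = (9/2)^4 / (16 * 2) for the signs far from half of the cube, where 16 is the size
    of that half and 2 the gain from the distance. *)
Lemma thirty_three_pow (R : realFieldType) : (33 / 32) ^+ 4 * (6561 / 512) <= 16 * (10 / 11) :> R.
Proof.
have h2 : (33 / 32) ^+ 2 <= 67 / 63 :> R by rewrite expr2; lra.
have h4 : ((33 / 32) ^+ 2) ^+ 2 <= (67 / 63) ^+ 2 :> R.
  apply: lerXn2r h2; rewrite nnegrE; [exact: sqr_ge0|lra].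
have -> : (33 / 32) ^+ 4 = ((33 / 32) ^+ 2) ^+ 2 :> R by rewrite -exprM.
have p0 : 0 <= 6561 / 512 :> R by lra.
apply: (le_trans (ler_wpM2r p0 h4)).
by rewrite expr2; lra.
Qed.

Lemma union_bound_lt (R : realFieldType) (K m : nat) (x y q a b : R) :
  0 <= x -> 0 <= y -> 0 <= q -> 0 <= a -> 0 <= b -> x * y <= 16 * q -> q ^+ K <= 1 / 256 ->
  (2 <= m)%N -> a <= 32 ^+ m * x ^+ (K * m) -> b <= 2 * y ^+ (K * m) ->
  4 * (a * b) < 16 ^+ (K * m).
Proof.
move=> x0 y0 q0 a0 b0 xy qK m2 ha hb; set t := (K * m)%N in ha hb *.
have t0 : 0 < 16 ^+ t :> R by rewrite exprn_gt0.
have m0 : 0 <= 32 ^+ m :> R by rewrite exprn_ge0.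
have h1 : a * b <= 32 ^+ m * x ^+ t * (2 * y ^+ t) by apply: ler_pM.
have h2 : (x * y) ^+ t <= (16 * q) ^+ t by apply: lerXn2r; rewrite ?nnegrE ?mulr_ge0.
have h3 : 32 ^+ m * q ^+ t <= (1 / 8) ^+ m.
  rewrite /t exprM -exprMn; have -> : 1 / 8 = 32 * (1 / 256) :> R by clear; field.
  apply: lerXn2r; last by rewrite ler_wpM2l.
    by rewrite nnegrE; apply: mulr_ge0 => //; apply: exprn_ge0.
  by rewrite nnegrE; clear; lra.
(* For m = 1 these estimates would bound the total only by 16^K itself; m >= 2 makes the final
   inequality strict. *)
have h4 : (1 / 8) ^+ m <= (1 / 8) ^+ 2 :> R by apply: ler_wiXn2l => //; clear; lra.
have h5 : 32 ^+ m * q ^+ t <= 1 / 64.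
  by apply: (le_trans (le_trans h3 h4)); clear; rewrite expr2; lra.
have h6 : a * b <= 2 * 16 ^+ t * (1 / 64).
  apply: (le_trans h1).
  rewrite (_ : _ * (2 * _) = 2 * 32 ^+ m * (x * y) ^+ t); last by rewrite exprMn; ring.
  apply: (@le_trans _ _ (2 * 32 ^+ m * (16 * q) ^+ t)); first by rewrite ler_wpM2l// mulr_ge0.
  rewrite (_ : 2 * 32 ^+ m * _ = 2 * 16 ^+ t * (32 ^+ m * q ^+ t)); last by rewrite exprMn; ring.
  by rewrite ler_wpM2l// mulr_ge0// ltW.
move: h6 t0; clear; set u := 16 ^+ t; lra.
Qed.

(** [Bad W] consists of the signs far from all of [Typ W]. The union of these sets over small W
    fills less than a quarter of the cube, while [T] has at least half, so some e in [T] is good for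
    every W simultaneously. *)
Lemma simultaneous_signs (R : realFieldType) (K m D : nat) (T : {set {ffun 'I_D -> bool}})
    (Typ : {set 'I_D} -> {set {ffun 'I_D -> bool}}) :
  (64 <= K)%N -> (2 <= m)%N -> D = (4 * (K * m))%N ->
  (#|{: {ffun 'I_D -> bool}}| <= 2 * #|T|)%N ->
  (forall W, (#|{: {ffun 'I_D -> bool}}| <= 2 * #|Typ W|)%N) ->
  exists2 e, e \in T & forall W : {set 'I_D}, (#|W| <= m)%N ->
    exists2 e', e' \in Typ W & (#|[set i | e i != e' i]%SET| < K * m)%N.
Proof.
move=> K64 m2 DE hT hTyp.
pose t := (K * m)%N.
have card_signs : #|{: {ffun 'I_D -> bool}}|%:R = 16 ^+ t :> R.
  by rewrite card_ffun card_bool card_ord DE expnM natrX.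
pose Bad W := [set e : {ffun 'I_D -> bool} | [forall e' in Typ W, (t <= #|[set i | e i != e' i]%SET|)%N]]%SET.
pose small := [set W : {set 'I_D} | (#|W| <= m)%N]%SET.
have bad W : #|Bad W|%:R <= 2 * (6561 / 512) ^+ t :> R.
  have h : #|Bad W|%:R * #|Typ W|%:R * 2 ^+ t <= (6561 / 16) ^+ t :> R.
    have -> : (6561 / 16) ^+ t = (9 / 2 : R) ^+ D by rewrite DE exprM; congr (_ ^+ _); field.
    by apply: separated_sets => x y; rewrite inE => /forall_inP/(_ y) xy yT; exact: xy.
  have hW : 16 ^+ t <= 2 * #|Typ W|%:R :> R by rewrite -card_signs -natrM ler_nat.
  have p0 : 0 < 16 ^+ t * 2 ^+ t :> R by rewrite mulr_gt0// exprn_gt0.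
  rewrite -(ler_pM2r p0) -[leRHS]mulrA -!exprMn.
  rewrite (_ : 6561 / 512 * (16 * 2) = 6561 / 16 :> R); last by field.
  rewrite exprMn; apply: (@le_trans _ _ (2 * (#|Bad W|%:R * #|Typ W|%:R * 2 ^+ t))); last by rewrite ler_pM2l.
  rewrite !mulrA ler_wpM2r ?exprn_ge0// [2 * _]mulrC -mulrA ler_wpM2l//.
pose U := (\bigcup_(W in small) Bad W)%SET.
have e1 : #|U|%:R <= #|small|%:R * (2 * (6561 / 512) ^+ t) :> R.
  apply: (@le_trans _ _ (\sum_(W in small) #|Bad W|%:R)).
    rewrite -natr_sum ler_nat /U.
    elim/big_rec2: _ => [|W a b _ h]; first by rewrite cards0.
    by apply: leq_trans (leq_card_setU _ _).1 _; rewrite leq_add2l.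
  rewrite mulr_natl -sumr_const; apply: ler_sum => W _; exact: bad.
(* At x = 1/32 the number of small sets grows at rate (33/32)^4 per four coordinates, slow enough
   for [thirty_three_pow]; the price 32^m is paid by a large K. *)
have i0 : 0 < 1/32 :> R by clear; lra.
have i1 : 1/32 <= 1 :> R by clear; lra.
have e3 : #|small|%:R <= 32 ^+ m * ((33 / 32) ^+ 4) ^+ t :> R.
  rewrite -exprM -DE; have -> : (33 / 32 : R) = 1 + 1 / 32 by clear; field.
  have x0 : 0 < (1/32) ^+ m :> R by rewrite exprn_gt0.
  rewrite -(ler_pM2r x0); apply: (le_trans (card_small_sets D m i0 i1)).
  rewrite mulrAC -exprMn (_ : 32 * (1/32) = 1 :> R); last by clear; field.
  by rewrite expr1n [leRHS]mul1r.
have c0 : 0 <= 6561 / 512 :> R by clear; lra.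
have c1 : 0 <= 33 / 32 :> R by clear; lra.
have c2 : 0 <= 10 / 11 :> R by clear; lra.
have c3 : (10 / 11) ^+ K <= 1 / 256 :> R.
  apply: le_trans (ten_elevenths_pow R).
  by apply: ler_wiXn2l => //; clear; lra.
have y0 : 0 <= 2 * (6561 / 512) ^+ t :> R := mulr_ge0 (ler0n R 2) (exprn_ge0 t c0).
have tot : 4 * #|U|%:R < 16 ^+ t :> R.
  apply: le_lt_trans (union_bound_lt (exprn_ge0 4 c1) c0 c2 (ler0n R _) y0
    (thirty_three_pow R) c3 m2 e3 (lexx _)).
  by rewrite ler_pM2l.
have : (0 < #|T :\: U|)%N.
  rewrite cardsD.
  have h1 : (#|T :&: U| <= #|U|)%N.
    by rewrite subset_leq_card// finset.subsetIr.
  have h2 : (4 * #|U| < #|{: {ffun 'I_D -> bool}}|)%N.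
    by rewrite -(ltr_nat R) natrM card_signs.
  move: h1 h2 hT; move: #|T| #|U| #|T :&: U| #|{: {ffun 'I_D -> bool}}| => a b c e.
  by clear; lia.
rewrite card_gt0 => /set0Pn[e]; rewrite inE => /andP[eb eT].
exists e => // W Wm.
have : e \notin Bad W.
  by apply: contra eb => eW; apply/finset.bigcupP; exists W => //; rewrite inE.
by rewrite inE negb_forall_in => /exists_inP[e' e'T]; rewrite -ltnNge => h; exists e'.
Qed.

(** * Restrictions of polynomials to the sphere *)

Section homogeneous_polynomials.
Context {R : realType} {n : nat}.
Local Notation N := (n.+1 + n.+1)%N.
Local Notation V := 'rV[R]_N.
Local Notation ei i := (delta_mx 0 i : V).
Local Notation S := (sphere R n).

(** Homogeneous polynomial functions, presented so that continuity, Euler's identity and the degree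
    of the partial derivatives follow by induction. *)
Inductive hpoly : nat -> (V -> R) -> Prop :=
| hpoly_cst c : hpoly 0 (fun=> c)
| hpoly_coord k (i : 'I_N) p : hpoly k p -> hpoly k.+1 (fun v => v 0 i * p v)
| hpolyD k p q : hpoly k p -> hpoly k q -> hpoly k (fun v => p v + q v).

Lemma hpolyZ c k p : hpoly k p -> hpoly k (fun v => c * p v).
Proof.
elim=> [a|{}k i {}p hp ih|{}k {}p q hp ihp hq ihq]; first exact: hpoly_cst.
  rewrite (_ : (fun v => _) = (fun v : V => v 0 i * (c * p v))); first exact: hpoly_coord.
  by apply/funext => v; ring.
rewrite (_ : (fun v => _) = (fun v => c * p v + c * q v)); first exact: hpolyD.
by apply/funext => v; ring.
Qed.

Lemma hpoly0 k : hpoly k (fun=> 0).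
Proof.
elim: k => [|k ih]; first exact: hpoly_cst.
have := @hpoly_coord _ ord0 _ ih.
by congr hpoly; apply/funext => v; rewrite mulr0.
Qed.

Lemma hpoly_sum k (I : Type) (r : seq I) (F : I -> V -> R) :
  (forall i, hpoly k (F i)) -> hpoly k (fun v => \sum_(i <- r) F i v).
Proof.
move=> hF; elim: r => [|i r ih].
  by rewrite (_ : (fun v => _) = fun=> 0); [exact: hpoly0|apply/funext => v; rewrite big_nil].
rewrite (_ : (fun v => _) = (fun v => F i v + \sum_(i <- r) F i v)); first exact: hpolyD.
by apply/funext => v; rewrite big_cons.
Qed.

Lemma hpoly_homog k p c v : hpoly k p -> p (c *: v) = c ^+ k * p v.
Proof.
elim=> [a|{}k i {}p hp ih|{}k {}p q hp ihp hq ihq]; first by rewrite mul1r.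
  by rewrite mxE ih exprS; ring.
by rewrite ihp ihq mulrDr.
Qed.

Lemma continuous_hpoly k p : hpoly k p -> continuous p.
Proof.
elim=> [a|{}k i {}p hp ih|{}k {}p q hp ihp hq ihq].
- by apply: continuous_at_all => v; exact: cst_continuous.
- apply: continuous_at_all => v; apply: continuous_atM; first exact: continuous_coord.
  exact: ih.
- by apply: continuous_at_all => v; apply: continuous_atD; [exact: ihp|exact: ihq].
Qed.

Lemma hpoly_derive k p : hpoly k p -> exists dp : 'I_N -> V -> R,
  [/\ forall (v : V) i, is_derive v (ei i) p (dp i v),
    forall v : V, \sum_i v 0 i * dp i v = k%:R * p v &
    forall i, if k is k'.+1 then hpoly k' (dp i) else dp i = fun=> 0].
Proof.
elim=> [a|{}k i {}p hp [dp [hd he hh]]|{}k {}p q hp [dp [hd he hh]] hq [dq [kd ke kh]]].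
- exists (fun _ _ => 0); split => //.
    by move=> v j; exact: is_derive_cst.
  by move=> v; rewrite mul0r big1// => j _; rewrite mulr0.
- exists (fun j (v : V) => (j == i)%:R * p v + v 0 i * dp j v); split.
  + move=> v j.
    have := @is_deriveM _ _ (fun w : V => w 0 i : R) p v (ei j) _ _ (is_derive_coord v j i) (hd v j).
    by congr (is_derive _ _ _ _); rewrite addrC [X in X + _]mulrC; congr (_ + _); rewrite [LHS]mulrC.
  + move=> v; rewrite -natr1 mulrDl mul1r.
    rewrite (eq_bigr (fun j => v 0 j * (j == i)%:R * p v + v 0 i * (v 0 j * dp j v))); last first.
      by move=> j _; ring.
    rewrite big_split /= -mulr_sumr he (bigD1 i)//= eqxx mulr1 big1 => [|j /negbTE ->]; first by ring.
    by rewrite mulr0 mul0r.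
  + move=> j; apply: hpolyD; first exact: hpolyZ.
    case: k hp hd he hh => [|k] hp hd he hh; last exact: hpoly_coord.
    rewrite hh (_ : (fun v => _) = fun=> 0); first exact: hpoly0.
    by apply/funext => v; rewrite mulr0.
- exists (fun j v => dp j v + dq j v); split.
  + by move=> v j; exact: is_deriveD.
  + by move=> v; rewrite mulrDr -he -ke -big_split; apply: eq_bigr => j _; rewrite mulrDr.
  + move=> j; move: (hh j) (kh j); case: (k) => [-> ->|k' h1 h2]; last exact: hpolyD.
    by apply/funext => v; rewrite addr0.
Qed.

Lemma hpoly_C2data k p : hpoly k p -> exists dp ddp,
  [/\ C2data p dp ddp, forall v : V, \sum_i v 0 i * dp i v = k%:R * p v &
    if k is k'.+2 then hpoly k' (fun v => lap ddp v) else forall v : V, lap ddp v = 0].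
Proof.
move=> hp; have [dp [hd he hh]] := hpoly_derive hp.
have /choice[ddp hdd] : forall i, exists ddp : 'I_N -> V -> R,
    (forall (v : V) j, is_derive v (ei j) (dp i) (ddp j v)) /\
    forall j, if k is k'.+2 then hpoly k' (ddp j) else ddp j = fun=> 0.
  move=> i; move: (hh i); case: (k) => [->|k' /hpoly_derive[ddp [h1 _ h2]]].
    by exists (fun _ _ => 0); split => // v j; exact: is_derive_cst.
  by exists ddp; split => // j; have := h2 j; case: (k').
exists dp, ddp; split => //.
  have cdp i : continuous (dp i).
    move: (hh i); case: (k) => [->|k' /continuous_hpoly//].
    by apply: continuous_at_all => v; exact: cst_continuous.
  have cddp i j : continuous (ddp i j).
    have [_ /(_ j)] := hdd i; case: (k) => [->|[->|k' /continuous_hpoly//]];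
    by apply: continuous_at_all => v; exact: cst_continuous.
  move=> v v0; split => //.
  - exact: (continuous_hpoly hp).
  - by move=> i; exact: cdp.
  - by move=> i j; have [h _] := hdd i; exact: h.
  - by move=> i j; exact: cddp.
have h2 i : if k is k'.+2 then hpoly k' (ddp i i) else ddp i i = fun=> 0.
  by have [_ h2] := hdd i; move: (h2 i); case: (k) => [|[|k']].
move: h2; case: (k) => [h2|[h2|k' h2]].
- by move=> v; rewrite /lap big1// => i _; rewrite h2.
- by move=> v; rewrite /lap big1// => i _; rewrite h2.
by rewrite /lap; apply: hpoly_sum.
Qed.

Lemma C2data_eq F G dF ddF : (forall v : V, v != 0 -> F v = G v) ->
  C2data F dF ddF -> C2data G dF ddF.
Proof.
move=> FG hF v v0; have [cF d1 c1 d2 c2] := hF v v0.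
have nFG : \forall w \near v, F w = G w by apply: filterS (near_neq0 v0) => w /FG.
split => //; last by move=> i; exact: near_eq_is_derive nFG (d1 i).
rewrite /prop_for /continuous_at -(FG v v0); apply: cvg_trans cF.
exact: (@near_eq_cvg _ _ (nbhs v) _ F G nFG).
Qed.

Variable d : nat.
Hypothesis dE : d = (N - 1)%N.

(* l is the Laplace-Beltrami operator (nonpositive sign convention) applied to f *)
Definition sphere_laplacian (f l : S -> R) := exists dF ddF,
  C2data (radial_ext f) dF ddF /\ forall z : S, lap ddF (realify (val z)) = l z.

Lemma eigenspace_laplacian k f : eigenspace_LB R n d k f <->
  sphere_laplacian f (fun z => - theta R d k * f z).
Proof.
split=> [/eigen_data[dF [ddF [h1 _ h2]]]|[dF [ddF [/C2data_on[h1 h2] h]]]].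
  exists dF, ddF; split => // z; rewrite h2 ?realify_neq0// radial_ext_realify.
  by rewrite /rho sqn_realify powR1 mulr1.
split => // z.
by rewrite /laplace_beltrami h2 ?realify_neq0// h mulNr opprK.
Qed.

Lemma sphere_laplacian_sum (I : Type) (r : seq I) (c : I -> R) (f l : I -> S -> R) :
  (forall i, sphere_laplacian (f i) (l i)) ->
  sphere_laplacian (fun z => \sum_(i <- r) c i * f i z) (fun z => \sum_(i <- r) c i * l i z).
Proof.
move=> /choice[dF /choice[ddF h]]; do 2 eexists; split.
  exact: (C2data_sum r c (fun i => (h i).1)).
move=> z; rewrite /lap exchange_big /=; apply: eq_bigr => i _.
by rewrite -mulr_sumr [X in _ * X](h i).2.
Qed.

Lemma eigenspace_sum k (I : Type) (r : seq I) (c : I -> R) (f : I -> S -> R) :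
  (forall i, eigenspace_LB R n d k (f i)) ->
  eigenspace_LB R n d k (fun z => \sum_(i <- r) c i * f i z).
Proof.
move=> hf; apply/eigenspace_laplacian.
have := sphere_laplacian_sum r c (fun i => (eigenspace_laplacian k (f i)).1 (hf i)).
congr sphere_laplacian; apply/funext => z; rewrite mulr_sumr.
by apply: eq_bigr => i _; ring.
Qed.

Lemma eigenspaceZ k c f : eigenspace_LB R n d k f -> eigenspace_LB R n d k (fun z => c * f z).
Proof.
move=> hf; have := @eigenspace_sum k unit [:: tt] (fun=> c) (fun=> f) (fun=> hf).
by congr (eigenspace_LB R n d k); apply/funext => z; rewrite big_seq1.
Qed.

Lemma eigenspace0 k : eigenspace_LB R n d k (fun=> 0).
Proof.
have := @eigenspace_sum k void [::] (fun=> 0) (fun _ _ => 0) (fun i => match i with end).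
by congr (eigenspace_LB R n d k); apply/funext => z; rewrite big_nil.
Qed.

(* On the sphere, (Delta_S + theta_k) p is the restriction of the Euclidean
   Laplacian of p, a sum of h_j in H_j with j <= k - 2; subtracting the
   h_j / (theta_k - theta_j) from p leaves an element of H_k. *)
Lemma hpoly_sphere k p : hpoly k p -> exists h : nat -> S -> R,
  (forall j, eigenspace_LB R n d j (h j)) /\
  forall z : S, p (realify (val z)) = \sum_(j < k.+1) h j z.
Proof.
elim/ltn_ind: k p => k ih p hp; have [dp [ddp [hC he hl]]] := hpoly_C2data hp.
have [h [hh lapE]] : exists h : nat -> S -> R, (forall j, eigenspace_LB R n d j (h j)) /\
    forall z : S, lap ddp (realify (val z)) = \sum_(j < k) h j z.
  case: k ih hp hl {he} => [|[|k]] ih hp hl.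
  - by exists (fun _ _ => 0); split => [j|z]; [exact: eigenspace0|rewrite hl big_ord0].
  - by exists (fun _ _ => 0); split => [j|z]; [exact: eigenspace0|rewrite hl big1].
  have [h [h1 h2]] := ih k (leqnSn _) _ hl.
  exists (fun j => if (j < k.+1)%N then h j else fun=> 0); split => [j|z].
    by case: ifP => _; [exact: h1|exact: eigenspace0].
  rewrite h2 [RHS]big_ord_recr /= ltnn addr0; apply: eq_bigr => j _.
  by rewrite ltn_ord.
pose P (z : S) := p (realify (val z)).
have hP : sphere_laplacian P (fun z => - theta R d k * P z + \sum_(j < k) h j z).
  (* Off the origin the radial extension of P is |v|^-k p(v), since p is homogeneous of degree k. *)
  have hC1 := C2data_mul (@C2data_rho R n (- k%:R)) hC.
  do 2 eexists; split.
    apply: (C2data_eq _ hC1) => v v0; rewrite /radial_ext /P realify_radial//.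
    rewrite (hpoly_homog _ _ hp) exprVn -rho_enorm; congr (_ * _).
    have := rhoD k%:R (- k%:R) v0; rewrite subrr rho0 => h1.
    have r0 : rho k%:R v != 0 by rewrite rho_enorm expf_neq0// enorm_eq0.
    by apply: (mulfI r0); rewrite h1 mulfV.
  move=> z; have v0 := realify_neq0 z.
  have rho1 a : rho a (realify (val z)) = 1 by rewrite /rho sqn_realify powR1.
  rewrite (@lap_rho_mul _ _ _ _ _ _ _ _ v0 (he _)) !rho1 lapE /theta dE natrB; last by rewrite addSn.
  by rewrite /P; ring.
pose c j := (theta R d k - theta R d j)^-1.
pose Q (z : S) := \sum_(j < k) - c j * h j z.
have hQ : sphere_laplacian Q (fun z => \sum_(j < k) - c j * (- theta R d j * h j z)).
  by apply: sphere_laplacian_sum => j; apply/eigenspace_laplacian.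
have hg : eigenspace_LB R n d k (fun z => P z + Q z).
  apply/eigenspace_laplacian.
  have := @sphere_laplacian_sum bool [:: true; false] (fun=> 1) (fun b => if b then P else Q)
    (fun b => if b then (fun z => - theta R d k * P z + \sum_(j < k) h j z)
      else (fun z => \sum_(j < k) - c j * (- theta R d j * h j z)))
    (fun b => match b with true => hP | false => hQ end).
  congr sphere_laplacian; apply/funext => z; rewrite !big_cons big_nil !mul1r ?addr0//.
  rewrite mulrDr -addrA; congr (_ + _); rewrite mulr_sumr -big_split; apply: eq_bigr => j _ /=.
  rewrite /c; field; apply: theta_inj; first by rewrite dE addSn addnS subn1.
  by rewrite gtn_eqF.
exists (fun j => if j == k then (fun z => P z + Q z) else (fun z => c j * h j z)); split.
  by move=> j; have [->|_] := eqVneq j k; [exact: hg|exact: eigenspaceZ].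
move=> z; rewrite big_ord_recr /= eqxx addrC -addrA -[LHS]addr0; congr (_ + _).
rewrite -big_split big1// => j _ /=.
by rewrite ltn_eqF// mulNr addNr.
Qed.


End homogeneous_polynomials.

(** * Counting harmonics by interpolation on a grid *)

Section degree_count.
Context {R : realType} {n : nat}.
Local Notation N := (n.+1 + n.+1)%N.
Local Notation d0 := (n + n.+1)%N.
Local Notation V := 'rV[R]_N.
Local Notation S := (sphere R n).

Definition poly_le (M : nat) (p : V -> R) := exists q : nat -> V -> R,
  (forall k, hpoly k (q k)) /\ forall v, p v = \sum_(k < M.+1) q k v.

Lemma poly_le_factor M (j : 'I_N) (c : R) p : poly_le M p ->
  poly_le M.+1 (fun v => (v 0 j - c) * p v).
Proof.
move=> [q [hq pE]].
(* [q] is arbitrary beyond index M, so the test k' < M removes the spurious component q (M + 1). *)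
exists (fun k => if k is k'.+1 then
    (fun v => v 0 j * q k' v + (if (k' < M)%N then - c else 0) * q k v)
  else (fun v => - c * q 0%N v)); split.
  move=> [|k]; first exact: hpolyZ.
  by apply: hpolyD; [exact: hpoly_coord|exact: hpolyZ].
move=> v; rewrite [RHS]big_ord_recl /= [X in _ = _ + X]big_split /= -mulr_sumr -pE.
rewrite [X in _ = _ + (_ + X)]big_ord_recr /= ltnn mul0r addr0.
rewrite [X in _ = _ + (_ + X)](_ : _ = - c * \sum_(k < M) q k.+1 v); last first.
  by rewrite mulr_sumr; apply: eq_bigr => k _; rewrite /bump /= add1n ltn_ord.
have : p v = q 0%N v + \sum_(k < M) q k.+1 v by rewrite pE big_ord_recl.
by move=> e; rewrite e; ring.
Qed.

Lemma poly_le_prod (l : seq ('I_N * R)) :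
  poly_le (size l) (fun v => \prod_(x <- l) (v 0 x.1 - x.2)).
Proof.
elim: l => [|x l ih].
  exists (fun k => if k == 0%N then fun=> 1 else fun=> 0); split => [k|v].
    by case: eqP => [->|_]; [exact: hpoly_cst|exact: hpoly0].
  by rewrite big_nil big_ord1.
have := poly_le_factor x.1 x.2 ih.
by congr poly_le; apply/funext => v; rewrite big_cons.
Qed.

Variables (d : nat) (xi : nat -> S -> R) (deg : nat -> nat).
Hypotheses (dE : d = (N - 1)%N) (hxi : harmonic_system d xi deg).

Let spanned i0 (f : S -> R) := exists a : 'I_i0 -> R, forall z, f z = \sum_(i < i0) a i * xi i z.

Let spanned_sum i0 (I : finType) (f : I -> S -> R) : (forall i, spanned i0 (f i)) ->
  spanned i0 (fun z => \sum_i f i z).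
Proof.
move=> /choice[a ha]; exists (fun i => \sum_j a j i) => z.
under [RHS]eq_bigr do rewrite mulr_suml.
by rewrite exchange_big; apply: eq_bigr => j _; rewrite ha.
Qed.

Lemma poly_le_span M i0 p : poly_le M p -> (M < deg i0)%N ->
  spanned i0 (fun z => p (realify (val z))).
Proof.
move=> [q [hq pE]] hM.
rewrite (_ : (fun z => _) = (fun z => \sum_(k < M.+1) q k (realify (val z)))); last first.
  by apply/funext => z; rewrite pE.
apply: spanned_sum => k; have [h [hh hqE]] := hpoly_sphere dE (hq k).
rewrite (_ : (fun z => _) = (fun z => \sum_(j < k.+1) h j z)); last by apply/funext => z; rewrite hqE.
apply: spanned_sum => j; have [|a ->] := hs_span hxi (k := j) (i0 := i0) _ (hh j); last by exists a.
apply: leq_ltn_trans hM; rewrite -ltnS; apply: leq_trans (ltn_ord j) _; exact: (ltn_ord k).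
Qed.

Variable s : nat.
Hypothesis s0 : (0 < s)%N.

(** The spacing keeps every grid coordinate below 1/N, so all but the last coordinate of a point can
    be prescribed and the last one solved for on the unit sphere. *)
Let node (a : nat) : R := a%:R / (s%:R * N%:R).

Let node_inj (a b : nat) : node a = node b -> a = b.
Proof.
move=> /mulIf h; have : s%:R * N%:R != 0 :> R by rewrite mulf_neq0 ?pnatr_eq0 -?lt0n.
by move=> sn; apply/eqP; rewrite -(eqr_nat R); apply/eqP/h; rewrite invr_eq0.
Qed.

Local Notation G := {ffun 'I_d0 -> 'I_s}.

Let coord (g : G) (j : 'I_d0) : R := node (g j).

Let coord_sum g : \sum_j coord g j ^+ 2 <= 1.
Proof.
have N0 : (0 : R) < N%:R by rewrite ltr0n.
have s1 : (0 : R) < s%:R by rewrite ltr0n.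
apply: (@le_trans _ _ (\sum_(j < d0) N%:R^-1)); last first.
  rewrite sumr_const card_ord -[leLHS]mulr_natl ler_pdivrMr// mul1r ler_nat.
  by rewrite leq_add2r.
apply: ler_sum => j _.
have h1 : coord g j <= N%:R^-1.
  rewrite /coord /node invfM mulrA ler_piMl ?invr_ge0 ?(ltW N0)//.
  by rewrite ler_pdivrMr// mul1r ler_nat ltnW.
have h0 : 0 <= coord g j by rewrite divr_ge0 ?mulr_ge0 ?ler0n.
have n1 : N%:R^-1 <= 1 :> R by rewrite invf_le1// ler1n.
by rewrite expr2 -[leRHS]mulr1; apply: ler_pM => //; exact: le_trans n1.
Qed.

Let pt (g : G) : V := \row_(i < d0.+1)
  if unlift ord_max i is Some j then coord g j else Num.sqrt (1 - \sum_j coord g j ^+ 2).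

Let ax (j : 'I_d0) : 'I_N := lift (ord_max : 'I_d0.+1) j.

Let pt_ax g j : pt g 0 (ax j) = coord g j.
Proof. by rewrite mxE liftK. Qed.

Let sqn_pt g : sqn (pt g) = 1.
Proof.
rewrite /sqn (@bigD1_ord _ _ _ d0.+1 ord_max)//= mxE unlift_none sqr_sqrtr ?subr_ge0 ?coord_sum//.
rewrite [X in _ + X](_ : _ = \sum_j coord g j ^+ 2) ?subrK//.
by apply: eq_bigr => j _; rewrite pt_ax.
Qed.

Let zpt g : S := radial (pt g).

Let realify_zpt g : realify (val (zpt g)) = pt g.
Proof. by rewrite realify_radial -?sqn_gt0 ?sqn_pt// enormE sqn_pt sqrtr1 invr1 scale1r. Qed.

Let factors (g : G) : seq ('I_N * R) :=
  [seq (ax x.1, node x.2) | x : 'I_d0 * 'I_s in [pred x : 'I_d0 * 'I_s | x.2 != g x.1]].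

Let size_factors g : size (factors g) = (d0 * s.-1)%N.
Proof.
rewrite size_map -cardE.
have -> : #|[pred x : 'I_d0 * 'I_s | x.2 != g x.1]| = (d0 * s - d0)%N.
  have := cardC [pred x : 'I_d0 * 'I_s | x.2 == g x.1].
  rewrite card_prod !card_ord => <-.
  rewrite (_ : #|[pred x : 'I_d0 * 'I_s | x.2 == g x.1]| = d0); last first.
    rewrite -[RHS]card_ord -(card_imset _ (f := fun j => (j, g j))) => [|i j [] //].
    apply: eq_card => -[i j]; rewrite !inE /=; apply/eqP/imsetP => [->|[k _ [-> ->]]//].
    by exists i.
  rewrite addKn; apply: eq_card => x; by rewrite !inE.
by rewrite -[X in (_ - X)%N]muln1 -mulnBr subn1.
Qed.

Let L g (v : V) : R := \prod_(x <- factors g) (v 0 x.1 - x.2).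

Let L_pt g h : (L g (pt h) == 0) = (g != h).
Proof.
rewrite /L big_map big_enum_cond /=; apply/prodf_eq0/idP => [[[j a] /= ag]|].
  rewrite pt_ax subr_eq0 => /eqP/node_inj/val_inj e.
  by move: ag; rewrite andbT inE /= -e; apply: contra => /eqP ->.
move=> gh; have [j hj] : exists j, h j != g j.
  apply/existsP; apply: contraR gh; rewrite negb_exists => /forallP e.
  by apply/eqP/ffunP => j; have /eqP := negbNE (e j).
exists (j, h j); first by rewrite andbT inE.
by rewrite /= (pt_ax h j) subr_eq0; exact: eqxx.
Qed.

(** The Lagrange polynomials [L g] of the grid have degree d (s - 1), hence restrict to combinations
    of the first i0 harmonics. Evaluation at the s^d grid points then factors an identity matrix of
    that size through dimension i0. *)
Lemma degree_count i0 : (d0 * s.-1 < deg i0)%N -> (s ^ d0 <= i0)%N.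
Proof.
move=> hdeg.
have /choice[a ha] : forall g, spanned i0 (fun z => L g (realify (val z))).
  by move=> g; apply: (@poly_le_span (d0 * s.-1)) => //; rewrite -(size_factors g); exact: poly_le_prod.
have -> : (s ^ d0)%N = #|{: G}| by rewrite card_ffun !card_ord.
pose A : 'M[R]_(#|{: G}|, i0) := \matrix_(k, i) (a (enum_val k) i / L (enum_val k) (pt (enum_val k))).
pose B : 'M[R]_(i0, #|{: G}|) := \matrix_(i, k) xi i (zpt (enum_val k)).
apply: (@mulmx1_min R _ _ A B); apply/matrixP => k l; rewrite !mxE.
under eq_bigr do rewrite !mxE mulrAC.
rewrite -mulr_suml -ha realify_zpt.
have [->|kl] := eqVneq k l; first by rewrite mulfV// L_pt eqxx.
have /eqP -> : L (enum_val k) (pt (enum_val l)) == 0.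
  by rewrite L_pt; apply: contra kl => /eqP/enum_val_inj ->.
by rewrite mul0r.
Qed.

End degree_count.

(** * Norms on the sphere *)

Section sphere_norms.
Context {R : realType} {n : nat}.
Local Notation S := (sphere R n).
Local Notation nu := (sphere_vol R n).
Implicit Types (f g h : S -> R).

Let nu1 : nu setT = 1%E.
Proof. exact: (@probability_setT _ _ _ nu). Qed.

Let nu_gt0 : (0 < nu setT)%E. Proof. by rewrite nu1. Qed.

Lemma bms_integral f : bms f -> (\int[nu]_z (f z)%:E = (sint f)%:E)%E.
Proof. by move=> hf; rewrite /sint /Rintegral fineK// integrable_fin_num//; exact: bms_integrable. Qed.

Lemma bms_norm f : bms f -> bms (fun z => `|f z|).
Proof.
move=> [mf [M hM]]; split; first exact: (measurableT_comp (@normr_measurable R setT) mf).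
by exists M => z; rewrite normr_id.
Qed.

Lemma norm_sint_le f : bms f -> `|sint f| <= sint (fun z => `|f z|).
Proof.
move=> hf; rewrite ler_norml lerNl -mulN1r -sintZ//; apply/andP; split.
  apply: le_sint; [exact: bmsZ|exact: bms_norm|move=> z].
  by rewrite mulN1r -normrN ler_norm.
by apply: le_sint => //; [exact: bms_norm|move=> z; exact: ler_norm].
Qed.

(** From t^p <= 1 + t^(2s) with t = |f| / B. The resulting 2^(1/p) <= 2 is a harmless price for
    comparing norms of different exponents. *)
Lemma Lnorm_le_moment f (p B : R) s : bms f -> 1 <= p -> p <= (s.*2)%:R -> 0 < B ->
  sint (fun z => f z ^+ s.*2) <= B ^+ s.*2 -> ('N[nu]_p%:E[EFin \o f] <= (2 * B)%:E)%E.
Proof.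
move=> hf p1 ps B0 hB; have p0 : 0 < p by lra.
have Bp0 : 0 < B `^ p by rewrite powR_gt0.
have key z : `|f z| `^ p <= B `^ p * (1 + (B ^+ s.*2)^-1 * f z ^+ s.*2).
  rewrite -{1}[`|f z|](@divfK _ B) ?gt_eqF// mulrC powRM ?divr_ge0 ?(ltW B0)// ler_pM2l//.
  have -> : (B ^+ s.*2)^-1 * f z ^+ s.*2 = (`|f z| / B) ^+ s.*2.
    by rewrite expr_div_n -normrX ger0_norm 1?mulrC// -mul2n exprM exprn_ge0// sqr_ge0.
  have t0 : 0 <= `|f z| / B by rewrite divr_ge0// ltW.
  have [t1|t1] := leP (`|f z| / B) 1.
    apply: (@le_trans _ _ 1); last by rewrite lerDl exprn_ge0.
    have := @ge0_ler_powR R p (ltW p0) _ 1 t0 ler01 t1.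
    by rewrite powR1.
  apply: (@le_trans _ _ ((`|f z| / B) ^+ s.*2)); last by rewrite lerDr.
  by rewrite -powR_mulrn// ler_powR// ltW.
have hg : bms (fun z => B `^ p * (1 + (B ^+ s.*2)^-1 * f z ^+ s.*2)).
  by apply: bmsZ; apply: bmsD; [exact: bms_cst|apply: bmsZ; exact: bmsX].
have int_le : (\int[nu]_z (`|f z| `^ p)%:E <= (B `^ p * 2)%:E)%E.
  apply: (@le_trans _ _ (\int[nu]_z (B `^ p * (1 + (B ^+ s.*2)^-1 * f z ^+ s.*2))%:E)%E).
    apply: ge0_le_integral => //.
    - apply/measurable_EFinP; apply: (measurableT_comp (measurable_powR _)).
      exact: (bms_norm hf).1.
    - by apply/measurable_EFinP; exact: hg.1.
    - by move=> z _; rewrite lee_fin; exact: key.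
  rewrite bms_integral// lee_fin sintZ; last first.
    by apply: bmsD; [exact: bms_cst|apply: bmsZ; exact: bmsX].
  rewrite ler_wpM2l ?(ltW Bp0)// sintD; [|exact: bms_cst|by apply: bmsZ; exact: bmsX].
  rewrite sint_cst sintZ; last exact: bmsX.
  rewrite -[leRHS]/(1 + 1) lerD2l mulrC ler_pdivrMr ?exprn_gt0// mul1r//.
rewrite unlock /=.
have pinv : 0 <= p^-1 by rewrite invr_ge0 ltW.
apply: (@le_trans _ _ ((B `^ p * 2)%:E `^ p^-1)%E).
  apply: gt0_ler_poweR => //.
  - by rewrite in_itv /= leey andbT; apply: integral_ge0 => z _; rewrite lee_fin powR_ge0.
  - by rewrite in_itv /= leey andbT lee_fin mulr_ge0 ?powR_ge0.
rewrite poweR_EFin lee_fin powRM ?powR_ge0// -powRrM mulfV ?gt_eqF// powRr1 ?(ltW B0)//.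
rewrite mulrC ler_wpM2r ?(ltW B0)// -[leRHS]powRr1// ler_powR ?ler1n//.
by rewrite invf_le1.
Qed.

Lemma Lnorm_infty_le f (B : R) : (forall z, `|f z| <= B) -> ('N[nu]_+oo[EFin \o f] <= B%:E)%E.
Proof.
move=> hB; rewrite unlock; case: ifPn => [_|/negP[]]; last exact: nu_gt0.
apply/ess_supP; apply: aeW => z /=.
by rewrite lee_fin.
Qed.

(** The extended inverses settle the degenerate cases: that of +oo is 0, giving the pair (+oo, 1),
    and that of 0 is +oo, which excludes q' = 0. *)
Lemma conjugate_exponents (q : \bar R) (q' : R) : (1 < q)%E -> (q^-1 + (q'%:E)^-1 = 1)%E ->
  (q = +oo%E /\ q' = 1) \/ exists r : R, [/\ q = r%:E, 1 < r, 1 < q' & r^-1 + q'^-1 = 1].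
Proof.
case: q => [r| |]// r1; last first.
  rewrite invey add0e inver; case: eqP => // _ [h]; left; split => //.
  by rewrite -[q']invrK h invr1.
move: r1; rewrite lte_fin => r1; have r0 : 0 < r by lra.
rewrite !inver gt_eqF//; case: eqP => // /eqP q0 [h]; right; exists r; split => //.
have : 0 < q'^-1 < 1.
  have : 0 < r^-1 by rewrite invr_gt0.
  have : r^-1 < 1 by rewrite invf_lt1.
  by move=> a b; apply/andP; split; lra.
by move=> /andP[a b]; rewrite invr_gt0 in a; rewrite -invf_lt1.
Qed.

Lemma Lnorm_pairing f h (q : \bar R) (q' : R) : bms f -> bms h ->
  (1 < q)%E -> (q^-1 + (q'%:E)^-1 = 1)%E ->
  ((sint (fun z => f z * h z))%:E <= 'N[nu]_q[EFin \o f] * 'N[nu]_q'%:E[EFin \o h])%E.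
Proof.
move=> hf hh q1 qq; have hfh := bmsM hf hh.
apply: (@le_trans _ _ ('N[nu]_1[EFin \o (f \* h)%R])%E).
  rewrite Lnorm1 (_ : (fun z => `|(EFin \o (f \* h)%R) z|)%E = fun z => (`|f z * h z|)%:E)//.
  rewrite bms_integral; last exact: bms_norm.
  by rewrite lee_fin (le_trans (ler_norm _))// norm_sint_le.
have [[-> ->]|[r [-> r1 q'1 rq]]] := conjugate_exponents q1 qq; last first.
  by apply: hoelder => //; [exact: hf.1|exact: hh.1|lra|lra].
rewrite !Lnorm1.
(* The remaining pair is (+oo, 1): the essential supremum of |f| is a finite t since f is bounded,
   and |f| <= t almost everywhere. *)
have [M hM] := hf.2.
have M0 : 0 <= M by exact: le_trans (hM sphere_point).
have N_le : ('N[nu]_+oo[EFin \o f] <= M%:E)%E by exact: Lnorm_infty_le.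
have N_ge0 := Lnorm_ge0 nu +oo%E (EFin \o f).
have [t tE t0] : exists2 t, 'N[nu]_+oo[EFin \o f]%E = t%:E & 0 <= t.
  move: N_le N_ge0; case: ('N[nu]_+oo[EFin \o f])%E => // t _ t0.
  by exists t.
have aet : \forall z \ae nu, (`|f z|%:E <= t%:E)%E.
  have := @ess_sup_ge _ _ _ nu (abse \o (EFin \o f)).
  by rewrite -tE unlock; case: ifPn => // /negP[]; exact: nu_gt0.
rewrite tE (_ : (fun z => `|(EFin \o h) z|)%E = fun z => (`|h z|)%:E)//.
rewrite [X in (_ * X)%E]bms_integral; last exact: bms_norm.
rewrite -EFinM -sintZ; last exact: bms_norm.
rewrite -[leRHS]bms_integral; last by apply: bmsZ; exact: bms_norm.
apply: ae_ge0_le_integral => //.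
- by apply: measurableT_comp => //; apply/measurable_EFinP; exact: hfh.1.
- by move=> z _; rewrite lee_fin mulr_ge0.
- by apply/measurable_EFinP; exact: (bmsZ t (bms_norm hh)).1.
apply: filterS aet => z; rewrite lee_fin => ft _.
by rewrite /= lee_fin normrM ler_wpM2r.
Qed.

End sphere_norms.

(** * The lower bound *)

Section enumerated_harmonics.
Context {R : realType} {n : nat}.
Local Notation N := (n.+1 + n.+1)%N.
Local Notation S := (sphere R n).
Local Notation nu := (sphere_vol R n).
Variables (d : nat) (dim : nat -> nat) (Y : forall k, 'I_(dim k) -> S -> R) (xi : nat -> S -> R).
Arguments Y : clear implicits.
Hypotheses (dE : d = (N - 1)%N) (hY : harmonic_bases d Y) (hxi : harmonic_enumeration Y xi).

Lemma harmonic_system_of_bases : exists deg, [/\ harmonic_system d xi deg,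
  {homo deg : i j / (i <= j)%N} &
  forall k (j : 'I_(dim k)), exists i, xi i = Y k j /\ deg i = k].
Proof.
have [e [[e' eK e'K] mono xiE]] := hxi.
pose deg i := tag (e i).
have eigen i : eigenspace_LB R n d (deg i) (xi i) by rewrite xiE; have [h _ _] := hY (tag (e i)).
have idx k (j : 'I_(dim k)) : exists i, xi i = Y k j /\ deg i = k.
  by exists (e' (existT _ k j)); rewrite xiE /deg e'K.
exists deg; split => //; split => //.
- move=> i j; have [ij|ij] := eqVneq (deg i) (deg j); last first.
    rewrite (eigenspace_orthogonal dE ij (eigen i) (eigen j)).
    by case: (eqVneq i j) ij => // ->; rewrite eqxx.
  rewrite !xiE -(can_eq eK); move: ij; rewrite /deg.
  case: (e i) => k a; case: (e j) => l b /= kl; subst l.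
  by have [_ -> _] := hY k; rewrite eq_Tagged.
- move=> k i0 f ki0 Hf; have [_ _ /(_ f Hf)[a fE]] := hY k.
  have /choice[ix hix] : forall j : 'I_(dim k), exists i : 'I_i0, xi i = Y k j.
    move=> j; have [i [xiYE di]] := idx k j.
    have ii0 : (i < i0)%N by rewrite ltnNge; apply: contraL ki0 => /mono; rewrite -leqNgt -di.
    by exists (Ordinal ii0).
  exists (fun i => \sum_j a j * (ix j == i)%:R); apply/funext => z.
  under [RHS]eq_bigr do rewrite mulr_suml.
  rewrite exchange_big fE; apply: eq_bigr => j _.
  rewrite (bigD1 (ix j))//= eqxx mulr1 big1 ?addr0 ?hix// => i.
  by rewrite eq_sym => /negbTE ->; rewrite mulr0 mul0r.
Qed.

Variable deg : nat -> nat.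
Hypothesis hs : harmonic_system d xi deg.

Lemma comb_inner (I J : finType) (a : I -> R) (b : J -> R) (f : I -> nat) (g : J -> nat) :
  sint (fun z => (\sum_i a i * xi (f i) z) * (\sum_j b j * xi (g j) z)) =
  \sum_i \sum_j a i * b j * (f i == g j)%:R.
Proof.
have bx i : bms (xi i) by exact: bms_xi hs i.
rewrite (_ : (fun z => _) = (fun z => \sum_i \sum_j a i * b j * (xi (f i) z * xi (g j) z))).
  rewrite sint_sum => [|i _]; last by apply: bms_sum => j _; apply: bmsZ; exact: bmsM.
  apply: eq_bigr => i _; rewrite sint_sum => [|j _]; last by apply: bmsZ; exact: bmsM.
  by apply: eq_bigr => j _; rewrite sintZ; [rewrite -(hs_ortho hs)|exact: bmsM].
apply/funext => z; rewrite mulr_suml; apply: eq_bigr => i _.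
by rewrite mulr_sumr; apply: eq_bigr => j _; ring.
Qed.

(** The constant 1 lies in the eigenspace of degree 0, by [hpoly_sphere] in degree 0, and
    eigenspaces of different degrees are orthogonal. *)
Lemma sint_xi i : (0 < deg i)%N -> sint (xi i) = 0.
Proof.
move=> di; have [h [hh hE]] := hpoly_sphere dE (hpoly_cst (n := n) (1 : R)).
have h0 z : h 0%N z = 1 by rewrite (hE z) big_ord1.
have := eigenspace_orthogonal dE _ (hs_eigen hs i) (hh 0%N).
rewrite -lt0n di => /(_ isT); rewrite /inner => <-.
by rewrite /sint; congr (Rintegral _ _ _); apply/funext => z; rewrite h0 mulr1.
Qed.

(** Integrating the kernel bound for M = 1 counts these harmonics. Any bound independent of D
    serves, as they only have to be few compared with D. *)
Lemma card_degree0 D : #|[set i : 'I_D | deg i == 0%N]%SET|%:R <= @kernel_const R n d.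
Proof.
have bx i : bms (fun z => xi i z ^+ 2) by apply: bmsX; exact: bms_xi hs i.
rewrite -sum1_card natr_sum; rewrite (eq_bigl (fun i : 'I_D => deg i == 0%N)) => [|i]; last by rewrite inE.
rewrite (eq_bigr (fun i : 'I_D => sint (fun z => xi i z ^+ 2))) => [|i _]; last first.
  have := hs_ortho hs i i; rewrite eqxx => <-.
  by rewrite /inner /sint; congr (Rintegral _ _ _); apply/funext => z; rewrite expr2.
rewrite -sint_sum// -[leRHS](@sint_cst R n); apply: le_sint => [||z].
- by apply: bms_sum => i _; exact: bx.
- exact: bms_cst.
have := kernel_bound dE hs (P := fun i : 'I_D => deg i == 0%N) z (ltn0Sn 0).
by rewrite expr1n mulr1; apply => i /eqP ->.
Qed.

Variables (gamma : R) (hdeg : forall k (j : 'I_(dim k)), exists i, xi i = Y k j /\ deg i = k).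
Local Notation w i := (theta R d (deg i) `^ (- (gamma / 2))).

(** The function phi of the Sobolev class is the combination with coefficients [a]. Degree 0 is
    excluded because phi must have mean 0. *)
Lemma comb_sobolev (p : \bar R) D (a : 'I_D -> R) :
  (forall i : 'I_D, deg i = 0%N -> a i = 0) ->
  ('N[nu]_p[EFin \o (fun z => \sum_i a i * xi i z)%R] <= 1)%E ->
  sobolev_class d Y gamma p (fun z => \sum_(i < D) (w i * a i) * xi i z).
Proof.
move=> a0 hN.
have bx i : bms (xi i) by exact: bms_xi hs i.
have bc (c : 'I_D -> R) : bms (fun z => \sum_i c i * xi i z).
  by apply: bms_sum => i _; exact: bmsZ.
split; first exact: (bms_integrable (bc _)).
do 2 eexists; split; [exact: (bc a).1|exact: hN| |reflexivity|].
  have -> : (\int[nu]_z (\sum_(i < D) a i * xi i z))%R = sint (fun z => \sum_i a i * xi i z) by [].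
  rewrite sint_sum => [|i _]; last exact: bmsZ.
  rewrite big1// => i _; rewrite sintZ//.
  have [di|di] := posnP (deg i); first by rewrite a0// mul0r.
  by rewrite sint_xi// mulr0.
move=> k j k0; rewrite /fourier_coef; have [i [<- ik]] := hdeg j.
have coefE (c : 'I_D -> R) : inner (fun z => \sum_i c i * xi i z) (xi i) =
    \sum_l c l * ((l : nat) == i)%:R.
  transitivity (sint (fun z => (\sum_l c l * xi l z) * (\sum_(l < 1) 1 * xi i z))).
    by rewrite /inner /sint; congr (Rintegral _ _ _); apply/funext => z; rewrite big_ord1 mul1r.
  rewrite (comb_inner c (fun=> 1) (fun l => l) (fun=> i)).
  by apply: eq_bigr => l _; rewrite big_ord1 mulr1.
rewrite !coefE mulr_sumr; apply: eq_bigr => l _.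
by case: eqP => [->|_]; rewrite ?mulr0// !mulr1 ik.
Qed.

End enumerated_harmonics.

Section width_lower_bound.
Context {R : realType} {n : nat}.
Local Notation N := (n.+1 + n.+1)%N.
Local Notation S := (sphere R n).
Local Notation nu := (sphere_vol R n).
Variables (d : nat) (dim : nat -> nat) (Y : forall k, 'I_(dim k) -> S -> R) (xi : nat -> S -> R).
Variables (deg : nat -> nat) (gamma : R).
Hypotheses (dE : d = (N - 1)%N) (hs : harmonic_system d xi deg).
Hypothesis hdeg : forall k (j : 'I_(dim k)), exists i, xi i = Y j /\ deg i = k.
Hypothesis gamma0 : 0 < gamma.
Variables (K m M D c0 : nat).
Hypotheses (DE : D = (4 * (K * m))%N) (Kc : (64 + c0 <= K)%N) (m2 : (2 <= m)%N) (M0 : (0 < M)%N).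
Hypothesis degM : forall i : 'I_D, (deg i <= M)%N.
Hypothesis hc0 : @kernel_const R n d <= c0%:R.
Local Notation signs := {ffun 'I_D -> bool}.
Local Notation A := (@kernel_const R n d * M%:R ^+ d).
Local Notation w i := (theta R d (deg i) `^ (- (gamma / 2))).
Local Notation wmin := (theta R d M `^ (- (gamma / 2))).

Definition positive_degree (i : 'I_D) : R := (0 < deg i)%:R.
Local Notation u := positive_degree.

Lemma theta_gt0 k : (0 < k)%N -> 0 < theta R d k.
Proof.
move=> k0; have k1 : (1 : R) <= k%:R by rewrite ler1n.
have d1 : (1 : R) <= d%:R by rewrite ler1n dE addSn addnS subn1.
by rewrite /theta mulr_gt0//; lra.
Qed.

Lemma theta_le k l : (k <= l)%N -> theta R d k <= theta R d l.
Proof.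
move=> kl; have d1 : (1 : R) <= d%:R by rewrite ler1n dE addSn addnS subn1.
have k1 : (k%:R : R) <= l%:R by rewrite ler_nat.
have k0 := ler0n R k.
by rewrite /theta; apply: ler_pM => //; lra.
Qed.

Let w_gt0 i : (0 < deg i)%N -> 0 < w i.
Proof. by move=> di; rewrite powR_gt0 ?theta_gt0. Qed.

Let wmin_gt0 : 0 < wmin.
Proof. by rewrite powR_gt0 ?theta_gt0. Qed.

Let wmin_le (i : 'I_D) : (0 < deg i)%N -> wmin <= w i.
Proof.
move=> di; rewrite !powRN lef_pV2 ?posrE ?powR_gt0 ?theta_gt0//.
apply: ge0_ler_powR; first by rewrite divr_ge0// ltW.
- by rewrite nnegrE ltW// theta_gt0.
- by rewrite nnegrE ltW// theta_gt0.
- exact: theta_le.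
Qed.

(* the coefficients, up to signs, of the function h paired with f - g when g is
   spanned by the harmonics indexed by W *)
Definition dual_coef (W : {set 'I_D}) (i : 'I_D) : R :=
  if (i \in W) || (deg i == 0%N) then 0 else wmin / w i.

Lemma xi_square_sum (c : 'I_D -> R) z : (forall i, `|c i| <= 1) ->
  \sum_i (c i * xi i z) ^+ 2 <= A.
Proof.
move=> c1; apply: (le_trans _ (kernel_bound dE hs z M0 (P := predT) (fun i _ => degM i))).
apply: ler_sum => i _; rewrite exprMn ler_piMl ?sqr_ge0//.
by rewrite -real_normK ?num_real// expr_le1.
Qed.

Lemma positive_degree_le1 i : `|u i| <= 1.
Proof. by rewrite /u; case: (_ < _)%N; rewrite ?normr1 ?normr0. Qed.

Let dual_coef_le1 W i : `|dual_coef W i| <= 1.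
Proof.
rewrite /dual_coef; case: ifPn; first by rewrite normr0.
rewrite negb_or -lt0n => /andP[_ di].
by rewrite ger0_norm ?divr_ge0 ?powR_ge0// ler_pdivrMr ?w_gt0// mul1r wmin_le.
Qed.

Let A_gt0 : 0 < A.
Proof. by rewrite mulr_gt0 ?kernel_const_gt0// exprn_gt0// ltr0n. Qed.

Let card_degree0 : (#|[set i : 'I_D | deg i == 0%N]%SET| <= c0)%N.
Proof. by rewrite -(ler_nat R); apply: le_trans (card_degree0 dE hs D) hc0. Qed.

(** At least 4Km - m - c0 indices remain, and each of the fewer than Km disagreements costs 2. As Km
    >= m + c0, at least Km is left; this is why K contains c0. *)
Let sign_correlation (e e' : signs) (W : {set 'I_D}) : (#|W| <= m)%N ->
  (#|[set i | e i != e' i]%SET| < K * m)%N ->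
  (K * m)%:R <= \sum_(i | ~~ ((i \in W) || (deg i == 0%N))) @sg R (e i) * sg (e' i).
Proof.
move=> Wm hd; pose G := [set i : 'I_D | ~~ ((i \in W) || (deg i == 0%N))]%SET.
pose Z := [set i : 'I_D | deg i == 0%N]%SET.
have cardG : (D <= #|G| + #|W| + #|Z|)%N.
  have -> : G = ~: (W :|: Z)%SET by apply/finset.setP => i; rewrite !inE.
  have := cardsC (W :|: Z)%SET; have := (leq_card_setU W Z).1; rewrite card_ord.
  by move: #|_| #|_| #|_| #|_| => x1 x2 x3 x4; clear; lia.
rewrite (eq_bigl (mem G)) => [|i]; last by rewrite !inE.
have -> : \sum_(i in G) @sg R (e i) * sg (e' i) =
    #|G|%:R - 2 * \sum_(i in G) (e i != e' i)%:R.
  rewrite -sum1_card natr_sum mulr_sumr -sumrB; apply: eq_bigr => i _.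
  by case: (e i); case: (e' i); rewrite /sg /=; ring.
have : \sum_(i in G) (e i != e' i)%:R <= #|[set i | e i != e' i]%SET|%:R :> R.
  rewrite -natr_sum ler_nat -sum1_card big_mkcond [leqRHS]big_mkcond /=.
  by apply: leq_sum => i _; rewrite !inE; case: (_ != _); case: ifP.
have : (K * m + 2 * #|[set i | e i != e' i]%SET| <= #|G|)%N.
  have mK : (m + c0 <= K * m)%N by move: Kc m2; clear; nia.
  move: cardG hd card_degree0 Wm mK DE; rewrite -/Z.
  move: #|G| #|W| #|Z| #|[set i | e i != e' i]%SET| (K * m)%N => g a b c t.
  by clear; lia.
rewrite -(ler_nat R) natrD natrM; lra.
Qed.

Variables (p : \bar R) (B : R) (T : {set signs}).
Hypotheses (B0 : 0 < B) (hT : (#|{: signs}| <= 2 * #|T|)%N).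
Hypothesis normT : forall e, e \in T ->
  ('N[nu]_p[EFin \o (fun z => B^-1 * signed_sum xi u e z)%R] <= 1)%E.
Variables (q : \bar R) (q' Bq : R) (s : nat).
Hypotheses (q1 : (1 < q)%E) (qq' : (q^-1 + (q'%:E)^-1 = 1)%E).
Hypotheses (q's : q' <= (s.*2)%:R) (Bq0 : 0 < Bq) (hBq : 2 * moment_const s A <= Bq ^+ s.*2).

Lemma width_lower_bound :
  ((B^-1 * wmin * (K * m)%:R / (2 * Bq))%:E <=
   m_term_width (sobolev_class d Y gamma p) xi m (fun f => 'N[nu]_q[EFin \o f]))%E.
Proof.
pose Typ W := [set e : signs |
  (sint (fun z => signed_sum xi (dual_coef W) e z ^+ s.*2) <= 2 * moment_const s A)%R]%SET.
have hTyp W : (#|{: signs}| <= 2 * #|Typ W|)%N.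
  apply: (moment_typical hs A_gt0) => z; apply: xi_square_sum; exact: dual_coef_le1.
have K64 : (64 <= K)%N by apply: leq_trans Kc; exact: leq_addr.
have [e eT he] := simultaneous_signs R K64 m2 DE hT hTyp.
pose a (i : 'I_D) := B^-1 * u i * sg (e i).
pose f z := \sum_(i < D) (w i * a i) * xi i z.
have fK : sobolev_class d Y gamma p f.
  apply: (@comb_sobolev _ _ _ _ Y xi dE deg hs gamma hdeg p D a) => [i di|]; first by rewrite /a /u di mulr0 mul0r.
  rewrite (_ : (fun z => _) = (fun z => B^-1 * signed_sum xi u e z)); first exact: normT.
  apply/funext => z; rewrite /signed_sum mulr_sumr; apply: eq_bigr => i _.
  by rewrite /a; ring.
have bx i : bms (xi i) by exact: bms_xi hs i.
have bf : bms f by apply: bms_sum => i _; exact: bmsZ.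
apply: le_trans (ereal_sup_ubound _); last by exists f; first exact: fK.
apply/ereal_infP => _ [om om_inc <-]; apply/ereal_infP => _ [g [b gE] <-].
have bg : bms g by rewrite gE; apply: bms_sum => i _; exact: bmsZ.
(* Chosen indices beyond D can be disregarded: those harmonics are orthogonal to h, which involves
   the first D only. *)
pose W := [set i : 'I_D | (i : nat) \in codom om]%SET.
have Wm : (#|W| <= m)%N.
  rewrite -[m in (_ <= m)%N]card_ord -(size_codom om) cardE -(size_map val).
  apply: uniq_leq_size; first by rewrite (map_inj_uniq val_inj) enum_uniq.
  by move=> _ /mapP[i + ->]; rewrite mem_enum inE.
have [e' e'T ee'] := he W Wm.
pose h := signed_sum xi (dual_coef W) e'.
have bh : bms h by apply: bms_sum => i _; do 2 apply: bmsZ.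
have Nh : ('N[nu]_q'%:E[EFin \o h] <= (2 * Bq)%:E)%E.
  apply: (Lnorm_le_moment bh _ q's Bq0).
    by have [[_ ->]|[r [_ _ /ltW]]] := conjugate_exponents q1 qq'.
  by move: e'T; rewrite inE => /le_trans; apply.
have hE : h = fun z => \sum_i (sg (e' i) * dual_coef W i) * xi i z.
  by apply/funext => z; apply: eq_bigr => i _; rewrite mulrA.
(* The weights of f cancel against those of h, so only wmin and the correlation of e with e'
   remain. *)
have fh : B^-1 * wmin * (K * m)%:R <= sint (fun z => f z * h z).
  rewrite hE (comb_inner hs (fun i : 'I_D => w i * a i) (fun i => sg (e' i) * dual_coef W i) (@nat_of_ord D) (@nat_of_ord D)).
  have -> : \sum_(i < D) \sum_(j < D) w i * a i * (sg (e' j) * dual_coef W j) * ((i : nat) == (j : nat))%:R =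
      B^-1 * wmin * \sum_(i | ~~ ((i \in W) || (deg i == 0%N))) @sg R (e i) * sg (e' i).
    rewrite mulr_sumr [RHS]big_mkcond /=; apply: eq_bigr => i _.
    rewrite (bigD1 i)//= eqxx mulr1 big1 ?addr0 => [|j ji]; last first.
      by rewrite eq_sym (inj_eq val_inj) (negbTE ji) mulr0.
    rewrite /dual_coef; case: ifPn => [_|]; first by rewrite !mulr0.
    rewrite negb_or -lt0n => /andP[_ di].
    have wi := w_gt0 di; rewrite /a /u di /= mulr1; field.
    by rewrite !gt_eqF.
  rewrite ler_wpM2l ?mulr_ge0 ?invr_ge0 ?(ltW B0) ?(ltW wmin_gt0)//.
  exact: sign_correlation.
have gh : sint (fun z => g z * h z) = 0.
  rewrite hE gE (comb_inner hs b (fun i => sg (e' i) * dual_coef W i) om (@nat_of_ord D)).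
  rewrite big1// => l _; rewrite big1// => j _; case: eqP => [omj|_]; last by rewrite mulr0.
  by rewrite /dual_coef inE -omj codom_f /= !mulr0 mul0r.
have fgh : sint (fun z => (f z - g z) * h z) = sint (fun z => f z * h z).
  rewrite (_ : (fun z => _) = (fun z => f z * h z + -1 * (g z * h z))).
    rewrite sintD; [|exact: bmsM|by apply: bmsZ; exact: bmsM].
    by rewrite sintZ ?gh ?mulr0 ?addr0//; exact: bmsM.
  by apply/funext => z; ring.
have bfg : bms (f \- g)%R.
  rewrite (_ : (f \- g)%R = (fun z => f z + -1 * g z)); last by apply/funext => z /=; rewrite mulN1r.
  by apply: bmsD => //; exact: bmsZ.
have := Lnorm_pairing bfg bh q1 qq'; rewrite [X in (X%:E <= _)%E]fgh => pair.
rewrite EFinM lee_pdivrMr ?mulr_gt0//.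
apply: (@le_trans _ _ (sint (fun z => f z * h z))%:E); first by rewrite lee_fin.
apply: (le_trans pair); apply: lee_wpmul2l => //; exact: Lnorm_ge0.
Qed.

End width_lower_bound.

(** * Numerical estimates and the choice of constants *)

Section constants.
Context {R : realType}.

Lemma factorial_le_pow k : (k`! <= k ^ k)%N.
Proof.
elim: k => // k ih; rewrite factS expnS leq_mul2l /=; apply: leq_trans ih _.
by case: k => // k; rewrite leq_exp2r.
Qed.

Lemma pow_scale_le (c x : R) k : 0 <= c -> 0 <= x -> (0 < k)%N ->
  c * x ^+ k <= ((1 + c) * x) ^+ k.
Proof.
move=> c0 x0 k0; rewrite exprMn ler_wpM2r ?exprn_ge0//.
apply: (@le_trans _ _ (1 + c)); first by rewrite lerDr.
by rewrite -[leLHS]expr1 ler_weXn2l//; lra.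
Qed.

(** Since (2s)! <= (2s)^(2s) and s >= 1, all constants can move inside the 2s-th power; the root is
    of order s A^(1/2). *)
Lemma moment_const_le (s : nat) (A c : R) : 0 < A -> 0 <= c -> (0 < s)%N ->
  c * moment_const s A <= ((1 + 2 * c * expR 2) * (2 * s%:R * Num.sqrt A)) ^+ s.*2.
Proof.
move=> A0 c0 s0.
have x0 : 0 <= 2 * s%:R * Num.sqrt A by rewrite !mulr_ge0 ?sqrtr_ge0.
have c20 : 0 <= 2 * c * expR 2 by rewrite !mulr_ge0 ?expR_ge0.
apply: le_trans (pow_scale_le c20 x0 _); last by rewrite double_gt0.
have -> : (2 * s%:R * Num.sqrt A) ^+ s.*2 = (s.*2)%:R ^+ s.*2 * A ^+ s.
  rewrite exprMn -natrM mul2n; congr (_ * _).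
  by rewrite -mul2n exprM sqr_sqrtr// ltW.
rewrite /moment_const (_ : c * _ = 2 * c * expR 2 * ((s.*2)`!%:R * A ^+ s)); last by ring.
rewrite ler_wpM2l// ler_wpM2r ?exprn_ge0 ?(ltW A0)//.
by rewrite -natrX ler_nat factorial_le_pow.
Qed.

(** A factor up to e^s is absorbed by passing from A to e A, the moment constant being homogeneous
    of degree s in A. This removes the factor of order m from the uniform bound when s >= log m. *)
Lemma moment_const_expR (s : nat) (A x : R) : 0 < A -> 0 < x -> ln x <= s%:R ->
  x * moment_const s A <= moment_const s (expR 1 * A).
Proof.
move=> A0 x0 xs; rewrite /moment_const exprMn -expRM_natr mul1r.
rewrite (_ : x * _ = 2 * expR 2 * (s.*2)`!%:R * A ^+ s * x); last by ring.
rewrite (_ : _ * (_ * _) = 2 * expR 2 * (s.*2)`!%:R * A ^+ s * expR s%:R); last by ring.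
rewrite ler_wpM2l ?mulr_ge0 ?expR_ge0 ?exprn_ge0 ?ler0n ?(ltW A0)//.
by rewrite -[leLHS]lnK ?posrE// ler_expR.
Qed.

Lemma exists_nat_ceil (x : R) : 0 <= x -> exists s : nat, [/\ (0 < s)%N, x <= s%:R & s%:R <= x + 1].
Proof.
move=> x0; exists (Num.truncn x).+1; split => //; first exact: ltW (truncnS_gt x).
by rewrite -natr1 lerD2r truncn_le.
Qed.

Lemma expR_half_le2 : expR (1 / 2 : R) <= 2.
Proof.
have := expR_ge1Dx (- (1 / 2) : R); rewrite expRN => h.
have e0 := expR_gt0 (1 / 2 : R).
have : expR (1 / 2) * (1 / 2) <= expR (1 / 2) * (expR (1 / 2))^-1 :> R.
  by rewrite ler_pM2l//; lra.
by rewrite mulfV ?gt_eqF// => ?; lra.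
Qed.

Lemma ln2_ge_half : 1 / 2 <= ln (2 : R).
Proof. by rewrite -ler_expR lnK ?posrE//; exact: expR_half_le2. Qed.

Lemma le_two_powR (y : R) : 0 <= y -> y <= 2 `^ (2 * y).
Proof.
move=> y0; rewrite /powR gt_eqF//.
apply: (@le_trans _ _ (expR y)); first by have := expR_ge1Dx y; lra.
rewrite ler_expR; have h := ler_wpM2l y0 ln2_ge_half.
by rewrite (_ : 2 * y * ln 2 = 2 * (y * ln 2)); [lra|ring].
Qed.

(** This decides C2 = C3 = 2: squaring recovers t exactly, and y <= 2^(2y) at y = q^(1/2) bounds q
    by the square of the exponential factor. *)
Lemma factor_le (t q : R) : 0 < t -> 0 < q ->
  (t `^ (1 / 2) * 2 `^ (2 * q `^ (1 / 2))) `^ (- 2) <= (t * q)^-1.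
Proof.
move=> t0 q0; rewrite powRN powR_mulrn ?mulr_ge0 ?powR_ge0//.
have sq (x : R) : 0 < x -> (x `^ (1 / 2)) ^+ 2 = x.
  by move=> x0; rewrite -powR_mulrn ?powR_ge0// -powRrM mul1r mulVf// powRr1// ltW.
rewrite lef_pV2 ?posrE ?mulr_gt0 ?exprn_gt0 ?mulr_gt0 ?powR_gt0//.
rewrite exprMn sq// ler_pM2l// -{1}(sq q q0).
by rewrite lerXn2r ?nnegrE ?powR_ge0// le_two_powR// powR_ge0.
Qed.

(** The pairing contributes k m and the two norms one factor sA each, with sA^2 <= a m. So m cancels
    and the weight [wg], of order m^(-gamma/d), is left. *)
Lemma assemble_bound (wm wg k m B Bq b h t q sA a E : R) :
  0 < B -> 0 < Bq -> 0 < k -> 0 < m -> 0 < b -> 0 < h -> 0 < t -> 0 < q -> 0 < sA -> 0 < a ->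
  0 <= wg -> wg <= wm -> B <= b * t * sA -> Bq <= 4 * h * q * sA -> sA ^+ 2 <= a * m ->
  E <= (t * q)^-1 ->
  wg * k / (8 * h * b * a) * E <= B^-1 * wm * (k * m) / (2 * Bq).
Proof.
move=> B0 Bq0 k0 m0 b0 h0 t0 q0 sA0 a0 wg0 wgm hB hBq hA hE.
have den0 : 0 < 8 * h * b * a by rewrite !mulr_gt0.
apply: (@le_trans _ _ (wg * k / (8 * h * b * a) * (t * q)^-1)).
  by rewrite ler_wpM2l// divr_ge0 ?mulr_ge0 ?(ltW k0)// ltW.
apply: (@le_trans _ _ (wg * (k * m) / (2 * (B * Bq)))); last first.
  rewrite (_ : B^-1 * wm * _ / _ = wm * (k * m) / (2 * (B * Bq))); last by field; rewrite !gt_eqF.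
  rewrite ler_pM2r ?invr_gt0 ?mulr_gt0//.
  by rewrite ler_pM2r ?mulr_gt0.
have BB : 2 * (B * Bq) <= 8 * h * b * a * m * (t * q).
  apply: (@le_trans _ _ (2 * ((b * t * sA) * (4 * h * q * sA)))).
    by rewrite ler_pM2l//; apply: ler_pM => //; exact: ltW.
  rewrite (_ : 2 * _ = 8 * h * b * t * q * sA ^+ 2); last by ring.
  rewrite (_ : 8 * h * b * a * m * (t * q) = 8 * h * b * t * q * (a * m)); last by ring.
  by rewrite ler_pM2l// !mulr_gt0.
rewrite (_ : wg * k / (8 * h * b * a) * (t * q)^-1 = wg * (k * m) / (8 * h * b * a * m * (t * q))); last first.
  by field; rewrite !gt_eqF.
rewrite ler_wpM2l ?mulr_ge0 ?(ltW k0) ?(ltW m0)//.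
by rewrite lef_pV2 ?posrE// !mulr_gt0.
Qed.

End constants.

Lemma conjugate_ge1 (R : realType) (q : \bar R) (q' : R) : (1 < q)%E ->
  (q^-1 + (q'%:E)^-1 = 1)%E -> 1 <= q'.
Proof. by move=> q1 /(conjugate_exponents q1)[[_ ->]|[r [_ _ /ltW]]]. Qed.

Section final.
Context {R : realType} {n : nat}.
Local Notation N := (n.+1 + n.+1)%N.
Local Notation S := (sphere R n).
Local Notation nu := (sphere_vol R n).
Variables (d : nat) (gamma : R).
Hypotheses (dE : d = (N - 1)%N) (gamma0 : 0 < gamma).

Let d_gt0 : (0 < d)%N. Proof. by rewrite dE addSn addnS subn1. Qed.

(** Here theta_M <= d M^2, because (d - 1) (M - 1) >= 0, and M <= (a m)^(1/d). *)
Lemma theta_power_bound (M : nat) (a m : R) : (0 < M)%N -> 0 < a -> 0 < m -> M%:R ^+ d <= a * m ->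
  (d%:R `^ (gamma / 2) * a `^ (gamma / d%:R))^-1 * m `^ (- (gamma / d%:R)) <=
  theta R d M `^ (- (gamma / 2)).
Proof.
move=> M0 a0 m0 hM; have M1 : (1 : R) <= M%:R by rewrite ler1n.
have g2 : 0 <= gamma / 2 by rewrite divr_ge0// ltW.
have d0 : d%:R != 0 :> R by rewrite pnatr_eq0 -lt0n.
have dp : 0 < d%:R :> R by rewrite ltr0n.
have d1 : 1 <= d%:R :> R by rewrite ler1n.
have th0 := theta_gt0 (R := R) dE M0.
rewrite !powRN -invfM lef_pV2 ?posrE ?mulr_gt0 ?powR_gt0//.
have Mle : M%:R <= (a * m) `^ (d%:R^-1).
  rewrite (_ : M%:R = (M%:R ^+ d) `^ (d%:R^-1)); last first.
    by rewrite -powR_mulrn// -powRrM mulfV// powRr1.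
  by apply: ge0_ler_powR => //; rewrite nnegrE ?exprn_ge0// mulr_ge0// ltW.
have thle : theta R d M <= d%:R * ((a * m) `^ (d%:R^-1)) ^+ 2.
  apply: (@le_trans _ _ (d%:R * M%:R ^+ 2)).
    rewrite /theta expr2 mulrCA ler_pM2l; last by rewrite ltr0n.
    have : 0 <= (d%:R - 1) * (M%:R - 1) :> R by rewrite mulr_ge0//; lra.
    by lra.
  by rewrite ler_pM2l; [rewrite lerXn2r ?nnegrE ?powR_ge0//; lra|lra].
apply: (@le_trans _ _ ((d%:R * ((a * m) `^ (d%:R^-1)) ^+ 2) `^ (gamma / 2))).
  apply: ge0_ler_powR => //; rewrite nnegrE ?(ltW th0)//.
  by rewrite mulr_ge0// ?sqr_ge0//.
rewrite powRM ?sqr_ge0//.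
rewrite -powR_mulrn ?powR_ge0// -!powRrM.
rewrite (_ : d%:R^-1 * (2 * (gamma / 2)) = gamma / d%:R); last by field.
by rewrite powRM ?(ltW a0) ?(ltW m0)// mulrA.
Qed.

Variables (dim : nat -> nat) (Y : forall k, 'I_(dim k) -> S -> R) (xi : nat -> S -> R) (deg : nat -> nat).
Hypothesis hs : harmonic_system d xi deg.
Hypothesis hdeg : forall k (j : 'I_(dim k)), exists i, xi i = Y j /\ deg i = k.

(** Let s be least with D <= s^d. A degree above d (s - 1) at an index below D would force s^d < D
    by [degree_count], and minimality gives (s - 1)^d < D. *)
Lemma degree_bound D : (2 <= D)%N -> exists M, [/\ (0 < M)%N, forall i : 'I_D, (deg i <= M)%N &
  (M ^ d <= d ^ d * D)%N].
Proof.
move=> D2; have dd : d = (n + n.+1)%N by rewrite dE addSn subn1.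
have ex : exists s, (D <= s ^ d)%N.
  by exists D; rewrite -[X in (X <= _)%N]expn1 leq_pexp2l// ltnW.
have [s hsD hmin] := ex_minnP ex.
have s2 : (2 <= s)%N.
  case: s hsD {hmin} => [|[|s]]//; rewrite ?exp0n ?exp1n//.
    by move=> h; have := leq_trans D2 h.
  by move=> h; have := leq_trans D2 h.
exists (d * s.-1)%N; split.
- by rewrite muln_gt0 d_gt0 -ltnS prednK// ltnW.
- move=> i; rewrite leqNgt; apply/negP; rewrite dd => h.
  have := degree_count dE hs (ltnW s2) h; rewrite -dd => h2.
  by have := leq_trans hsD h2; rewrite leqNgt ltn_ord.
rewrite expnMn leq_mul2l; apply/orP; right; rewrite ltnW// ltnNge.
by apply/negP => /hmin; rewrite leqNgt prednK ?leqnn// ltnW.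
Qed.

Local Notation kappa := (@kernel_const R n d).
Variables (m D K c0 M : nat) (a : R).
Hypotheses (KE : K = (64 + c0)%N) (m2 : (2 <= m)%N) (DE : D = (4 * (K * m))%N).
Hypotheses (hc0 : kappa <= c0%:R) (M0 : (0 < M)%N) (degM : forall i : 'I_D, (deg i <= M)%N).
Hypothesis hM : M%:R ^+ d <= a * m%:R.
Local Notation A := (kappa * M%:R ^+ d).
Local Notation u := (@positive_degree R deg D).

Let A_gt0 : 0 < A.
Proof. by rewrite mulr_gt0 ?kernel_const_gt0// exprn_gt0// ltr0n. Qed.

Let sA_gt0 : 0 < Num.sqrt A. Proof. by rewrite sqrtr_gt0. Qed.

Let u_square_sum z : \sum_i (u i * xi i z) ^+ 2 <= A.
Proof. by apply: (xi_square_sum dE hs M0 degM) => i; exact: positive_degree_le1. Qed.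

Local Notation h := (1 + 2 * 2 * expR 2 : R).

Let h_gt0 : 0 < h. Proof. by rewrite addr_gt0// !mulr_gt0// expR_gt0. Qed.

Let b k := h * (2 * k%:R * Num.sqrt A).

Let b_gt0 k : (0 < k)%N -> 0 < b k.
Proof. by move=> k0; rewrite !mulr_gt0// ltr0n. Qed.

Let b_le k (x : R) : 1 <= x -> k%:R <= x + 1 -> b k <= 4 * h * x * Num.sqrt A.
Proof.
move=> x1 kx; rewrite (_ : b k = 2 * h * Num.sqrt A * k%:R); last by rewrite /b; ring.
rewrite (_ : 4 * _ * _ * _ = 2 * h * Num.sqrt A * (2 * x)); last by ring.
by rewrite ler_pM2l ?mulr_gt0//; lra.
Qed.

Let moment_le_b k : (0 < k)%N -> 2 * moment_const k A <= b k ^+ k.*2.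
Proof. by move=> k0; exact: moment_const_le. Qed.

Lemma finite_width (p : R) (q : \bar R) (q' : R) : 1 < p -> (1 < q)%E ->
  (q^-1 + (q'%:E)^-1 = 1)%E -> exists B Bq : R,
  [/\ 0 < B, 0 < Bq, B <= 8 * h * p * Num.sqrt A, Bq <= 4 * h * q' * Num.sqrt A &
  ((B^-1 * theta R d M `^ (- (gamma / 2)) * (K * m)%:R / (2 * Bq))%:E <=
    m_term_width (sobolev_class d Y gamma p%:E) xi m (fun f => 'N[nu]_q[EFin \o f]))%E].
Proof.
move=> p1 q1 qq'; have q'1 := conjugate_ge1 q1 qq'.
have p0 : 0 <= p by lra.
have q'0 : 0 <= q' by lra.
have [s [s0 ps sp]] := exists_nat_ceil p0; have [t [t0 qt tq]] := exists_nat_ceil q'0.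
(* Here s <= p + 1 and t <= q' + 1, and moments of orders 2s >= p and 2t >= q' control the two
   norms. The 2 in the first witness compensates the factor lost in [Lnorm_le_moment]; the statement
   to be proved already has it for Bq. *)
exists (2 * b s), (b t); split.
- by rewrite mulr_gt0// b_gt0.
- exact: b_gt0.
- rewrite (_ : 8 * _ * _ * _ = 2 * (4 * h * p * Num.sqrt A)); last by ring.
  by rewrite ler_pM2l//; apply: b_le => //; exact: ltW.
- exact: b_le.
pose T := [set e : {ffun 'I_D -> bool} |
  (sint (fun z => signed_sum xi u e z ^+ s.*2) <= 2 * moment_const s A)%R]%SET.
have Kc : (64 + c0 <= K)%N by rewrite KE.
have q't : q' <= (t.*2)%:R by apply: (le_trans qt); rewrite ler_nat -addnn leq_addr.
have B0 : 0 < 2 * b s by rewrite mulr_gt0// b_gt0.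
apply: (width_lower_bound dE hs hdeg gamma0 DE Kc m2 M0 degM hc0 B0
  (moment_typical hs A_gt0 u_square_sum s) _ q1 qq' q't (b_gt0 t0) (moment_le_b t0)).
- move=> e; rewrite inE => he; have bS := bms_signed_sum hs u e.
  rewrite (_ : 1%E = (2 * (1 / 2))%:E :> \bar R); last by congr EFin; field.
  apply: (@Lnorm_le_moment _ _ _ _ _ s) => //.
  + exact: bmsZ.
  + exact: ltW.
  + by apply: (le_trans ps); rewrite ler_nat -addnn leq_addr.
  have -> : (fun z => ((2 * b s)^-1 * signed_sum xi u e z) ^+ s.*2) =
      (fun z => ((2 * b s)^-1 ^+ s.*2) * signed_sum xi u e z ^+ s.*2).
    by apply/funext => z; rewrite exprMn.
  rewrite sintZ; last exact: bmsX.
  rewrite -(ler_pM2l (_ : 0 < (2 * b s) ^+ s.*2)); last by rewrite exprn_gt0// mulr_gt0// b_gt0.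
  rewrite mulrA -exprMn mulfV ?expr1n ?mul1r; last by rewrite gt_eqF// mulr_gt0// b_gt0.
  rewrite -exprMn (_ : 2 * b s * 2^-1 = b s); last by field.
  by apply: (le_trans he); exact: moment_le_b.
Qed.

Local Notation g := (1 + 2 * (2 * kappa * a) * expR 2 : R).

Lemma infinite_width (q : \bar R) (q' : R) : (1 < q)%E ->
  (q^-1 + (q'%:E)^-1 = 1)%E -> exists B Bq : R,
  [/\ 0 < B, 0 < Bq, B <= 6 * g * expR 1 * ln m%:R * Num.sqrt A, Bq <= 4 * h * q' * Num.sqrt A &
  ((B^-1 * theta R d M `^ (- (gamma / 2)) * (K * m)%:R / (2 * Bq))%:E <=
    m_term_width (sobolev_class d Y gamma +oo%E) xi m (fun f => 'N[nu]_q[EFin \o f]))%E].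
Proof.
move=> q1 qq'; have q'1 := conjugate_ge1 q1 qq'.
have q'0 : 0 <= q' by lra.
have m0 : 0 < m%:R :> R by rewrite ltr0n ltnW.
have a0 : 0 < a.
  by rewrite -(pmulr_lgt0 _ m0); apply: lt_le_trans hM; rewrite exprn_gt0// ltr0n.
have k0 : 0 < kappa by exact: kernel_const_gt0.
have lnm : 1 / 2 <= ln (m%:R : R).
  by apply: (le_trans ln2_ge_half); rewrite ler_ln ?posrE// ler_nat.
have lnm0 : 0 <= ln (m%:R : R) by lra.
(* With s >= ln m one has m <= e^s, and ln m >= 1/2 gives s <= ln m + 1 <= 3 ln m. *)
have [s [s0 ms sm]] := exists_nat_ceil lnm0; have [t [t0 qt tq]] := exists_nat_ceil q'0.
have e0 := expR_gt0 (1 : R).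
have c0' : 0 <= 2 * kappa * a := mulr_ge0 (mulr_ge0 (ler0n R 2) (ltW k0)) (ltW a0).
have g0 : 0 < g.
  by rewrite ltr_wpDr//; apply: mulr_ge0 (expR_ge0 _); exact: mulr_ge0.
(* One factor e comes from the values in the shell, the other absorbs m <= e^s. *)
pose B := g * (2 * s%:R * Num.sqrt (expR 1 * (expR 1 * A))).
have BE : B = 2 * g * expR 1 * Num.sqrt A * s%:R.
  have sqe : Num.sqrt (expR 1 * (expR 1 * A)) = expR 1 * Num.sqrt A.
    by rewrite mulrA -expr2 sqrtrM ?sqr_ge0// sqrtr_sqr ger0_norm// ltW.
  by rewrite /B sqe; ring.
have B0 : 0 < B by rewrite BE !mulr_gt0// ltr0n.
exists B, (b t); split => //.
- exact: b_gt0.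
- rewrite BE (_ : 6 * _ * _ * _ * _ = 2 * g * expR 1 * Num.sqrt A * (3 * ln m%:R)); last by ring.
  by rewrite ler_pM2l ?mulr_gt0//; lra.
- exact: b_le.
pose T := [set e : {ffun 'I_D -> bool} | `[< forall z, (signed_sum xi u e z ^+ s.*2 <=
    2 * kappa * M%:R ^+ d * moment_const s (expR 1 * A))%R >]]%SET.
have Kc : (64 + c0 <= K)%N by rewrite KE.
have q't : q' <= (t.*2)%:R by apply: (le_trans qt); rewrite ler_nat -addnn leq_addr.
apply: (width_lower_bound dE hs hdeg gamma0 DE Kc m2 M0 degM hc0 B0
  (sup_typical dE hs A_gt0 u_square_sum M0 (fun i _ => degM i) s0) _ q1 qq' q't (b_gt0 t0)).
- move=> e; rewrite inE => /asboolP he; apply: Lnorm_infty_le => z.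
  rewrite normrM ger0_norm ?invr_ge0 ?(ltW B0)// mulrC ler_pdivrMr// mul1r.
  rewrite -(ler_pXn2r (n := s.*2)) ?double_gt0// ?nnegrE ?(ltW B0)//.
  rewrite -normrX ger0_norm; last by rewrite -mul2n exprM exprn_ge0// sqr_ge0.
  apply: (le_trans (he z)).
  have eA0 : 0 < expR 1 * A by rewrite mulr_gt0.
  have eeA0 : 0 < expR 1 * (expR 1 * A) by rewrite mulr_gt0.
  apply: le_trans (moment_const_le eeA0 c0' s0).
  apply: (@le_trans _ _ (2 * kappa * a * (m%:R * moment_const s (expR 1 * A)))).
    rewrite [leRHS](_ : _ = 2 * kappa * (a * m%:R) * moment_const s (expR 1 * A)); last by ring.
    rewrite ler_pM2r ?moment_const_gt0// ler_pM2l// mulr_gt0//.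
  by rewrite ler_wpM2l// moment_const_expR.
- exact: moment_le_b.
Qed.

End final.

(* The unit sphere of C^(n+1), of real dimension d = 2(n+1) - 1: every odd
   d >= 3 is of this form. *)
Theorem theorem2 (R : realType) (d n : nat) (gamma : R) :
  (3 <= d)%N -> d = (2 * n.+1 - 1)%N -> 0 < gamma ->
  exists C1 C2 C3 : R, [/\ 0 < C1, 0 < C2, 0 < C3 &
    forall (dim : nat -> nat) (Y : forall k, 'I_(dim k) -> sphere R n -> R)
      (xi : nat -> sphere R n -> R),
      harmonic_bases d Y -> harmonic_enumeration Y xi ->
      forall m : nat, (2 <= m)%N ->
        (forall p q q' : R, 1 < p -> 1 < q -> q^-1 + q'^-1 = 1 ->
          ((C1 * m%:R `^ (- (gamma / d%:R)) *
              (p `^ (1 / 2) * 2 `^ (C2 * q' `^ (1 / 2))) `^ (- C3))%:E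
            <= m_term_width (sobolev_class d Y gamma p%:E) xi m
                 (fun f => 'N[sphere_vol R n]_q%:E[EFin \o f]))%E) /\
        (forall (q : \bar R) (q' : R),
          (1 < q)%E -> (q^-1 + (q'%:E)^-1 = 1)%E ->
          ((C1 * m%:R `^ (- (gamma / d%:R)) *
              (ln m%:R `^ (1 / 2) * 2 `^ (C2 * q' `^ (1 / 2))) `^ (- C3))%:E
            <= m_term_width (sobolev_class d Y gamma +oo%E) xi m
                 (fun f => 'N[sphere_vol R n]_q[EFin \o f]))%E)].
Proof.
move=> d3 dE' gamma0.
have dE : d = (n.+1 + n.+1 - 1)%N by rewrite dE' mul2n addnn.
have d0 : (0 < d)%N by apply: leq_trans d3.
set kappa := @kernel_const R n d; have k0 : 0 < kappa by exact: kernel_const_gt0.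
have [c0 [_ hc0 _]] := exists_nat_ceil (ltW k0).
(* 64 serves the union bound and c0 the harmonics of degree 0; a is such that M^d <= d^d D = a m for
   D = 4 K m. *)
pose K := (64 + c0)%N; pose a : R := (d ^ d * (4 * K))%:R.
have K0 : 0 < K%:R :> R by rewrite ltr0n.
have a0 : 0 < a by rewrite ltr0n muln_gt0 expn_gt0 d0.
pose h : R := 1 + 2 * 2 * expR 2.
pose g : R := 1 + 2 * (2 * kappa * a) * expR 2.
(* The sum dominates the constants of both cases, p finite and p = +oo, so that C1 is common to
   them. *)
pose b : R := 8 * h + 6 * g * expR 1.
have e1 := expR_gt0 (1 : R); have e2 := expR_gt0 (2 : R).
have h0 : 0 < h by rewrite addr_gt0// !mulr_gt0.
have ka0 : 0 < kappa * a by exact: mulr_gt0.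
have g0 : 0 < g by rewrite addr_gt0// mulr_gt0// mulr_gt0// -mulrA mulr_gt0.
have b0 : 0 < b by rewrite addr_gt0// !mulr_gt0.
pose w0 : R := (d%:R `^ (gamma / 2) * a `^ (gamma / d%:R))^-1.
have w00 : 0 < w0 by rewrite invr_gt0 mulr_gt0 ?powR_gt0// ltr0n.
exists (w0 * K%:R / (8 * h * b * (kappa * a))), 2, 2; split => //.
  apply: divr_gt0; first exact: mulr_gt0.
  by apply: mulr_gt0 ka0; apply: mulr_gt0 b0; apply: mulr_gt0.
move=> dim Y xi hY hxi m m2.
have [deg [hs _ hdeg]] := harmonic_system_of_bases dE hY hxi.
have m0 : 0 < m%:R :> R by rewrite ltr0n ltnW.
pose D := (4 * (K * m))%N.
have D2 : (2 <= D)%N by apply: (leq_trans m2); rewrite /D mulnA leq_pmull.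
have [M [M0 degM hM]] := degree_bound dE hs D2.
have hMa : M%:R ^+ d <= a * m%:R.
  by rewrite /a -natrM -natrX ler_nat; apply: (leq_trans hM); rewrite /D !mulnA.
have wle := theta_power_bound dE gamma0 M0 a0 m0 hMa.
set A := kappa * M%:R ^+ d.
have A0 : 0 < A by rewrite mulr_gt0// exprn_gt0// ltr0n.
have sA0 : 0 < Num.sqrt A by rewrite sqrtr_gt0.
have sA2 : Num.sqrt A ^+ 2 <= kappa * a * m%:R.
  by rewrite sqr_sqrtr ?(ltW A0)// -mulrA ler_pM2l.
have final (t q' B Bq : R) : 0 < t -> 1 <= q' -> 0 < B -> 0 < Bq ->
    B <= b * t * Num.sqrt A -> Bq <= 4 * h * q' * Num.sqrt A ->
    w0 * K%:R / (8 * h * b * (kappa * a)) * m%:R `^ (- (gamma / d%:R)) *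
      (t `^ (1 / 2) * 2 `^ (2 * q' `^ (1 / 2))) `^ (- 2) <=
    B^-1 * theta R d M `^ (- (gamma / 2)) * (K * m)%:R / (2 * Bq).
  move=> t0 q'1 B0 Bq0 hB hBq; have q'0 : 0 < q' by lra.
  have wg0 : 0 <= w0 * m%:R `^ (- (gamma / d%:R)) by rewrite mulr_ge0 ?powR_ge0// ltW.
  have := assemble_bound B0 Bq0 K0 m0 b0 h0 t0 q'0 sA0 ka0 wg0 wle hB hBq sA2 (factor_le t0 q'0).
  by rewrite natrM; congr (_ * _ <= _); ring.
split=> [p q q' p1 q1 qq'|q q' q1 qq'].
  (* With the real convention that the inverse of 0 is 0, q' = 0 would mean q = 1. It is removed
     before passing to extended inverses, where 0 has inverse +oo. *)
  have q'0 : q' != 0.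
    apply: contraTneq q1 => q'0; move: qq'; rewrite q'0 invr0 addr0 => qq.
    by rewrite -[q]invrK qq invr1 ltxx.
  have q1E : (1 < q%:E)%E by rewrite lte_fin.
  have qqE : ((q%:E)^-1 + (q'%:E)^-1 = 1)%E.
    by rewrite !inver (negbTE q'0) gt_eqF -?EFinD ?qq'//; lra.
  have [B [Bq [B0 Bq0 hB hBq]]] :=
    finite_width dE gamma0 hs hdeg (erefl K) m2 (erefl D) hc0 M0 degM p1 q1E qqE.
  apply: le_trans; rewrite lee_fin; apply: final => //; first by lra.
    exact: conjugate_ge1 q1E qqE.
  apply: (le_trans hB); rewrite ler_pM2r// ler_pM2r; last by lra.
  by rewrite /b lerDl !mulr_ge0// ltW.
have lnm : 0 < ln (m%:R : R).
  have : ln 2 <= ln m%:R :> R by rewrite ler_ln ?posrE// ler_nat.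
  by have := @ln2_ge_half R; lra.
have [B [Bq [B0 Bq0 hB hBq]]] :=
  infinite_width dE gamma0 hs hdeg (erefl K) m2 (erefl D) hc0 M0 degM hMa q1 qq'.
apply: le_trans; rewrite lee_fin; apply: final => //.
  exact: conjugate_ge1 q1 qq'.
apply: (le_trans hB); rewrite ler_pM2r// ler_pM2r//.
by rewrite /b lerDr !mulr_ge0// ltW.
Qed.
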